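(* Let $(x_0,y_0)\in\mathbb{R}^2$ be a saddle point of the Müller–Brown potential $V$ and let $X_0=(x_0,y_0,z_0)\in\mathbb{R}^6$ with $z_0=\psi(x_0,y_0)$. Denote by $\lambda>0$ the unstable eigenvalue of $\mathrm{D}f(X_0)$ and by $v\in\mathbb{R}^6$ an associated eigenvector. Let $\gamma>0$, $N\in\mathbb{N}$ with $N\ge 2$, and $\eta\in\mathbb{R}^6_{>0}$. Assume that $\hat{\mathbf p}=(\mathbf p_0,\dots,\mathbf p_{N-1})\in(\mathbb{R}^6)^N$ satisfies $\mathbf p_0=X_0$, $\mathbf p_1=\gamma v$ and $n\lambda\mathbf p_n=\mathbf f_n(\hat{\mathbf p})$ for all $2\le n<N$. Let $\mathbf T$ be the operator and $Y,Z_1,Z_2,Z_3,Z_4$ the constants defined from these data in the context, and set $$P(r)=\frac{Z_4}{24}r^4+\frac{Z_3}{6}r^3+\frac{Z_2}{2}r^2-(1-Z_1)r+Y,\qquad Q(r)=\frac{Z_4}{6}r^3+\frac{Z_3}{2}r^2+Z_2r-(1-Z_1).$$ Assume there exists $\bar r>0$ such that $P(\bar r)<0$ and $Q(\bar r)<0$. Then there exist $\mathbf p_n\in\mathbb{R}^6$, $n\ge N$, such that $$\sum_{i=1}^6\sum_{n=N}^\infty|\mathbf p_n^{(i)}|\,\eta^{(i)}\le\bar r,$$ and such that the function $p(\theta)=\sum_{n=0}^\infty\mathbf p_n\theta^n$, $\theta\in[-1,1]$, satisfies the invariance equation $$p'(\theta)\lambda\theta=f(p(\theta)),\qquad\theta\in[-1,1],$$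 that is, $p([-1,1])\subset\mathbb{R}^6$ is a local unstable manifold of $X_0$ for the vector field $f$. Besides, $$\left\{(p^{(1)}(\theta),p^{(2)}(\theta)):\ \theta\in[-1,1]\right\}\subset\mathbb{R}^2$$ is a local unstable manifold of $(x_0,y_0)$ for the vector field $-\nabla V$.
   Context: **Potential and extended vector field.** Let $\alpha=(-200,-100,-170,15)$, $\hat x=(1,0,-0.5,-1)$, $\hat y=(0,0.5,1.5,1)$, $a=(-1,-1,-6.5,0.7)$, $b=(0,0,11,0.6)$, $c=(-10,-10,-6.5,0.7)$. For $i=1,\dots,4$, $$\psi^{(i)}(x,y)=\alpha^{(i)}\exp\!\big(a^{(i)}(x-\hat x^{(i)})^2+b^{(i)}(x-\hat x^{(i)})(y-\hat y^{(i)})+c^{(i)}(y-\hat y^{(i)})^2\big),$$ $\psi=(\psi^{(1)},\dots,\psi^{(4)})$, and $V=\sum_{i=1}^4\psi^{(i)}:\mathbb{R}^2\to\mathbb{R}$ (Müller–Brown potential). Put $w^{(i)}_1=2a^{(i)}\hat x^{(i)}+b^{(i)}\hat y^{(i)}$, $w^{(i)}_2=b^{(i)}\hat x^{(i)}+2c^{(i)}\hat y^{(i)}$. For $X=(X^{(1)},\dots,X^{(6)})=(x,y,z^{(1)},\dots,z^{(4)})\in\mathbb{R}^6$ let $L_1^{(i)}(X)=2a^{(i)}X^{(1)}+b^{(i)}X^{(2)}-w_1^{(i)}$, $L_2^{(i)}(X)=b^{(i)}X^{(1)}+2c^{(i)}X^{(2)}-w_2^{(i)}$. The polynomial vector field $f:\mathbb{R}^6\to\mathbb{R}^6$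 is $$f^{(1)}(X)=-\sum_{i=1}^4L_1^{(i)}(X)X^{(i+2)},\quad f^{(2)}(X)=-\sum_{i=1}^4L_2^{(i)}(X)X^{(i+2)},$$ $$f^{(j+2)}(X)=-\Big(L_1^{(j)}(X)\sum_{i=1}^4L_1^{(i)}(X)X^{(i+2)}+L_2^{(j)}(X)\sum_{i=1}^4L_2^{(i)}(X)X^{(i+2)}\Big)X^{(j+2)},\quad j=1,\dots,4.$$ **Saddle.** A saddle point $(x_0,y_0)$ of $V$ is a zero of $\nabla V$ at which $-\mathrm{D}^2V(x_0,y_0)$ has eigenvalues $\lambda>0$ and $\mu<0$; $\mathrm{D}f(X_0)$ then has eigenvalues $\lambda$, $\mu$ and $0$ (algebraic multiplicity 4). $M_n=n\lambda I_6-\mathrm{D}f(X_0)$, invertible for $n\ge 2$. **Local unstable manifold.** $p([-1,1])$ is a local unstable manifold of $X_0$: it is a curve through $X_0=p(0)$, tangent there to the unstable eigenvector, on which the flow $\phi_t$ of $f$ satisfies $\phi_t(p(\theta))=p(e^{\lambda t}\theta)$ for $\theta\in[-1,1]$, $t\le 0$ (so backward orbits stay on the curve and converge to $X_0$); analogously for the planar curve, $(x_0,y_0)$ and $-\nabla V$. **Sequences.** $\mathbb{N}=\{0,1,2,\dots\}$. For $\mathbf p\in(\mathbb{R}^6)^{\mathbb{N}}$, $\mathbf f(\mathbf p)=(\mathbf f_n(\mathbf p))_{n\in\mathbb{N}}$ is the sequence of coefficients of the (formal) power series $f(\sum_n\mathbf p_n\theta^n)$, i.e. products in $f$ are replaced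 by Cauchy products. $\mathbf f_n(\mathbf p)$ depends only on $\mathbf p_0,\dots,\mathbf p_n$. $\pi_n(\mathbf p)=(\mathbf p_0,\dots,\mathbf p_n,0,0,\dots)$; finite sequences are identified with their extension by zeros. $\|\mathbf u\|_1=\sum_n|\mathbf u_n|$, $\|\mathbf q\|_{\mathcal X_\eta}=\sum_{i=1}^6\|\mathbf q^{(i)}\|_1\eta^{(i)}$, and $\mathcal X_\eta$ is the Banach space of $\mathbb{R}^6$-valued sequences with finite norm (here indexed by $n\ge N$). **Operator.** For $\check{\mathbf p}=(\check{\mathbf p}_n)_{n\ge N}\in\mathcal X_\eta$ and $\mathbf p=(\hat{\mathbf p},\check{\mathbf p})$, let $\mathbf g_n(\mathbf p)=\mathbf f_n(\pi_{n-1}(\mathbf p))$ and $\mathbf T_n(\check{\mathbf p})=M_n^{-1}\mathbf g_n(\mathbf p)$, $n\ge N$; $\mathbf T=(\mathbf T_n)_{n\ge N}:\mathcal X_\eta\to\mathcal X_\eta$, $\mathbf g=(\mathbf g_n)_{n\ge N}$. Derivatives of $\mathbf g$ are with respect to $\check{\mathbf p}$, and $\mathrm{D}^k\mathbf g(\hat{\mathbf p})$ is evaluated at $\check{\mathbf p}=0$. $\mathrm{D}^k_{(j_1,\dots,j_k)}\mathbf g^{(i)}(\hat{\mathbf p})$ is the block of $\mathrm{D}^k\mathbf g(\hat{\mathbf p})$ giving the $i$-th component of the output when the $l$-th argument has only its $j_l$-th component nonzero; it is a $k$-linear operator on $\ell^1$ and $\|\cdot\|_1$ denotes its operator norm. **Constants.**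 For $X\in\mathbb{R}^6$, $|X|_\eta=\sum_i|X^{(i)}|\eta^{(i)}$ and $|\cdot|_\eta$ is also the induced matrix norm. Let $\mathcal Q$ be an invertible $6\times6$ matrix with $\mathrm{D}f(X_0)=\mathcal Q^{-1}\mathrm{diag}(\lambda,\mu,0,0,0,0)\mathcal Q$. Define $$\mathfrak M_n=\begin{cases}\dfrac{|\mathcal Q^{-1}|_\eta|\mathcal Q|_\eta}{(n-1)\lambda},& n\le\frac{|\mathrm{D}f(X_0)|_\eta}{\lambda},\\[2mm]\min\Big(\dfrac{1}{n\lambda-|\mathrm{D}f(X_0)|_\eta},\dfrac{|\mathcal Q^{-1}|_\eta|\mathcal Q|_\eta}{(n-1)\lambda}\Big),& n>\frac{|\mathrm{D}f(X_0)|_\eta}{\lambda},\end{cases}$$ $$Y=\sum_{n=N}^{4N-4}\sum_{i=1}^6|\mathbf T_n^{(i)}(0)|\,\eta^{(i)},\qquad Z_1=\mathfrak M_N\max_{1\le j\le6}\frac1{\eta^{(j)}}\sum_{i=1}^6\|\mathrm{D}_j\mathbf g^{(i)}(\hat{\mathbf p})\|_1\,\eta^{(i)},$$ and for $k=2,3,4$ $$Z_k=\mathfrak M_N\max_{1\le j_1,\dots,j_k\le6}\frac{1}{\eta^{(j_1)}\cdots\eta^{(j_k)}}\sum_{i=1}^6\|\mathrm{D}^k_{(j_1,\dots,j_k)}\mathbf g^{(i)}(\hat{\mathbf p})\|_1\,\eta^{(i)}.$$ *)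

(* Defs.v *)
From HB Require Import structures.
From mathcomp Require Import all_boot all_order all_algebra.
From mathcomp Require Import all_classical all_reals all_analysis.
Set Implicit Arguments.
Unset Strict Implicit.
Unset Printing Implicit Defensive.
Import Order.TTheory GRing.Theory Num.Theory.
Import numFieldNormedType.Exports.
Local Open Scope classical_set_scope.
Local Open Scope ring_scope.

Section Calculus.
Variable R : realType.

Definition Jac m n (F : 'cV[R]_n -> 'cV[R]_m) (X : 'cV[R]_n) : 'M[R]_(m, n) :=
  \matrix_(i, j) ('d F X (delta_mx j 0)) i 0.

Definition grad n (U : 'cV[R]_n -> R^o) (X : 'cV[R]_n) : 'cV[R]_n :=
  \col_i 'd U X (delta_mx i 0).

(* At an end point of an interval A this is the one-sided derivative. *)
Definition has_derivative_within (W : normedModType R) (A : set R)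
    (u : R -> W) (s : R) (d : W) : Prop :=
  (t - s)^-1 *: (u t - u s) @[t --> within A s^'] --> d.

(* u' = F(u) on the closed interval with end points 0 and t. *)
Definition integral_curve n (F : 'cV[R]_n -> 'cV[R]_n) (t : R)
    (u : R -> 'cV[R]_n) : Prop :=
  let I := `[Num.min 0 t, Num.max 0 t] in
  forall s, s \in I -> has_derivative_within [set` I] u s (F (u s)).

(* phi_t(x) is defined (with a unique value) and equals y, where phi is the flow
   of F. *)
Definition flow_eq n (F : 'cV[R]_n -> 'cV[R]_n) (t : R) (x y : 'cV[R]_n) : Prop :=
  (exists2 u, integral_curve F t u & u 0 = x /\ u t = y) /\
  (forall u, integral_curve F t u -> u 0 = x -> u t = y).

(* p([-1,1]) is a local unstable manifold of X for F, where lambda is the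
   unstable eigenvalue of DF(X). *)
Definition local_unstable_manifold n (F : 'cV[R]_n -> 'cV[R]_n) (X : 'cV[R]_n)
    (lambda : R) (p : R -> 'cV[R]_n) : Prop :=
  [/\ {within `[-1, 1], continuous p},
      p 0 = X,
      (exists w : 'cV[R]_n, [/\ w != 0, Jac F X *m w = lambda *: w &
         has_derivative_within `[-1, 1] p 0 w]) &
      forall theta t, theta \in `[-1, 1] -> t <= 0 ->
        flow_eq F t (p theta) (p (expR (lambda * t) * theta))].

End Calculus.

Section MuellerBrown.
Variable R : realType.

Definition alpha (i : 'I_4) : R := [:: -200; -100; -170; 15]`_i.
Definition xhat (i : 'I_4) : R := [:: 1; 0; - (1 / 2); -1]`_i.
Definition yhat (i : 'I_4) : R := [:: 0; 1 / 2; 3 / 2; 1]`_i.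
Definition a (i : 'I_4) : R := [:: -1; -1; - (13 / 2); 7 / 10]`_i.
Definition b (i : 'I_4) : R := [:: 0; 0; 11; 3 / 5]`_i.
Definition c (i : 'I_4) : R := [:: -10; -10; - (13 / 2); 7 / 10]`_i.

Definition psi (i : 'I_4) (x y : R) : R :=
  alpha i * expR (a i * (x - xhat i) ^+ 2 + b i * (x - xhat i) * (y - yhat i)
                  + c i * (y - yhat i) ^+ 2).

Definition V (q : 'cV[R]_2) : R^o := \sum_(i < 4) psi i (q 0 0) (q 1 0).

(* q is a saddle point of V at which -D^2V(q) has eigenvalues lambda and mu.
   (eigenvalue uses row eigenvectors, which gives the same spectrum.) *)
Definition saddle_point (q : 'cV[R]_2) (lambda mu : R) : Prop :=
  [/\ grad V q = 0, 0 < lambda, mu < 0,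
      eigenvalue (- Jac (grad V) q) lambda & eigenvalue (- Jac (grad V) q) mu].

Definition w1 (i : 'I_4) : R := 2 * a i * xhat i + b i * yhat i.
Definition w2 (i : 'I_4) : R := b i * xhat i + 2 * c i * yhat i.

(* The formulas for f, over an R-module A with product mul and unit one: A = R
   gives f, sequences with the Cauchy product give the coefficients of f applied
   to a formal power series. R^6 is seen as R^2 x R^4, so that z^(i) has index
   rshift 2 i. *)
Section VectorField.
Variables (A : lmodType R) (mul : A -> A -> A) (one : A) (X : 'I_6 -> A).

Let x := X (lshift 4 (0 : 'I_2)).
Let y := X (lshift 4 (1 : 'I_2)).
Let z (i : 'I_4) := X (rshift 2 i).

Definition L1 (i : 'I_4) : A := (2 * a i) *: x + b i *: y - w1 i *: one.
Definition L2 (i : 'I_4) : A := b i *: x + (2 * c i) *: y - w2 i *: one.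
Definition S1 : A := \sum_(i < 4) mul (L1 i) (z i).
Definition S2 : A := \sum_(i < 4) mul (L2 i) (z i).

Definition field_over (i : 'I_6) : A :=
  match fintype.split (i : 'I_(2 + 4)) with
  | inl k => if k == 0 then - S1 else - S2
  | inr j => - mul (mul (L1 j) S1 + mul (L2 j) S2) (z j)
  end.

End VectorField.

Definition f (X : 'cV[R]_6) : 'cV[R]_6 :=
  \col_i field_over (A := R^o) *%R 1 (fun k => X k 0) i.

Definition cauchy (u v : nat -> R^o) : nat -> R^o :=
  fun n => \sum_(k < n.+1) u k * v (n - k)%N.

Definition cauchy1 : nat -> R^o := fun n => (n == 0%N)%:R.

Definition component (i : 'I_6) (p : nat -> 'cV[R]_6) : nat -> R^o := fun n => p n i 0.

Definition fcoef (p : nat -> 'cV[R]_6) (n : nat) : 'cV[R]_6 :=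
  \col_i field_over cauchy cauchy1 (fun k => component k p) i n.

(* The projection pi_n. *)
Definition trunc (n : nat) (p : nat -> 'cV[R]_6) : nat -> 'cV[R]_6 :=
  fun m => if (m <= n)%N then p m else 0.

End MuellerBrown.

Section SequenceSpace.
Variable R : realType.
Implicit Types (u v : nat -> R) (q : nat -> 'cV[R]_6).

Definition norm1 u : \bar R := (\sum_(0 <= n <oo) `|u n|%:E)%E.

Lemma norm1_ge0 u : (0 <= norm1 u)%E.
Proof. by apply: nneseries_ge0 => n _ _; rewrite lee_fin. Qed.

Lemma norm10 : norm1 (fun=> 0) = 0%E.
Proof. by rewrite /norm1; apply: eseries0 => n _ _; rewrite normr0. Qed.

Lemma norm1D u v : (norm1 (fun n => (u n + v n)%R) <= norm1 u + norm1 v)%E.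
Proof.
rewrite /norm1 -nneseriesD; try by move=> *; rewrite lee_fin.
apply: lee_nneseries => n *; first by rewrite lee_fin.
by rewrite -EFinD lee_fin ler_normD.
Qed.

Lemma norm1Z l u : (norm1 (fun n => (l * u n)%R) = `|l|%:E * norm1 u)%E.
Proof.
rewrite /norm1 -nneseriesZl; last by move=> *; rewrite lee_fin.
by apply: eq_eseriesr => n _; rewrite normrM EFinM.
Qed.

Lemma norm1_ge u n : (`|u n|%:E <= norm1 u)%E.
Proof.
rewrite /norm1; apply: le_trans (nneseries_lim_ge n.+1 _); last first.
  by move=> *; rewrite lee_fin.
rewrite big_nat_recr//= leeDr// sume_ge0// => *; by rewrite lee_fin.
Qed.

Lemma norm1_ltyP u :
  (norm1 u < +oo)%E <-> exists C, forall K, \sum_(n < K) `|u n| <= C.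
Proof.
split=> [ufin|[C uC]].
  exists (fine (norm1 u)) => K.
  rewrite -lee_fin fineK; last by rewrite ge0_fin_numE// norm1_ge0.
  rewrite -sumEFin -(big_mkord xpredT (fun n => `|u n|%:E)).
  by apply: nneseries_lim_ge => *; rewrite lee_fin.
apply: (@le_lt_trans _ _ C%:E); last exact: ltry.
apply: lime_le; first by apply: is_cvg_nneseries => *; rewrite lee_fin.
by near=> K; rewrite big_mkord sumEFin lee_fin.
Unshelve. all: by end_near. Qed.

Variable eta : 'I_6 -> {posnum R}.

Definition eta_norm q : \bar R :=
  (\sum_(i < 6) norm1 (component i q) * ((eta i)%:num)%:E)%E.

Definition Xeta_pred : {pred nat -> 'cV[R]_6} := fun q => (eta_norm q < +oo)%E.

Lemma eta_normD q r :
  (eta_norm (q + r)%R <= eta_norm q + eta_norm r)%E.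
Proof.
rewrite /eta_norm -big_split/=; apply: lee_sum => i _.
rewrite -ge0_muleDl ?norm1_ge0// lee_pmul2r ?fin_numE// ?lte_fin//.
rewrite (_ : component i (q + r) = fun n => component i q n + component i r n) ?norm1D//.
by apply/funext => n; rewrite /component mxE.
Qed.

Lemma eta_normZ l q : (eta_norm (l *: q)%R = `|l|%:E * eta_norm q)%E.
Proof.
rewrite /eta_norm ge0_sume_distrr; last first.
  by move=> i _; rewrite mule_ge0 ?norm1_ge0// lee_fin.
apply: eq_bigr => i _; rewrite muleA -norm1Z; congr (norm1 _ * _)%E.
by apply/funext => n; rewrite /component mxE.
Qed.

Lemma eta_norm_ge0 q : (0 <= eta_norm q)%E.
Proof. by apply: sume_ge0 => i _; rewrite mule_ge0 ?norm1_ge0// lee_fin. Qed.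

Lemma eta_norm_eq0 q : eta_norm q = 0%E -> q = 0.
Proof.
move=> q0; apply/funext => n; apply/colP => i; rewrite mxE.
apply/normr0_eq0/eqP; rewrite eq_le normr_ge0 andbT -lee_fin.
rewrite -(pmule_lle0 _ (_ : 0 < ((eta i)%:num)%:E)%E)//.
have <- : eta_norm q = 0%E by [].
rewrite /eta_norm (bigD1 i)//= (le_trans _ (leeDl _ _))//.
  by rewrite lee_pmul2r// (norm1_ge (component i q) n).
by apply: sume_ge0 => j _; rewrite mule_ge0 ?norm1_ge0// lee_fin.
Qed.

Lemma Xeta_submod_closed : submod_closed Xeta_pred.
Proof.
split=> [|l q r qfin rfin].
  rewrite unfold_in /eta_norm big1 ?ltry// => i _.
  rewrite (_ : component i 0 = fun=> 0) ?norm10 ?mul0e//.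
  by apply/funext => n; rewrite /component mxE.
rewrite unfold_in (le_lt_trans (eta_normD _ _))// eta_normZ lte_add_pinfty//.
by rewrite lte_mul_pinfty// lee_fin.
Qed.

HB.instance Definition _ :=
  GRing.isSubmodClosed.Build R (nat -> 'cV[R]_6) Xeta_pred Xeta_submod_closed.

(* The Banach space X_eta. *)
Record Xeta := MkXeta { Xeta_val :> nat -> 'cV[R]_6 ; _ : Xeta_val \in Xeta_pred }.

HB.instance Definition _ := [isSub for Xeta_val].
HB.instance Definition _ := [Choice of Xeta by <:].
HB.instance Definition _ := [SubChoice_isSubLmodule of Xeta by <:].

Definition Xeta_norm (q : Xeta) : R := fine (eta_norm q).

Lemma Xeta_normE (q : Xeta) : (Xeta_norm q)%:E = eta_norm q.
Proof. by rewrite fineK// ge0_fin_numE ?eta_norm_ge0//; case: q. Qed.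

Lemma Xeta_normD (q r : Xeta) : Xeta_norm (q + r) <= Xeta_norm q + Xeta_norm r.
Proof. by rewrite -lee_fin EFinD !Xeta_normE eta_normD. Qed.

Lemma Xeta_normZ (l : R) (q : Xeta) : Xeta_norm (l *: q) = `|l| * Xeta_norm q.
Proof. by apply/EFin_inj; rewrite EFinM !Xeta_normE eta_normZ. Qed.

Lemma Xeta_norm_eq0 (q : Xeta) : Xeta_norm q = 0 -> q = 0.
Proof.
by move=> q0; apply/val_inj/eta_norm_eq0; rewrite -Xeta_normE q0.
Qed.

HB.instance Definition _ :=
  @Lmodule_isNormed.Build R Xeta Xeta_norm Xeta_normD Xeta_normZ Xeta_norm_eq0.

End SequenceSpace.

Section Summability.
Variable R : realType.
Implicit Types (s u v : nat -> R^o) (U W : nat -> nat -> R^o).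

(* A family of sequences dominated by one summable sequence. *)
Definition dominated U :=
  exists2 s, (norm1 s < +oo)%E & forall n m, `|U n m| <= s m.

Lemma dominated_diag U :
  dominated U -> (norm1 (fun n => U n n) < +oo)%E.
Proof.
move=> [s sfin Us]; apply: le_lt_trans sfin; apply: lee_nneseries => n *.
  by rewrite lee_fin.
by rewrite lee_fin (le_trans (Us n n))// ler_norm.
Qed.

Lemma dominatedD U W :
  dominated U -> dominated W -> dominated (fun n => U n + W n).
Proof.
move=> [s sfin Us] [t tfin Wt]; exists (fun n => s n + t n).
  by rewrite (le_lt_trans (norm1D _ _))// lte_add_pinfty.
by move=> n m; rewrite (le_trans (ler_normD _ _))// lerD.
Qed.

Lemma dominatedZ (l : R) U : dominated U -> dominated (fun n => l *: U n).
Proof.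
move=> [s sfin Us]; exists (fun n => `|l| * s n).
  by rewrite norm1Z lte_mul_pinfty// lee_fin.
by move=> n m; rewrite normrM ler_wpM2l.
Qed.

Lemma dominated_sum (I : Type) (r : seq I) (U : I -> nat -> nat -> R^o) :
  (forall i, dominated (U i)) -> dominated (fun n => \sum_(i <- r) U i n).
Proof.
move=> dU; elim: r => [|i r IH].
  exists (fun=> 0); first by rewrite norm10 ltry.
  by move=> n m; rewrite big_nil normr0.
under [X in dominated X]eq_fun do rewrite big_cons.
exact: dominatedD.
Qed.


Lemma cauchy_norm1 u v :
  (norm1 u < +oo)%E -> (norm1 v < +oo)%E -> (norm1 (cauchy u v) < +oo)%E.
Proof.
move=> /norm1_ltyP[C uC] /norm1_ltyP[D vD]; apply/norm1_ltyP; exists (C * D) => K.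
have C0 : 0 <= C by apply: le_trans (uC 0%N); rewrite big_ord0.
have D0 : 0 <= D by apply: le_trans (vD 0%N); rewrite big_ord0.
apply: (@le_trans _ _ (\sum_(n < K) \sum_(k < K | (k <= n)%N) `|u k| * `|v (n - k)%N|)).
  apply: ler_sum => n _; rewrite /cauchy (le_trans (ler_norm_sum _ _ _))//.
  rewrite (big_ord_widen_cond K xpredT (fun k => `|u k * v (n - k)%N|))//.
  by apply: ler_sum => k _; rewrite normrM.
rewrite (exchange_big_dep xpredT)//=.
apply: (@le_trans _ _ (\sum_(k < K) `|u k| * D)); last first.
  by rewrite -mulr_suml ler_wpM2r.
apply: ler_sum => k _; rewrite -mulr_sumr ler_wpM2l// (le_trans _ (vD K))//.
rewrite -(big_mkord (fun n => (k <= n)%N) (fun n => `|v (n - k)%N|)).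
rewrite -(big_mkord xpredT (fun n => `|v n|)).
rewrite (big_cat_nat (n := k)) ?(ltnW (ltn_ord k))//= big_nat_cond big_pred0.
  rewrite add0r big_nat_cond.
  rewrite (eq_bigl (fun n => (k <= n < K)%N)); last first.
    by move=> n; case: (leqP k n) => //= _; rewrite andbT.
  rewrite -big_nat -{1}[nat_of_ord k]add0n big_addn.
  rewrite [leRHS](big_cat_nat (n := (K - k)%N)) ?leq_subr//=.
  under eq_bigr do rewrite addnK.
  by rewrite lerDl sumr_ge0.
by move=> n; case: (leqP k n) => kn; rewrite ?andbF//= andbT.
Qed.

Lemma dominated_cauchy U W :
  dominated U -> dominated W -> dominated (fun n => cauchy (U n) (W n)).
Proof.
move=> [s sfin Us] [t tfin Wt]; exists (cauchy s t); first exact: cauchy_norm1.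
move=> n m; rewrite (le_trans (ler_norm_sum _ _ _))//; apply: ler_sum => k _.
by rewrite normrM ler_pM.
Qed.

Lemma dominated_field (X : 'I_6 -> nat -> nat -> R^o) (i : 'I_6) :
  (forall k, dominated (X k)) ->
  dominated (fun n => field_over (@cauchy R) (@cauchy1 R) (fun k => X k n) i).
Proof.
move=> dX.
have d1 : dominated (fun=> @cauchy1 R).
  exists (@cauchy1 R); last first.
    by move=> _ m; rewrite ger0_norm /cauchy1 ?ler0n.
  apply/norm1_ltyP; exists 1 => K; rewrite -(big_mkord xpredT (fun n => `|cauchy1 R n|)).
  case: K => [|K]; first by rewrite big_nil.
  rewrite big_nat_recl//= normr1 big1 ?addr0// => n _.
  by rewrite /cauchy1 normr0.
have dN U : dominated U -> dominated (fun n => - U n).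
  by move/(dominatedZ (-1)); under [X in dominated X -> _]eq_fun do rewrite scaleN1r.
have dB U W : dominated U -> dominated W -> dominated (fun n => U n - W n).
  by move=> dU dW; apply: dominatedD => //; exact: dN.
have dL1 j : dominated (fun n => L1 (@cauchy1 R) (fun k => X k n) j).
  by apply: dB; [apply: dominatedD|]; apply: dominatedZ.
have dL2 j : dominated (fun n => L2 (@cauchy1 R) (fun k => X k n) j).
  by apply: dB; [apply: dominatedD|]; apply: dominatedZ.
have dS1 : dominated (fun n => S1 (@cauchy R) (@cauchy1 R) (fun k => X k n)).
  by apply: dominated_sum => j; apply: dominated_cauchy.
have dS2 : dominated (fun n => S2 (@cauchy R) (@cauchy1 R) (fun k => X k n)).
  by apply: dominated_sum => j; apply: dominated_cauchy.
rewrite /field_over; case: (fintype.split _) => [k|j].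
  by case: eqP => _; exact: dN.
apply: dN; apply: dominated_cauchy => //.
by apply: dominatedD; apply: dominated_cauchy.
Qed.

Lemma fcoef_trunc_norm1 (p : nat -> 'cV[R]_6) (i : 'I_6) :
  (forall k, norm1 (component k p) < +oo)%E ->
  (norm1 (component i (fun n => fcoef (trunc n.-1 p) n)) < +oo)%E.
Proof.
move=> pfin.
suff : dominated (fun n => field_over (@cauchy R) (@cauchy1 R)
    (fun k => component k (trunc n.-1 p)) i).
  move=> /dominated_diag; congr (norm1 _ < _)%E.
  by apply/funext => n; rewrite /component mxE.
apply: dominated_field => k; exists (fun n => `|component k p n|).
  by rewrite /norm1; under eq_eseriesr do rewrite normr_id; exact: pfin.
by move=> n m; rewrite /component /trunc; case: ifP => // _; rewrite mxE normr0.
Qed.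

Lemma norm1_shift (N : nat) (u : nat -> R) :
  (norm1 u < +oo -> norm1 (fun n => u (N + n)%N) < +oo)%E.
Proof.
move=> /norm1_ltyP[C uC]; apply/norm1_ltyP; exists C => K.
rewrite (le_trans _ (uC (N + K)%N))// big_split_ord/= lerDr.
by rewrite sumr_ge0.
Qed.

Lemma norm1_unshift (N : nat) (u : nat -> R) :
  (norm1 (fun n => u (N + n)%N) < +oo -> norm1 u < +oo)%E.
Proof.
move=> /norm1_ltyP[C uC]; apply/norm1_ltyP.
exists (\sum_(n < N) `|u n| + C) => K.
apply: (@le_trans _ _ (\sum_(n < N + K) `|u n|)).
  rewrite addnC big_split_ord/= lerDl; exact: sumr_ge0.
by rewrite big_split_ord/= lerD2l; exact: uC.
Qed.

End Summability.

Section Operator.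
Variable R : realType.
Variables (eta : 'I_6 -> {posnum R}) (N : nat) (phat : N.-tuple 'cV[R]_6).

(* The tail (p_n)_{n >= N} is indexed by n - N. *)
Definition glue (q : nat -> 'cV[R]_6) : nat -> 'cV[R]_6 :=
  fun n => if (n < N)%N then phat`_n else q (n - N)%N.

Definition gcoef (n : nat) (q : nat -> 'cV[R]_6) : 'cV[R]_6 :=
  fcoef (trunc n.-1 (glue q)) n.

Lemma eta_norm_ltyP (q : nat -> 'cV[R]_6) :
  q \in Xeta_pred eta <-> forall i, (norm1 (component i q) < +oo)%E.
Proof.
split=> [qfin i|qfin].
  have : (norm1 (component i q) * ((eta i)%:num)%:E < +oo)%E.
    apply: le_lt_trans qfin; rewrite /eta_norm (bigD1 i)//= leeDl//.
    by apply: sume_ge0 => j _; rewrite mule_ge0 ?norm1_ge0// lee_fin.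
  have := norm1_ge0 (component i q); case: norm1 => [r _ _| _ |//].
    exact: ltry.
  by rewrite gt0_mulye ?lte_fin.
rewrite unfold_in; apply: lte_sum_pinfty => i _.
rewrite muleC lte_mul_pinfty ?lee_fin//.
Qed.

Lemma g_subproof (q : Xeta eta) :
  (fun n => gcoef (N + n) q) \in Xeta_pred eta.
Proof.
apply/eta_norm_ltyP => i.
apply: (@norm1_shift R N (component i (fun n => gcoef n q))).
apply: fcoef_trunc_norm1 => k; apply: (@norm1_unshift R N).
have /eta_norm_ltyP/(_ k) : Xeta_val q \in Xeta_pred eta by case: q.
congr (norm1 _ < _)%E; apply/funext => n.
by rewrite /component /glue ltnNge leq_addr/= addKn.
Qed.

Definition g (q : Xeta eta) : Xeta eta := MkXeta (g_subproof q).

(* D^k F(q)(h_1, ..., h_k) for hs = [:: h_1; ...; h_k]: the derivative at q, in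
   the direction h_1, of q |-> D^(k-1) F(q)(h_2, ..., h_k). *)
Definition multi_diff (W : normedModType R) (F : W -> W) (hs : seq W) : W -> W :=
  foldr (fun h G q => 'd G q h) F hs.

(* The operator norm of D^k_(j_1, ..., j_k) g^(i)(phat), an element of l^1 being
   given as an element of X_eta with only one nonzero component. The point phat
   corresponds to the tail 0. *)
Definition Dg_norm1 (k : nat) (j : k.-tuple 'I_6) (i : 'I_6) : R :=
  sup [set fine (norm1 (component i (multi_diff g hs 0))) | hs in
    [set hs : k.-tuple (Xeta eta) | forall l : 'I_k,
      (forall m, m != tnth j l -> component m (tnth hs l) = cst 0) /\
      (norm1 (component (tnth j l) (tnth hs l)) <= 1)%E]].

(* |X|_eta and the induced matrix norm. *)
Definition vnorm (X : 'cV[R]_6) : R := \sum_(i < 6) `|X i 0| * (eta i)%:num.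

Definition mxnorm (A : 'M[R]_6) : R :=
  sup [set vnorm (A *m X) | X in [set X | vnorm X <= 1]].

(* In the rest of this section, A stands for Df(X_0) and Qm for the matrix that
   diagonalizes it. *)
Variables (A Qm : 'M[R]_6) (lambda : R).

Definition frakM (n : nat) : R :=
  let d := mxnorm (invmx Qm) * mxnorm Qm / ((n%:R - 1) * lambda) in
  if n%:R <= mxnorm A / lambda then d
  else Num.min (n%:R * lambda - mxnorm A)^-1 d.

Definition T (n : nat) (q : nat -> 'cV[R]_6) : 'cV[R]_6 :=
  invmx ((n%:R * lambda)%:M - A) *m gcoef n q.

Definition Y : R :=
  \sum_(N <= n < (4 * N - 4).+1) \sum_(i < 6) `|T n (0 : Xeta eta) i 0| * (eta i)%:num.

Definition Z (k : nat) : R :=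
  frakM N * \big[Num.max/0]_(j : k.-tuple 'I_6)
    ((\prod_(l < k) (eta (tnth j l))%:num)^-1 *
     \sum_(i < 6) Dg_norm1 j i * (eta i)%:num).

End Operator.

(* Main.v *)
From HB Require Import structures.
Require Import Defs.
From mathcomp Require Import all_boot all_order all_algebra.
From mathcomp Require Import all_classical all_reals all_analysis.
From mathcomp Require Import ring lra.
Set Implicit Arguments.
Unset Strict Implicit.
Unset Printing Implicit Defensive.
Import Order.TTheory GRing.Theory Num.Theory.
Import numFieldNormedType.Exports.
Local Open Scope classical_set_scope.
Local Open Scope ring_scope.
Local Notation a := Defs.a.
Local Notation b := Defs.b.
Local Notation c := Defs.c.
Local Notation f := Defs.f.
Local Notation g := Defs.g.
Local Notation T := Defs.T.
Local Notation V := Defs.V.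
Local Notation Y := Defs.Y.
Local Notation Z := Defs.Z.
Local Notation cauchy := Defs.cauchy.
Local Notation trunc := Defs.trunc.
Local Notation glue := Defs.glue.

(** Existence of the parametrization. The operator T is lower triangular: T_n
  only involves the coefficients of order less than n. Its fixed point is thus
  given by a recurrence ([coefs]), without a contraction argument, and what
  remains is to bound it. Truncations of the solution satisfy
    || pi_(K+1) || <= || T(pi_K) || <= Y + sum_k Z_k / k! || pi_K ||^k,
  and the right-hand side is at most P(rbar) + rbar < rbar as soon as
  || pi_K || <= rbar; an induction on K concludes ([coefs_bound]).

  The second inequality is the Taylor formula of g at 0, which is exact in
  degree 4, together with || M_n^-1 || <= frakM_n <= frakM_N for n >= N
  ([vnorm_resolvent], [frakM_nincr]). To handle the iterated Frechet
  differentials of g, the components of g are written as polynomial expressions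
  over the Banach algebra l^1 with the Cauchy product ([lexpr]). Such
  expressions have a formal derivative, which is shown to be the differential of
  the map that they define on X_eta ([lmap_diff]); the Taylor formula
  ([lmap_taylor]) and the boundedness of the differentials
  ([l1norm_multi_diff_le]) follow. The k-th differential on the diagonal is split
  along the six components by multilinearity, which brings in the block norms of
  Z_k ([multi_diff_norm_le]).

  The curve. As n lambda p_n = f_n(p) and f(p) is in l^1, the sequence n p_n is
  summable: the power series p is continuously differentiable on [-1, 1], end
  points included, and evaluation being a morphism of algebras, p satisfies the
  invariance equation ([curve_invariance]). Hence t |-> p(exp(lambda t) theta) is
  an integral curve of f, and it is the only one by Gronwall
  ([integral_curve_unique]).

  The planar curve. The graph z = psi(x, y) is invariant under f, and f restricted
  to it is conjugate to - grad V by the embedding [emb]. The functions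
  z_j exp(- arg_j(x, y)) are first integrals of f, hence constant along p, so that
  p lies in the graph ([curve_graph]). Integral curves of - grad V lift to integral
  curves of f, and uniqueness in the plane follows from uniqueness in R^6. *)

(** * Absolutely summable sequences *)

Section L1Sequences.
Variable R : realType.
Implicit Types (u v s : nat -> R).

(** Membership in l^1. *)
Definition summable1 u := (norm1 u < +oo)%E.
(** The l^1 norm as a real number; it is 0 on sequences that are not summable. *)
Definition l1norm u : R := fine (norm1 u).
(** The sum of a series; meaningful on summable sequences. *)
Definition lsum u : R := limn (series u).

Lemma l1norm_ge0 u : 0 <= l1norm u.
Proof. by rewrite fine_ge0// norm1_ge0. Qed.

Lemma psum_le_l1norm u K : summable1 u -> \sum_(n < K) `|u n| <= l1norm u.
Proof.
move=> uS; rewrite -lee_fin /l1norm fineK; last by rewrite ge0_fin_numE// norm1_ge0.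
rewrite -sumEFin -(big_mkord xpredT (fun n => `|u n|%:E)).
by apply: nneseries_lim_ge => *; rewrite lee_fin.
Qed.

(** A uniform bound on the partial sums gives both summability and a bound of the norm. *)
Lemma l1norm_le u C : (forall K, \sum_(n < K) `|u n| <= C) -> summable1 u /\ l1norm u <= C.
Proof.
move=> uC; have uS : summable1 u by apply/norm1_ltyP; exists C.
split=> //; rewrite -lee_fin /l1norm fineK; last by rewrite ge0_fin_numE// norm1_ge0.
apply: lime_le; first by apply: is_cvg_nneseries => *; rewrite lee_fin.
by near=> K; rewrite big_mkord sumEFin lee_fin.
Unshelve. all: by end_near. Qed.

Lemma coef_le_l1norm u n : summable1 u -> `|u n| <= l1norm u.
Proof.
move=> uS; apply: le_trans (psum_le_l1norm n.+1 uS).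
by rewrite big_ord_recr/= lerDr sumr_ge0.
Qed.

Lemma summable1_le u v : (forall n, `|u n| <= `|v n|) -> summable1 v ->
  summable1 u /\ l1norm u <= l1norm v.
Proof.
move=> uv vS; apply: l1norm_le => K; apply: le_trans (psum_le_l1norm K vS).
exact: ler_sum.
Qed.

Lemma summable1D u v : summable1 u -> summable1 v ->
  summable1 (fun n => u n + v n) /\ l1norm (fun n => u n + v n) <= l1norm u + l1norm v.
Proof.
move=> uS vS; apply: l1norm_le => K.
apply: le_trans (lerD (psum_le_l1norm K uS) (psum_le_l1norm K vS)).
by rewrite -big_split; apply: ler_sum => *; exact: ler_normD.
Qed.

Lemma summable1Z c u : summable1 u ->
  summable1 (fun n => c * u n) /\ l1norm (fun n => c * u n) <= `|c| * l1norm u.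
Proof.
move=> uS; apply: l1norm_le => K.
apply: le_trans (ler_wpM2l (normr_ge0 _) (psum_le_l1norm K uS)).
by rewrite mulr_sumr; apply: ler_sum => *; rewrite normrM.
Qed.

Lemma summable10 : summable1 (fun=> 0) /\ l1norm (fun=> 0) = 0.
Proof. by rewrite /summable1 /l1norm norm10 ltry. Qed.

Lemma summable1_cvg u : summable1 u -> cvgn (series u).
Proof.
move=> uS; apply: normed_cvg; apply: nondecreasing_is_cvgn.
  by apply: nondecreasing_series => n _ _; rewrite normr_ge0.
exists (l1norm u) => _ [n _ <-]; rewrite -[leLHS]/(\sum_(0 <= k < n) `|u k|) big_mkord.
exact: psum_le_l1norm.
Qed.

Lemma summable1_series u : summable1 u -> series u @ \oo --> lsum u.
Proof. exact: summable1_cvg. Qed.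

Lemma summable1_tail u : summable1 u -> forall e : R, 0 < e ->
  exists K, forall M, `|\sum_(K <= k < M) `|u k| | <= e.
Proof.
move=> uS e e0; have cv : cvgn (series (fun n => `|u n|)).
  apply: summable1_cvg; have [] // := @summable1_le (fun n => `|u n|) u _ uS.
  by move=> n; rewrite normr_id.
have /cvgrPdist_le/(_ e e0)[K _ HK] := (cv : series (fun n => `|u n|) @ \oo --> _).
exists K => M; case: (leqP K M) => KM; last first.
  by rewrite big_geq ?normr0 ?ltW// ltnW.
have cl : limn (series (fun n => `|u n|)) - series (fun n => `|u n|) M >= 0.
  rewrite subr_ge0; apply: nondecreasing_cvgn_le => //.
  by apply: nondecreasing_series => n _ _; rewrite normr_ge0.
rewrite -(sub_series_geq _ KM) ger0_norm ?subr_ge0; last first.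
  by apply: (nondecreasing_series (P := xpredT)) => // n *; rewrite normr_ge0.
by have := HK K (leqnn K); move/(le_trans (ler_norm _)); lra.
Qed.

Lemma lim_norm_le (V : normedModType R) (T : Type) (F : set_system T)
    (FF : ProperFilter F) (w : T -> V) (l : V) (C : R) :
  w x @[x --> F] --> l -> (\forall x \near F, `|w x| <= C) -> `|l| <= C.
Proof.
by move=> /cvg_norm wl wC; exact: cvgr_to_le wl wC.
Qed.

(** Tannery's theorem: the limit of a series whose terms are dominated by one
  summable sequence is the series of the limits. *)
Lemma lsum_cvg (T : Type) (F : set_system T) (FF : Filter F) (w : T -> nat -> R) s l :
  summable1 s -> (\forall t \near F, forall k, `|w t k| <= s k) ->
  (forall k, `|l k| <= s k) ->
  (forall k, w t k @[t --> F] --> l k) ->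
  lsum (w t) @[t --> F] --> lsum l.
Proof.
move=> sS ws ls wl.
have dom x : (forall k, `|x k| <= s k) -> summable1 x.
  by move=> xs; have [] // := summable1_le (fun n => le_trans (xs n) (ler_norm _)) sS.
apply/cvgrPdist_le => e e0.
(* Split the series at K, where the tail of s is at most e / 3. *)
have [K HK] := summable1_tail sS (divr_gt0 e0 (ltr0n R 3)).
have tail x : (forall k, `|x k| <= s k) -> `|lsum x - series x K| <= e / 3%:R.
  move=> xs; have : series x n - series x K @[n --> \oo] --> lsum x - series x K.
    by apply: cvgB; [exact/summable1_series/dom | exact: cvg_cst].
  move=> /lim_norm_le; apply; exists K => // M /= KM; rewrite sub_series_geq//.
  apply: le_trans (HK M); rewrite [leRHS]ger0_norm; last exact: sumr_ge0.
  apply: le_trans (ler_norm_sum _ _ _) _; apply: ler_sum => i _.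
  by rewrite (le_trans (xs i))// ler_norm.
have : series (w t) K @[t --> F] --> series l K.
  rewrite /series /=; apply: cvg_big => [|i _]; [exact: add_continuous | exact: wl].
move/cvgrPdist_le/(_ _ (divr_gt0 e0 (ltr0n R 3))) => near3.
near=> t; have wt : forall k, `|w t k| <= s k by near: t.
have t3 : `|series l K - series (w t) K| <= e / 3%:R by near: t.
have := tail _ wt; have := tail _ ls; move: t3; rewrite !ler_norml.
move=> /andP[? ?] /andP[? ?] /andP[? ?]; apply/andP; lra.
Unshelve. all: by end_near. Qed.

End L1Sequences.

(** * The Cauchy product *)

Section CauchyProduct.
Variable R : realType.
Implicit Types (u v : nat -> R^o).

Lemma psum_cauchy u v K :
  \sum_(n < K) cauchy u v n = \sum_(k < K) u k * \sum_(l < K - k) v l.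
Proof.
elim: K => [|K IH]; first by rewrite !big_ord0.
rewrite big_ord_recr/= IH /cauchy [in RHS]big_ord_recr/= [X in _ + X]big_ord_recr/=.
rewrite subnn subSnn big_ord1 addrA; congr (_ + _); rewrite -big_split/=.
apply: eq_bigr => k _; rewrite subSn ?(ltnW (ltn_ord k))// big_ord_recr/= mulrDr//.
Qed.

Lemma norm_cauchy_le u v n :
  `|cauchy u v n| <= cauchy (fun k => `|u k|) (fun k => `|v k|) n.
Proof.
apply: le_trans (ler_norm_sum _ _ _) _.
by apply: ler_sum => k _; rewrite normrM.
Qed.

(** l^1 is a Banach algebra for the Cauchy product. *)
Lemma summable1_cauchy u v : summable1 u -> summable1 v ->
  summable1 (cauchy u v) /\ l1norm (cauchy u v) <= l1norm u * l1norm v.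
Proof.
move=> uS vS; apply: l1norm_le => K.
apply: (@le_trans _ _ (\sum_(k < K) `|u k| * l1norm v)); last first.
  by rewrite -mulr_suml ler_wpM2r ?l1norm_ge0// psum_le_l1norm.
apply: (@le_trans _ _ (\sum_(n < K) cauchy (fun k => `|u k|) (fun k => `|v k|) n)).
  by apply: ler_sum => n _; exact: norm_cauchy_le.
rewrite psum_cauchy; apply: ler_sum => k _.
by rewrite ler_wpM2l// psum_le_l1norm.
Qed.

(** Mertens' theorem, for two absolutely convergent series. *)
Lemma lsum_cauchy u v : summable1 u -> summable1 v ->
  lsum (cauchy u v) = lsum u * lsum v.
Proof.
move=> uS vS.
(* The K-th partial sum of the product is the sum of the sequence w K, whose terms
  converge to those of u times the sum of v. *)
pose w K k : R := if (k < K)%N then u k * \sum_(l < K - k) v l else 0.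
have wE K : lsum (w K) = \sum_(n < K) cauchy u v n.
  rewrite psum_cauchy; apply/cvg_lim => //; apply: cvg_near_cst.
  exists K => // M /= KM; rewrite /series/= (big_cat_nat (n := K))//= big_mkord.
  rewrite [X in _ + X]big_nat_cond [X in _ + X]big1 ?addr0; last first.
    by move=> i /andP[/andP[Ki _] _]; rewrite /w ltnNge Ki.
  by apply: eq_bigr => i _; rewrite /w ltn_ord.
have c1 : lsum (w K) @[K --> \oo] --> lsum (fun k => u k * lsum v).
  have [sS _] := summable1Z (l1norm v) uS.
  have vn K : `|\sum_(l < K) v l| <= l1norm v.
    exact: le_trans (ler_norm_sum _ _ _) (psum_le_l1norm _ vS).
  apply: (@lsum_cvg R nat \oo _ w (fun k => `|l1norm v * u k|)).
  - by have [] := @summable1_le _ (fun k => `|l1norm v * u k|) _ _ sS => // n; rewrite normr_id.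
  - apply: nearW => K k; rewrite /w; case: ifP => _; last by rewrite normr0.
    rewrite !normrM mulrC ler_wpM2r// [leRHS]ger0_norm ?l1norm_ge0//.
  - move=> k; rewrite !normrM mulrC ler_wpM2r// [leRHS]ger0_norm ?l1norm_ge0//.
    apply: (@lim_norm_le R R^o nat \oo _ (series v) _ _ (summable1_series vS)); apply: nearW => K.
    by rewrite /series/= big_mkord.
  - move=> k; have : u k * series v (K - k)%N @[K --> \oo] --> u k * lsum v.
      apply: cvgMr; have := summable1_series vS.
      by move=> /(cvg_comp _ _ (_ : (n - k)%N @[n --> \oo] --> \oo)); apply; exact: cvg_subnr.
    apply: cvg_trans; apply: near_eq_cvg; exists k.+1 => // K /= kK.
    by rewrite /w kK /series/= big_mkord.
have c2 : lsum (w K) @[K --> \oo] --> lsum (cauchy u v).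
  under eq_fun do rewrite wE -(big_mkord xpredT).
  by have [cS _] := summable1_cauchy uS vS; exact: summable1_series cS.
rewrite -(cvg_lim _ c2)//= (cvg_lim _ c1)//; apply/cvg_lim => //.
have : series u n * lsum v @[n --> \oo] --> lsum u * lsum v.
  by apply: cvgMl; exact: summable1_series.
apply: cvg_trans; apply: near_eq_cvg; apply: nearW => n.
by rewrite /series/= mulr_suml.
Qed.

End CauchyProduct.

(** * Polynomial expressions over summable sequences *)

Section Expressions.
Variable R : realType.
Notation vars := ('I_6 -> nat -> R^o).
Implicit Types (x h : vars).

(** Polynomial expressions in six variables, with sequences as coefficients. Variables
  and values are sequences, and products are Cauchy products. *)
Inductive lexpr :=
  | Cst of (nat -> R^o)
  | Var of 'I_6
  | Add of lexpr & lexpr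
  | Mul of lexpr & lexpr
  | Scl of R & lexpr.
Implicit Types e : lexpr.

(** The value of an expression when the variables are the sequences x. *)
Fixpoint leval x e : nat -> R^o := match e with
  | Cst s => s
  | Var k => x k
  | Add a b => fun n => leval x a n + leval x b n
  | Mul a b => cauchy (leval x a) (leval x b)
  | Scl c a => fun n => c * leval x a n
  end.

(** The derivative in the direction h, as an expression in which h is a coefficient. *)
Fixpoint lderiv h e : lexpr := match e with
  | Cst s => Cst (fun=> 0)
  | Var k => Cst (h k)
  | Add a b => Add (lderiv h a) (lderiv h b)
  | Mul a b => Add (Mul (lderiv h a) b) (Mul a (lderiv h b))
  | Scl c a => Scl c (lderiv h a)
  end.

(** The coefficients are in l^1. *)
Fixpoint lwf e : Prop := match e with
  | Cst s => summable1 s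
  | Var k => True
  | Add a b => lwf a /\ lwf b
  | Mul a b => lwf a /\ lwf b
  | Scl c a => lwf a
  end.

(** An upper bound of the degree in the variables. *)
Fixpoint ldeg e : nat := match e with
  | Cst s => 0
  | Var k => 1
  | Add a b => maxn (ldeg a) (ldeg b)
  | Mul a b => ldeg a + ldeg b
  | Scl c a => ldeg a
  end.

(** The majorant: the expression where variables are replaced by r and coefficients by
  their norms. *)
Fixpoint lmaj (r : R) e : R := match e with
  | Cst s => l1norm s
  | Var k => r
  | Add a b => lmaj r a + lmaj r b
  | Mul a b => lmaj r a * lmaj r b
  | Scl c a => `|c| * lmaj r a
  end.

(** The n-th coefficient of the value at t x, as a polynomial in the real number t. *)
Fixpoint lpoly x e : nat -> {poly R} := match e with
  | Cst s => fun n => (s n)%:P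
  | Var k => fun n => x k n *: 'X
  | Add a b => fun n => lpoly x a n + lpoly x b n
  | Mul a b => fun n => \sum_(k < n.+1) lpoly x a k * lpoly x b (n - k)%N
  | Scl c a => fun n => c *: lpoly x a n
  end.

Lemma horner_lpoly x e n t :
  (lpoly x e n).[t] = leval (fun k m => t * x k m) e n.
Proof.
elim: e n => [s|k|a IHa b IHb|a IHa b IHb|c a IHa] n /=.
- by rewrite hornerC.
- by rewrite hornerZ hornerX mulrC.
- by rewrite hornerD IHa IHb.
- by rewrite horner_sum; apply: eq_bigr => k _; rewrite hornerM IHa IHb.
- by rewrite hornerZ IHa.
Qed.

Lemma deriv_lpoly x e n : (lpoly x e n)^`() = lpoly x (lderiv x e) n.
Proof.
elim: e n => [s|k|a IHa b IHb|a IHa b IHb|c a IHa] n /=.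
- by rewrite derivC.
- by rewrite derivZ derivX -mul_polyC mulr1.
- by rewrite derivD IHa IHb.
- by rewrite raddf_sum -big_split; apply: eq_bigr => k _ /=; rewrite derivM IHa IHb.
- by rewrite derivZ IHa.
Qed.

Lemma size_lpoly x e n : (size (lpoly x e n) <= (ldeg e).+1)%N.
Proof.
elim: e n => [s|k|a IHa b IHb|a IHa b IHb|c a IHa] n /=.
- exact: size_polyC_leq1.
- by rewrite (leq_trans (size_scale_leq _ _))// size_polyX.
- rewrite (leq_trans (size_polyD _ _))// geq_max.
  by rewrite (leq_trans (IHa n)) ?(leq_trans (IHb n))// ltnS ?leq_maxl ?leq_maxr.
- apply: (leq_trans (size_sum _ _ _)); apply/bigmax_leqP => k _.
  apply: (leq_trans (size_polyMleq _ _)).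
  have := leq_add (IHa k) (IHb (n - k)%N); rewrite addSn addnS.
  by case: (_ + _)%N.
- by rewrite (leq_trans (size_scale_leq _ _)).
Qed.

(** The Taylor formula at 0, exact for polynomials. *)
Lemma leval_taylor x e n d : (ldeg e <= d)%N ->
  leval x e n =
  \sum_(k < d.+1) k`!%:R^-1 * leval (fun _ _ => 0) (iter k (lderiv x) e) n.
Proof.
move=> ed; have Dk k : (lpoly x e n)^`(k) = lpoly x (iter k (lderiv x) e) n.
  by elim: k => [//|k IH]; rewrite derivnS IH deriv_lpoly.
have -> : leval x e n = (lpoly x e n).[1].
  by rewrite horner_lpoly; congr (leval _ e n); apply/funext => k; apply/funext => m; rewrite mul1r.
rewrite (@horner_coef_wide _ d.+1); last exact: leq_trans (size_lpoly _ _ _) _.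
apply: eq_bigr => k _; rewrite expr1n mulr1.
have -> : leval (fun _ _ => 0) (iter k (lderiv x) e) n = (lpoly x e n)^`(k).[0].
  by rewrite Dk horner_lpoly; congr (leval _ _ n); apply/funext => l; apply/funext => m; rewrite mul0r.
rewrite horner_coef0 coef_derivn addn0 ffactnn.
by rewrite -[_`_k *+ _]mulr_natl mulKf// pnatr_eq0 -lt0n fact_gt0.
Qed.

(** All the variables are in l^1. *)
Definition vfin x := forall k, summable1 (x k).

Lemma leval_summable x e : vfin x -> lwf e -> summable1 (leval x e).
Proof.
move=> xf; elim: e => [s|k|a IHa b IHb|a IHa b IHb|c a IHa] //=.
- by move=> [/IHa aS /IHb bS]; exact: (summable1D aS bS).1.
- by move=> [/IHa aS /IHb bS]; exact: (summable1_cauchy aS bS).1.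
- by move=> /IHa aS; exact: (summable1Z c aS).1.
Qed.

Lemma lwf_lderiv h e : vfin h -> lwf e -> lwf (lderiv h e).
Proof.
move=> hf; elim: e => [s|k|a IHa b IHb|a IHa b IHb|c a IHa] //=.
- by move=> _; have [] := summable10 R.
- by move=> [/IHa ? /IHb ?].
- by move=> [wa wb]; split; split; [exact: IHa | | | exact: IHb].
Qed.

Lemma lmaj_ge0 r e : 0 <= r -> 0 <= lmaj r e.
Proof.
move=> r0; elim: e => [s|k|a IHa b IHb|a IHa b IHb|c a IHa] //=.
- exact: l1norm_ge0.
- exact: addr_ge0.
- exact: mulr_ge0.
- exact: mulr_ge0.
Qed.

Lemma l1norm_leval_le x e r : vfin x -> lwf e -> (forall k, l1norm (x k) <= r) ->
  l1norm (leval x e) <= lmaj r e.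
Proof.
move=> xf we xr; have r0 : 0 <= r by exact: le_trans (l1norm_ge0 (x 0)) (xr 0).
elim: e we => [s|k|a IHa b IHb|a IHa b IHb|c a IHa] //=.
- move=> [wa wb]; apply: le_trans (lerD (IHa wa) (IHb wb)).
  by apply: (summable1D _ _).2; exact: leval_summable.
- move=> [wa wb]; apply: le_trans (ler_pM (l1norm_ge0 _) (l1norm_ge0 _) (IHa wa) (IHb wb)).
  by apply: (summable1_cauchy _ _).2; exact: leval_summable.
- move=> wa; apply: le_trans (ler_wpM2l (normr_ge0 c) (IHa wa)).
  by apply: (summable1Z _ _).2; exact: leval_summable.
Qed.

(** Since a majorant is a polynomial in r with nonnegative coefficients, its
  derivative at r is at most its increment from r to r + 1. *)
Lemma lmaj_lderiv h e r : 0 <= r -> (forall k, l1norm (h k) <= 1) ->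
  lmaj r (lderiv h e) + lmaj r e <= lmaj (r + 1) e.
Proof.
move=> r0 h1; have r10 : 0 <= r + 1 by rewrite addr_ge0.
elim: e => [s|k|a IHa b IHb|a IHa b IHb|c a IHa] /=.
- by rewrite (summable10 R).2 add0r.
- by rewrite addrC lerD2l.
- by move: IHa IHb; lra.
- have := ler_pM (addr_ge0 (lmaj_ge0 _ r0) (lmaj_ge0 a r0))
    (addr_ge0 (lmaj_ge0 _ r0) (lmaj_ge0 b r0)) IHa IHb.
  apply: le_trans.
  have := mulr_ge0 (lmaj_ge0 (lderiv h a) r0) (lmaj_ge0 (lderiv h b) r0).
  by lra.
- by rewrite -mulrDr ler_wpM2l.
Qed.

Lemma lmaj_foldr_lderiv (hs : seq vars) e r : 0 <= r ->
  (forall h, List.In h hs -> forall k, l1norm (h k) <= 1) ->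
  lmaj r (foldr lderiv e hs) <= lmaj (r + (size hs)%:R) e.
Proof.
elim: hs r => [|h hs IH] r r0 hs1 /=; first by rewrite addr0.
have r10 : 0 <= r + 1 by rewrite addr_ge0.
have h1 k : l1norm (h k) <= 1 by apply: hs1; left.
rewrite -natr1 [_%:R + 1]addrC addrA; apply: le_trans (IH _ r10 _); last first.
  by move=> h' h'hs; apply: hs1; right.
apply: le_trans (lmaj_lderiv _ r0 h1); rewrite lerDl lmaj_ge0//.
Qed.

(** First-order expansion at x, with a remainder of order 2 that is uniform in the
  direction h; d is a bound of the norms of the components of h. *)
Lemma leval_expand x e : vfin x -> lwf e ->
  exists2 C, 0 <= C & forall h, vfin h -> forall d, (forall k, l1norm (h k) <= d) -> d <= 1 ->
  [/\ l1norm (leval x e) <= C, l1norm (leval x (lderiv h e)) <= C * d &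
    exists rem : nat -> R^o, [/\ summable1 rem, l1norm rem <= C * d ^+ 2 &
     leval (fun k n => x k n + h k n) e =
     fun n => leval x e n + leval x (lderiv h e) n + rem n]].
Proof.
move=> xf.
have [zS z0] := summable10 R.
elim: e => [s|k|a IHa b IHb|a IHa b IHb|c a IHa] /=.
- move=> sS; exists (l1norm s); first exact: l1norm_ge0.
  move=> h hf d hd d1; have d0 : 0 <= d by exact: le_trans (l1norm_ge0 (h 0)) (hd 0).
  split => //; first by rewrite z0 mulr_ge0 ?l1norm_ge0.
  exists (fun=> 0); split => //; first by rewrite z0 mulr_ge0 ?l1norm_ge0 ?exprn_ge0.
  by apply/funext => n; rewrite !addr0.
- move=> _; exists (l1norm (x k) + 1); first by rewrite addr_ge0 ?l1norm_ge0.
  move=> h hf d hd d1; have d0 : 0 <= d by exact: le_trans (l1norm_ge0 (h 0)) (hd 0).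
  split; first by rewrite lerDl.
    by rewrite mulrDl mul1r (le_trans (hd k))// lerDr mulr_ge0 ?l1norm_ge0.
  exists (fun=> 0); split => //.
    by rewrite z0 mulr_ge0 ?exprn_ge0 ?addr_ge0 ?l1norm_ge0.
  by apply/funext => n; rewrite addr0.
- move=> [wa wb]; have [A A0 HA] := IHa wa; have [B B0 HB] := IHb wb.
  exists (A + B); first exact: addr_ge0.
  move=> h hf d hd d1; have [a0 da [ra [rS rA ->]]] := HA h hf d hd d1.
  have [b0 db [rb [rS' rB ->]]] := HB h hf d hd d1.
  have wda := lwf_lderiv hf wa; have wdb := lwf_lderiv hf wb.
  have sa := leval_summable xf wa; have sb := leval_summable xf wb.
  have sda := leval_summable xf wda; have sdb := leval_summable xf wdb.
  split; first by rewrite (le_trans (summable1D sa sb).2)// lerD.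
    by rewrite mulrDl (le_trans (summable1D sda sdb).2)// lerD.
  exists (fun n => ra n + rb n); split.
  + exact: (summable1D _ _).1.
  + by rewrite mulrDl (le_trans (summable1D rS rS').2)// lerD.
  + by apply/funext => n; ring.
- move=> [wa wb]; have [A A0 HA] := IHa wa; have [B B0 HB] := IHb wb.
  exists (6 * (A * B)); first by rewrite mulr_ge0// mulr_ge0.
  move=> h hf d hd d1; have [a0 da [ra [rS rA ->]]] := HA h hf d hd d1.
  have d0 : 0 <= d by exact: le_trans (l1norm_ge0 (h 0)) (hd 0).
  have [b0 db [rb [rS' rB ->]]] := HB h hf d hd d1.
  have wda := lwf_lderiv hf wa; have wdb := lwf_lderiv hf wb.
  have sa := leval_summable xf wa; have sb := leval_summable xf wb.
  have sda := leval_summable xf wda; have sdb := leval_summable xf wdb.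
  have AB0 : 0 <= A * B by exact: mulr_ge0.
  have d20 : 0 <= d ^+ 2 by exact: exprn_ge0.
  have d2d : d ^+ 2 <= d by rewrite expr2 ler_piMl.
  have d41 : d ^+ 2 <= 1 by exact: le_trans d2d d1.
  have mulS (u v : nat -> R^o) : summable1 u -> summable1 v -> summable1 (cauchy u v) :=
    fun us vs => (summable1_cauchy us vs).1.
  have addS (u v : nat -> R^o) : summable1 u -> summable1 v -> summable1 (fun n => u n + v n) :=
    fun us vs => (summable1D us vs).1.
  have mulN (u v : nat -> R^o) (p q : R) : summable1 u -> summable1 v -> l1norm u <= p -> l1norm v <= q ->
      l1norm (cauchy u v) <= p * q.
    move=> us vs up vq; apply: le_trans (summable1_cauchy us vs).2 _.
    by apply: ler_pM => //; exact: l1norm_ge0.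
  have addN (u v : nat -> R^o) (p q : R) : summable1 u -> summable1 v -> l1norm u <= p -> l1norm v <= q ->
      l1norm (fun n => u n + v n) <= p + q.
    by move=> us vs up vq; apply: le_trans (summable1D us vs).2 _; exact: lerD.
  have sB := addS _ _ (addS _ _ sb sdb) rS'.
  have sA := addS _ _ sa sda.
  have nB := addN _ _ _ _ (addS _ _ sb sdb) rS' (addN _ _ _ _ sb sdb b0 db) rB.
  have nA := addN _ _ _ _ sa sda a0 da.
  split.
  + by apply: le_trans (mulN _ _ _ _ sa sb a0 b0) _; lra.
  + apply: le_trans (addN _ _ _ _ _ _ (mulN _ _ _ _ sda sb da b0) (mulN _ _ _ _ sa sdb a0 db)) _.
    * exact: mulS.
    * exact: mulS.
    * by have := mulr_ge0 AB0 d0; nra.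
  + have S1 := mulS _ _ sda sdb; have S2 := mulS _ _ rS sB.
    have S3 := mulS _ _ sA rS'.
    exists (fun n => cauchy (leval x (lderiv h a)) (leval x (lderiv h b)) n
      + cauchy ra (fun n => leval x b n + leval x (lderiv h b) n + rb n) n
      + cauchy (fun n => leval x a n + leval x (lderiv h a) n) rb n); split.
    * exact: (addS _ _ (addS _ _ S1 S2) S3).
    * have N1 := mulN _ _ _ _ sda sdb da db; have N2 := mulN _ _ _ _ rS sB rA nB.
      have N3 := mulN _ _ _ _ sA rS' nA rB.
      apply: le_trans (addN _ _ _ _ (addS _ _ S1 S2) S3 (addN _ _ _ _ S1 S2 N1 N2) N3) _.
      have -> : A * d * (B * d) + A * d ^+ 2 * (B + B * d + B * d ^+ 2) +
         (A + A * d) * (B * d ^+ 2) = (A * B) * d ^+ 2 * (3 + d + d + d ^+ 2).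
        by ring.
      have -> : 6 * (A * B) * d ^+ 2 = A * B * d ^+ 2 * 6 by ring.
      by rewrite ler_wpM2l ?mulr_ge0//; lra.
    * apply/funext => n; rewrite /Defs.cauchy -!big_split/=; apply: eq_bigr => k _.
      by ring.
- move=> wa; have [A A0 HA] := IHa wa.
  exists (`|c| * A); first exact: mulr_ge0.
  move=> h hf d hd d1; have [a0 da [ra [rS rA ->]]] := HA h hf d hd d1.
  have sa := leval_summable xf wa.
  have sda := leval_summable xf (lwf_lderiv hf wa).
  split.
  + by rewrite (le_trans (summable1Z c sa).2)// ler_wpM2l.
  + by rewrite -mulrA (le_trans (summable1Z c sda).2)// ler_wpM2l.
  + exists (fun n => c * ra n); split.
    * exact: (summable1Z c rS).1.
    * by rewrite -mulrA (le_trans (summable1Z c rS).2)// ler_wpM2l.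
    * by apply/funext => n; ring.
Qed.

End Expressions.

(** * Polynomial maps of the sequence space *)

Section Differential.
Variables (R : realType) (V W : normedModType R).

(** A second-order Taylor estimate gives differentiability. *)
Lemma quadratic_differentiable (F : V -> W) (dF : {linear V -> W}) x (C d : R) :
  0 < d -> (forall h, `|h| <= d ->
    `|dF h| <= C * `|h| /\ `|F (h + x) - F x - dF h| <= C * `|h| ^+ 2) ->
  differentiable F x /\ 'd F x = dF :> (V -> W).
Proof.
move=> d0 FC.
have dFc : continuous dF.
  suff c0 : dF h @[h --> (0 : V)] --> (0 : W).
    apply: continuousfor0_continuous.
    have -> : {for 0, continuous dF} = (dF h @[h --> (0 : V)] --> dF 0) by [].
    by rewrite linear0.
  apply/cvgr0Pnorm_le => e e0.
  have c0 : 0 < `|C| + 1 by rewrite ltr_wpDl.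
  near=> h; have hd : `|h| <= d by near: h; apply: nbhs0_le.
  have he : `|h| <= e / (`|C| + 1) by near: h; apply: nbhs0_le; rewrite divr_gt0.
  apply: le_trans (FC h hd).1 _; apply: (@le_trans _ _ ((`|C| + 1) * `|h|)).
    by rewrite ler_wpM2r// (le_trans (ler_norm C))// lerDl.
  by rewrite mulrC -ler_pdivlMr.
have dFo : F \o shift x = cst (F x) + dF +o_ 0 id.
  apply/eqaddoP => e e0.
  have c0 : 0 < `|C| + 1 by rewrite ltr_wpDl.
  near=> h; have hd : `|h| <= d by near: h; apply: nbhs0_le.
  have he : `|h| <= e / (`|C| + 1) by near: h; apply: nbhs0_le; rewrite divr_gt0.
  rewrite /= -[(_ - _) h]/(F (h + x) - (F x + dF h)) opprD addrA.
  apply: le_trans (FC h hd).2 _; rewrite expr2 mulrA ler_wpM2r//.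
  apply: (@le_trans _ _ ((`|C| + 1) * `|h|)).
    by rewrite ler_wpM2r// (le_trans (ler_norm C))// lerDl.
  by rewrite mulrC -ler_pdivlMr.
have dE := diff_unique dFc dFo; split => //.
by apply/diff_locallyP; rewrite dE.
Unshelve. all: by end_near. Qed.

(** Differential of a finite sum. *)
Lemma diff_sum (I : finType) (G : I -> V -> W) x : (forall i, differentiable (G i) x) ->
  differentiable (fun y => \sum_i G i y) x /\
  forall h, 'd (fun y => \sum_i G i y) x h = \sum_i 'd (G i) x h.
Proof.
move=> Gd; have -> : (fun y => \sum_i G i y) = \sum_i G i.
  by apply/funext => y; rewrite fct_sumE.
suff [Sd SE] : differentiable (\sum_i G i) x /\
    forall h, 'd (\sum_i G i) x h = (\sum_i ('d (G i) x : V -> W)) h.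
  by split => // h; rewrite SE fct_sumE.
apply: (big_ind2 (fun u u' => differentiable u x /\ forall h, 'd u x h = u' h)) => //.
- by split; [exact: (differentiable_cst 0) | move=> h; rewrite (@diff_cst _ _ _ 0)].
- move=> u u' v v' [du hu] [dv hv]; split; first exact: differentiableD.
  by move=> h; rewrite diffD// /= hu hv.
Qed.

End Differential.

Section LexprLinear.
Variable R : realType.
Notation vars := ('I_6 -> nat -> R^o).
Implicit Types (x h : vars) (e : lexpr R).

Lemma leval_lderivZD x h h' c e n :
  leval x (lderiv (fun k m => c * h k m + h' k m) e) n =
  c * leval x (lderiv h e) n + leval x (lderiv h' e) n.
Proof.
elim: e n => [s|k|a IHa b IHb|a IHa b IHb|d a IHa] n /=.
- by rewrite mulr0 addr0.
- by [].
- by rewrite IHa IHb; ring.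
- rewrite /Defs.cauchy mulrDr !mulr_sumr -!big_split/=; apply: eq_bigr => k _.
  by rewrite IHa IHb; ring.
- by rewrite IHa; ring.
Qed.

End LexprLinear.

Section XetaMaps.
Variables (R : realType) (eta : 'I_6 -> {posnum R}) (N : nat).
Notation vars := ('I_6 -> nat -> R^o).
Notation X := (Xeta eta).
Implicit Types (q h : X) (E : 'I_6 -> lexpr R).

Lemma summable1_component k q : summable1 (component k q).
Proof. by have /eta_norm_ltyP/(_ k) : Xeta_val q \in Xeta_pred eta by case: q. Qed.

Lemma Xeta_normrE q : `|q| = \sum_(i < 6) l1norm (component i q) * (eta i)%:num.
Proof.
apply/EFin_inj; rewrite -[LHS]/((Xeta_norm q)%:E) Xeta_normE /eta_norm -sumEFin.
apply: eq_bigr => i _; rewrite EFinM /l1norm fineK//.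
by rewrite ge0_fin_numE ?norm1_ge0//; exact: summable1_component.
Qed.

(** The components of the tail q, seen as sequences indexed from 0 with N leading zeros. *)
Definition tail_vars q : vars := fun k n => if (n < N)%N then 0 else q (n - N)%N k 0.

Lemma psum_tail_vars q k K : \sum_(n < N + K) `|tail_vars q k n| = \sum_(n < K) `|component k q n|.
Proof.
rewrite big_split_ord/= big1 ?add0r; last by move=> i _; rewrite /tail_vars ltn_ord normr0.
by apply: eq_bigr => i _; rewrite /tail_vars ltnNge leq_addr/= addKn.
Qed.

Lemma l1norm_tail_vars q k : summable1 (tail_vars q k) /\ l1norm (tail_vars q k) <= l1norm (component k q).
Proof.
apply: l1norm_le => K; apply: le_trans (psum_le_l1norm K (summable1_component k q)).
by rewrite -psum_tail_vars addnC big_split_ord/= lerDl sumr_ge0.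
Qed.

Lemma tail_vars_vfin q : vfin (tail_vars q).
Proof. by move=> k; exact: (l1norm_tail_vars q k).1. Qed.

(** A constant that bounds the l^1 norm of each component by the norm of X_eta. *)
Definition eta_const : R := \sum_(k < 6) ((eta k)%:num)^-1.

Lemma eta_const_gt0 : 0 < eta_const.
Proof.
rewrite /eta_const (bigD1 (0 : 'I_6))//= ltr_pwDl ?invr_gt0//.
by apply: sumr_ge0 => k _; rewrite invr_ge0.
Qed.

Lemma l1norm_tail_vars_le q k : l1norm (tail_vars q k) <= eta_const * `|q|.
Proof.
apply: le_trans (l1norm_tail_vars q k).2 _.
have kq : l1norm (component k q) * (eta k)%:num <= `|q|.
  rewrite Xeta_normrE (bigD1 k)//= lerDl; apply: sumr_ge0 => i _.
  by rewrite mulr_ge0// l1norm_ge0.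
rewrite -ler_pdivlMr// in kq; apply: le_trans kq _; rewrite mulrC ler_wpM2r//.
by rewrite /eta_const (bigD1 k)//= lerDl sumr_ge0// => i _; rewrite invr_ge0.
Qed.

(** Forgetting the first N terms. *)
Lemma summable1_shift (u : nat -> R) : summable1 u ->
  summable1 (fun n => u (N + n)%N) /\ l1norm (fun n => u (N + n)%N) <= l1norm u.
Proof.
move=> uS; apply: l1norm_le => K; apply: le_trans (psum_le_l1norm (N + K) uS).
by rewrite big_split_ord/= lerDr sumr_ge0.
Qed.

Lemma lmap_subproof E (wE : forall i, lwf (E i)) q :
  (fun n => \col_i leval (tail_vars q) (E i) (N + n)%N : 'cV[R]_6) \in Xeta_pred eta.
Proof.
apply/eta_norm_ltyP => i.
have [+ _] := summable1_shift (leval_summable (tail_vars_vfin q) (wE i)).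
by rewrite /summable1; congr (norm1 _ < _)%E; apply/funext => n; rewrite /component mxE.
Qed.

(** The map X_eta -> X_eta given by six polynomial expressions, of which the
  coefficients of index at least N are kept. *)
Definition lmap E (wE : forall i, lwf (E i)) q : X := MkXeta (lmap_subproof wE q).

Lemma component_lmap E (wE : forall i, lwf (E i)) q i :
  component i (lmap wE q) = fun n => leval (tail_vars q) (E i) (N + n)%N.
Proof. by apply/funext => n; rewrite /component mxE. Qed.

(** The expressions of the derivative in the direction h in X_eta. *)
Definition lmap_deriv E h : 'I_6 -> lexpr R := fun i => lderiv (tail_vars h) (E i).

Lemma lmap_deriv_wf E h : (forall i, lwf (E i)) -> forall i, lwf (lmap_deriv E h i).
Proof. by move=> wE i; apply: lwf_lderiv => //; exact: tail_vars_vfin. Qed.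

Lemma tail_varsD q h : tail_vars (h + q) = fun k n => tail_vars q k n + tail_vars h k n.
Proof.
apply/funext => k; apply/funext => n; rewrite /tail_vars; case: ifP => _; first by rewrite addr0.
by rewrite mxE addrC.
Qed.

Lemma tail_varsZD c q h : tail_vars (c *: q + h) = fun k n => c * tail_vars q k n + tail_vars h k n.
Proof.
apply/funext => k; apply/funext => n; rewrite /tail_vars; case: ifP => _; first by rewrite mulr0 addr0.
by rewrite !mxE.
Qed.

Lemma lmap_deriv_linear E (wE : forall i, lwf (E i)) q :
  linear (fun h => lmap (lmap_deriv_wf h wE) q).
Proof.
move=> c h h'; apply/val_inj/funext => n; apply/colP => i.
by rewrite !mxE /lmap_deriv tail_varsZD leval_lderivZD.
Qed.

(** The Frechet differential of the map is given by the formal derivative. *)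
Lemma lmap_diff E (wE : forall i, lwf (E i)) q :
  differentiable (lmap wE) q /\
  'd (lmap wE) q = (fun h => lmap (lmap_deriv_wf h wE) q) :> (X -> X).
Proof.
pose dM := GRing.isLinear.Build _ _ _ _ _ (lmap_deriv_linear wE q).
pose dL : {linear X -> X} := HB.pack (fun h => lmap (lmap_deriv_wf h wE) q) dM.
have c0 := eta_const_gt0; set c := eta_const in c0 *.
have HC i : exists C, 0 <= C /\ forall h, c * `|h| <= 1 ->
    l1norm (leval (tail_vars q) (lderiv (tail_vars h) (E i))) <= C * (c * `|h|) /\
    exists rem : nat -> R^o, [/\ summable1 rem, l1norm rem <= C * (c * `|h|) ^+ 2 &
      leval (tail_vars (h + q)) (E i) =
      fun n => leval (tail_vars q) (E i) n + leval (tail_vars q) (lderiv (tail_vars h) (E i)) n + rem n].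
  have [C C0 HC] := leval_expand (tail_vars_vfin q) (wE i).
  exists C; split => // h h1; rewrite tail_varsD.
  by have [] := HC _ (tail_vars_vfin h) _ (l1norm_tail_vars_le h) h1.
have [C {}HC] := choice HC.
pose S := \sum_(i < 6) C i * (eta i)%:num.
have S0 : 0 <= S by apply: sumr_ge0 => i _; rewrite mulr_ge0//; have [] := HC i.
apply: (@quadratic_differentiable R X X (lmap wE) dL q (S * c + S * c ^+ 2) c^-1).
  by rewrite invr_gt0.
move=> h hc; have {}hc : c * `|h| <= 1 by rewrite mulrC -ler_pdivlMr// div1r.
have h0 : 0 <= `|h| by [].
split.
  apply: (@le_trans _ _ (S * c * `|h|)).
    rewrite Xeta_normrE -mulrA /S mulr_suml; apply: ler_sum => i _.
    rewrite mulrAC ler_wpM2r// component_lmap.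
    have [_ /(_ h hc)[+ _]] := HC i; apply: le_trans.
    apply: (summable1_shift _).2; apply: leval_summable; first exact: tail_vars_vfin.
    exact: lmap_deriv_wf.
  by rewrite ler_wpM2r// lerDl mulr_ge0// exprn_ge0// ltW.
apply: (@le_trans _ _ (S * c ^+ 2 * `|h| ^+ 2)); last first.
  by rewrite ler_wpM2r ?exprn_ge0// lerDr mulr_ge0// ltW.
rewrite Xeta_normrE -mulrA -exprMn /S mulr_suml; apply: ler_sum => i _.
rewrite mulrAC ler_wpM2r//.
have [_ /(_ h hc)[_ [rem [rS rC remE]]]] := HC i; apply: le_trans rC.
have -> : component i (lmap wE (h + q) - lmap wE q - dL h) = fun n => rem (N + n)%N.
  apply/funext => n; rewrite /component !mxE remE /=.
  rewrite /lmap_deriv; ring.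
exact: (summable1_shift rS).2.
Qed.

(** The expressions of the iterated differential in the directions hs. *)
Definition lmap_derivs E (hs : seq X) : 'I_6 -> lexpr R := foldr (fun h E => lmap_deriv E h) E hs.

Lemma lmap_derivs_wf E hs : (forall i, lwf (E i)) -> forall i, lwf (lmap_derivs E hs i).
Proof. by move=> wE; elim: hs => //= h hs IH; exact: lmap_deriv_wf. Qed.

Lemma eq_lmap E E' (wE : forall i, lwf (E i)) (wE' : forall i, lwf (E' i)) :
  (forall q i n, leval (tail_vars q) (E i) (N + n)%N = leval (tail_vars q) (E' i) (N + n)%N) ->
  lmap wE = lmap wE'.
Proof.
by move=> EE'; apply/funext => q; apply/val_inj/funext => n; apply/colP => i; rewrite !mxE EE'.
Qed.

(** Iterated differentials of such a map are again such maps. *)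
Lemma multi_diff_lmap E (wE : forall i, lwf (E i)) hs :
  multi_diff (lmap wE) hs = lmap (lmap_derivs_wf hs wE).
Proof.
elim: hs => [|h hs IH] /=; first exact: eq_lmap.
rewrite IH; apply/funext => q; rewrite (lmap_diff _ q).2.
apply/val_inj/funext => n; apply/colP => i; by rewrite !mxE.
Qed.

Lemma multi_diff_lmap_differentiable E (wE : forall i, lwf (E i)) hs q :
  differentiable (multi_diff (lmap wE) hs) q.
Proof. by rewrite multi_diff_lmap; exact: (lmap_diff _ q).1. Qed.

Lemma tail_vars0 : tail_vars 0 = fun _ _ => 0.
Proof. by apply/funext => k; apply/funext => n; rewrite /tail_vars mxE; case: ifP. Qed.

Lemma lmap_derivsE E hs i : lmap_derivs E hs i = foldr (@lderiv R) (E i) (map tail_vars hs).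
Proof. by elim: hs => //= h hs <-. Qed.

(** The Taylor formula at the origin of X_eta. *)
Lemma lmap_taylor E (wE : forall i, lwf (E i)) d q : (forall i, (ldeg (E i) <= d)%N) ->
  lmap wE q = \sum_(k < d.+1) k`!%:R^-1 *: multi_diff (lmap wE) (nseq k q) 0.
Proof.
move=> Ed; apply/val_inj/funext => n; apply/colP => i.
have vsum (F : 'I_d.+1 -> X) : (\sum_k F k : X) n i 0 = \sum_k F k n i 0.
  by elim/big_ind2 : _ => //= [|x y z t <- <-]; rewrite mxE.
rewrite vsum mxE (leval_taylor _ _ (Ed i)); apply: eq_bigr => k _.
rewrite multi_diff_lmap !mxE tail_vars0 lmap_derivsE; congr (_ * leval _ _ _).
by elim: (k : nat) => //= m ->.
Qed.

(** The iterated differentials at the origin are bounded on unit balls. *)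
Lemma l1norm_multi_diff_le E (wE : forall i, lwf (E i)) hs i :
  (forall h, h \in hs -> forall k, l1norm (component k h) <= 1) ->
  l1norm (component i (multi_diff (lmap wE) hs 0)) <= lmaj (size hs)%:R (E i).
Proof.
move=> hs1; rewrite multi_diff_lmap component_lmap tail_vars0.
have z0 := summable10 R.
have zf : vfin (fun (_ : 'I_6) (_ : nat) => 0 : R^o) by move=> k; exact: z0.1.
have wD := lmap_derivs_wf hs wE i.
apply: le_trans (summable1_shift (leval_summable zf wD)).2 _.
apply: le_trans (@l1norm_leval_le _ _ _ 0 zf wD _) _; first by move=> k; rewrite z0.2.
rewrite lmap_derivsE; apply: le_trans (lmaj_foldr_lderiv _ _ _) _ => //.
  move=> h /List.in_map_iff[h' [<- h'hs]] k; apply: le_trans (l1norm_tail_vars h' k).2 _.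
  by apply: hs1; elim: hs h'hs {wD} => //= x s IH [->|/IH]; rewrite inE ?eqxx// => ->; rewrite orbT.
by rewrite size_map add0r.
Qed.

End XetaMaps.

(** * Bounds for the iterated differentials *)

Lemma sum_tuple_recl (M : nmodType) (I : finType) k (G : seq I -> M) :
  \sum_(j : k.+1.-tuple I) G j = \sum_(m : I) \sum_(j : k.-tuple I) G (m :: j).
Proof.
rewrite pair_big/= (reindex (fun mj : I * k.-tuple I => cons_tuple mj.1 mj.2))//=.
exists (fun j : k.+1.-tuple I => (thead j, behead_tuple j)).
  by move=> [m j] _; congr pair; exact/val_inj.
by move=> j _; rewrite [in RHS](tuple_eta j); exact/val_inj.
Qed.

(** Expansion of a power of a sum, over tuples of indices. *)
Lemma sum_tuple_prod (A : comPzRingType) (I : finType) k (x : I -> A) :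
  \sum_(j : k.-tuple I) \prod_(m <- j) x m = (\sum_m x m) ^+ k.
Proof.
elim: k => [|k IH].
  rewrite expr0 (big_pred1 [tuple]); first by rewrite big_nil.
  by move=> j; apply/esym/eqP; exact: tuple0.
rewrite (sum_tuple_recl _ (fun j => \prod_(m <- j) x m)) exprS -IH mulr_suml.
apply: eq_bigr => m _; rewrite mulr_sumr; apply: eq_bigr => j _.
by rewrite big_cons.
Qed.

Section MultiDiff.
Variables (R : realType) (W : normedModType R) (F : W -> W).
Hypothesis Fd : forall hs x, differentiable (multi_diff F hs) x.

(** Differential of a linear combination. *)
Lemma differential_sum (I : finType) (G : I -> W -> W) (c : I -> R) x h :
  (forall i, differentiable (G i) x) ->
  differentiable (fun y => \sum_i c i *: G i y) x /\
  'd (fun y => \sum_i c i *: G i y) x h = \sum_i c i *: 'd (G i) x h.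
Proof.
move=> Gd; have [Sd SE] := diff_sum (fun i => differentiableZ (c i) (Gd i)).
by split => //; rewrite SE; apply: eq_bigr => i _; rewrite diffZ.
Qed.

(** Multilinearity of the k-th differential, on the diagonal. *)
Lemma multi_diff_expand (I : finType) (c : I -> R) (e : I -> W) k x :
  multi_diff F (nseq k (\sum_m c m *: e m)) x =
  \sum_(j : k.-tuple I) (\prod_(m <- j) c m) *: multi_diff F (map e j) x.
Proof.
elim: k x => [|k IH] x.
  rewrite (big_pred1 [tuple]); first by rewrite big_nil scale1r.
  by move=> j; apply/esym/eqP; exact: tuple0.
rewrite /= (funext IH).
rewrite (sum_tuple_recl k (fun j => (\prod_(m <- j) c m) *: multi_diff F (map e j) x)).
rewrite linear_sum; apply: eq_bigr => m _.
rewrite linearZ /= (differential_sum _ _ (fun j => Fd _ _)).2 scaler_sumr.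
by apply: eq_bigr => j _; rewrite big_cons scalerA.
Qed.

End MultiDiff.

Section ZBound.
Variables (R : realType) (eta : 'I_6 -> {posnum R}) (N : nat).
Variable (phat : N.-tuple 'cV[R]_6).
Notation X := (Xeta eta).
Variables (E : 'I_6 -> lexpr R) (wE : forall i, lwf (E i)).
Hypothesis gE : g phat = lmap N wE :> (X -> X).

Let Fd hs x : differentiable (multi_diff (g (eta := eta) phat) hs) x.
Proof. by rewrite gE; exact: multi_diff_lmap_differentiable. Qed.

Lemma single_subproof (u : nat -> R^o) (m : 'I_6) : summable1 u ->
  (fun n => \col_i (if i == m then u n else 0)) \in Xeta_pred eta.
Proof.
move=> uS; apply/eta_norm_ltyP => i; rewrite -/(summable1 _).
have [] // := @summable1_le R (component i (fun n => \col_i (if i == m then u n else 0))) u _ uS.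
by move=> n; rewrite /component mxE; case: ifP; rewrite // normr0.
Qed.

(** The element of X_eta whose m-th component is u, and whose other components are 0. *)
Definition single (u : nat -> R^o) (m : 'I_6) (uS : summable1 u) : X :=
  MkXeta (single_subproof m uS).

Lemma l1norm_sum (I : finType) (w : I -> nat -> R^o) : (forall i, summable1 (w i)) ->
  summable1 (fun n => \sum_i w i n) /\ l1norm (fun n => \sum_i w i n) <= \sum_i l1norm (w i).
Proof.
move=> wS; have -> : (fun n => \sum_i w i n) = \sum_i w i.
  by apply/funext => n; rewrite fct_sumE.
elim/big_ind2 : _ => //.
- by have [? ->] := summable10 R.
- move=> u x v y [uS ux] [vS vy]; have [sS sle] := summable1D uS vS.
  by split => //; apply: le_trans sle _; exact: lerD.
Qed.

(** Z_k without the factor frakM_N. *)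
Definition Zmax (k : nat) : R := \big[Num.max/0]_(j : k.-tuple 'I_6)
    ((\prod_(l < k) (eta (tnth j l))%:num)^-1 *
     \sum_(i < 6) Dg_norm1 eta phat j i * (eta i)%:num).

(** The set of which the block norm is the supremum is bounded, so that the block norm
  does bound the values at unit vectors. *)
Lemma l1norm_le_Dg_norm1 k (j : k.-tuple 'I_6) i (e : 'I_6 -> X) :
  (forall m m', m' != m -> component m' (e m) = cst 0) ->
  (forall m, l1norm (component m (e m)) <= 1) ->
  l1norm (component i (multi_diff (g phat) (map e j) (0 : X))) <= Dg_norm1 eta phat j i.
Proof.
move=> e0 e1; apply: sup_upper_bound; last first.
  exists [tuple of map e j] => //= l; rewrite tnth_map; split; first by move=> m; exact: e0.
  have eS := summable1_component (tnth j l) (e (tnth j l)).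
  by rewrite -[norm1 _]fineK ?lee_fin ?ge0_fin_numE ?norm1_ge0//; exact: e1.
split; first by eexists; exists [tuple of map e j] => //= l; rewrite tnth_map; split;
  [by move=> m; exact: e0|
   rewrite -[norm1 _]fineK ?lee_fin ?ge0_fin_numE ?norm1_ge0//;
   [exact: e1 | exact: summable1_component]].
exists (lmaj k%:R (E i)) => _ [hs hsP <-].
rewrite gE -[X in lmaj X%:R](size_tuple hs); apply: l1norm_multi_diff_le => h /tnthP[l ->] m.
have [hl0 hl1] := hsP l; have [->|ml] := eqVneq m (tnth j l).
  rewrite -lee_fin fineK ?ge0_fin_numE ?norm1_ge0//; exact: summable1_component.
by rewrite hl0// -[cst 0]/(fun=> 0) (summable10 R).2.
Qed.

(** The k-th differential of g on the diagonal, bounded by means of the block norms. *)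
Lemma multi_diff_norm_le k q : `|multi_diff (g phat) (nseq k q) (0 : X)| <= Zmax k * `|q| ^+ k.
Proof.
(* q is the sum of the c_m e_m, where e_m is the m-th component of q scaled to norm 1;
  e_m = 0 when that component vanishes, since the inverse of 0 is 0. *)
pose c m := l1norm (component m q).
have cS m := summable1_component m q.
pose e m : X := (c m)^-1 *: single m (cS m).
have singleE m : single m (cS m) = c m *: e m.
  rewrite /e scalerA; have [c0|c0] := eqVneq (c m) 0; last by rewrite mulfV// scale1r.
  rewrite c0 mul0r scale0r; apply/val_inj/funext => n; apply/colP => i; rewrite !mxE.
  case: ifP => // _; apply/normr0_eq0/le_anti; rewrite normr_ge0 andbT.
  by rewrite -c0; exact: coef_le_l1norm.
have qE : q = \sum_m c m *: e m.
  apply/val_inj/funext => n; apply/colP => i.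
  have vsum (G : 'I_6 -> X) : (\sum_k G k : X) n i 0 = \sum_k G k n i 0.
    by elim/big_ind2 : _ => //= [|x y z t <- <-]; rewrite mxE.
  rewrite -(eq_bigr _ (fun m _ => singleE m)) vsum (bigD1 i)//= mxE eqxx.
  by rewrite big1 ?addr0// => m mi; rewrite mxE eq_sym (negPf mi).
have e0 m m' : m' != m -> component m' (e m) = cst 0.
  by move=> m'm; apply/funext => n; rewrite /component !mxE (negPf m'm) mulr0.
have e1 m : l1norm (component m (e m)) <= 1.
  have -> : component m (e m) = fun n => (c m)^-1 * component m q n.
    by apply/funext => n; rewrite /component !mxE eqxx.
  apply: le_trans (summable1Z _ (cS m)).2 _; rewrite normfV ger0_norm ?l1norm_ge0//.
  rewrite -/(c m); have [->|c0] := eqVneq (c m) 0; first by rewrite mulr0.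
  by rewrite mulVf.
rewrite {1}qE multi_diff_expand//.
have c0 m : 0 <= c m by exact: l1norm_ge0.
pose D j : X := multi_diff (g phat) (map e j) 0.
rewrite Xeta_normrE.
apply: (@le_trans _ _ (\sum_(i < 6) (\sum_(j : k.-tuple 'I_6)
    (\prod_(m <- j) c m) * Dg_norm1 eta phat j i) * (eta i)%:num)).
  apply: ler_sum => i _; rewrite ler_wpM2r//.
  have -> : component i (\sum_(j : k.-tuple 'I_6) (\prod_(m <- j) c m) *: D j) =
     fun n => \sum_(j : k.-tuple 'I_6) (\prod_(m <- j) c m) * component i (D j) n.
    apply/funext => n; rewrite /component.
    by elim/big_ind2 : _ => //= [|x y z t <- <-|j _]; rewrite !mxE.
  have cD j := summable1_component i (D j).
  apply: le_trans (l1norm_sum _).2 _; first by move=> j; exact: (summable1Z _ (cD j)).1.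
  apply: ler_sum => j _; apply: le_trans (summable1Z _ (cD j)).2 _.
  rewrite ger0_norm ?prodr_ge0// ler_wpM2l ?prodr_ge0//; exact: l1norm_le_Dg_norm1.
under eq_bigr do rewrite mulr_suml.
rewrite exchange_big/= Xeta_normrE -sum_tuple_prod mulr_sumr.
apply: ler_sum => j _; under eq_bigr do rewrite -mulrA.
rewrite -mulr_sumr big_split/= [X in _ <= X * _]/Zmax.
have eta0 : 0 < \prod_(m <- j) (eta m)%:num by rewrite prodr_gt0.
rewrite mulrCA ler_wpM2l ?prodr_ge0//.
rewrite -ler_pdivrMr// mulrC; apply: le_trans (le_bigmax _ _ j) => /=.
by rewrite big_tuple.
Qed.

End ZBound.

(** * Resolvent estimates *)

Section WeightedNorm.
Variables (R : realType) (eta : 'I_6 -> {posnum R}).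
Implicit Types (X : 'cV[R]_6) (A : 'M[R]_6).
Notation vnorm := (vnorm eta).
Notation mxnorm := (mxnorm eta).

Lemma vnorm_ge0 X : 0 <= vnorm X.
Proof. by apply: sumr_ge0 => i _; rewrite mulr_ge0. Qed.

Lemma vnormD X X' : vnorm (X + X') <= vnorm X + vnorm X'.
Proof.
rewrite /Defs.vnorm -big_split; apply: ler_sum => i _.
by rewrite /= mxE -mulrDl ler_wpM2r// ler_normD.
Qed.

Lemma vnormZ c X : vnorm (c *: X) = `|c| * vnorm X.
Proof. by rewrite /Defs.vnorm mulr_sumr; apply: eq_bigr => i _; rewrite mxE normrM mulrA. Qed.

Lemma vnorm_eq0 X : vnorm X = 0 -> X = 0.
Proof.
move=> X0; apply/colP => i; rewrite mxE; apply/normr0_eq0/le_anti; rewrite normr_ge0 andbT.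
rewrite -(pmulr_lle0 _ (_ : 0 < (eta i)%:num))// -X0 /Defs.vnorm (bigD1 i)//= lerDl.
by apply: sumr_ge0 => j _; rewrite mulr_ge0.
Qed.

Lemma vnorm_mulmx_bounded A : exists2 C, 0 <= C & forall X, vnorm (A *m X) <= C * vnorm X.
Proof.
exists (\sum_i \sum_j `|A i j| * (eta i)%:num / (eta j)%:num).
  by apply: sumr_ge0 => i _; apply: sumr_ge0 => j _; rewrite !mulr_ge0 ?invr_ge0.
move=> X; rewrite [X in X <= _]/Defs.vnorm mulr_suml; apply: ler_sum => i _.
rewrite mxE mulr_suml; apply: (@le_trans _ _ (\sum_j `|A i j| * `|X j 0| * (eta i)%:num)).
  rewrite -mulr_suml ler_wpM2r//; apply: le_trans (ler_norm_sum _ _ _) _.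
  by apply: ler_sum => j _; rewrite normrM.
apply: ler_sum => j _.
have -> : `|A i j| * `|X j 0| * (eta i)%:num =
    `|A i j| * (eta i)%:num / (eta j)%:num * (`|X j 0| * (eta j)%:num).
  by field; exact: lt0r_neq0.
rewrite ler_wpM2l ?mulr_ge0 ?invr_ge0// /Defs.vnorm (bigD1 j)//= lerDl.
by apply: sumr_ge0 => k _; rewrite mulr_ge0.
Qed.

Lemma mxnorm_has_sup A : has_sup [set vnorm (A *m X) | X in [set X | vnorm X <= 1]].
Proof.
have [C C0 HC] := vnorm_mulmx_bounded A; split.
  exists (vnorm (A *m 0)); exists 0 => //=; rewrite /Defs.vnorm big1 ?ler01// => i _.
  by rewrite mxE normr0 mul0r.
exists C => _ [X X1 <-]; apply: le_trans (HC X) _.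
by rewrite -[leRHS]mulr1 ler_wpM2l.
Qed.

(** [mxnorm] is the norm induced by [vnorm]. *)
Lemma vnorm_mulmx A X : vnorm (A *m X) <= mxnorm A * vnorm X.
Proof.
have [X0|X0] := eqVneq (vnorm X) 0.
  by rewrite (vnorm_eq0 X0) mulmx0 -{1}(scale0r (0 : 'cV[R]_6)) vnormZ normr0 mul0r
    -{1}(scale0r (0 : 'cV[R]_6)) vnormZ normr0 mul0r mulr0.
have Xp : 0 < vnorm X by rewrite lt_def X0 vnorm_ge0.
rewrite -ler_pdivrMr//; apply: (sup_upper_bound (mxnorm_has_sup A)).
exists ((vnorm X)^-1 *: X).
  by rewrite /= vnormZ ger0_norm ?invr_ge0 ?vnorm_ge0// mulVf.
by rewrite -scalemxAr vnormZ ger0_norm ?invr_ge0 ?vnorm_ge0// mulrC.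
Qed.

Lemma mxnorm_ge0 A : 0 <= mxnorm A.
Proof.
apply: (sup_upper_bound (mxnorm_has_sup A)); exists 0 => /=.
  by rewrite -(scale0r (0 : 'cV[R]_6)) vnormZ normr0 mul0r.
by rewrite mulmx0 -(scale0r (0 : 'cV[R]_6)) vnormZ normr0 mul0r.
Qed.

End WeightedNorm.

Section Resolvent.
Variables (R : realType) (eta : 'I_6 -> {posnum R}) (A Qm : 'M[R]_6) (lambda mu : R).
Hypothesis Qu : Qm \in unitmx.
Hypothesis AE : A = invmx Qm *m diag_mx (\row_i [:: lambda; mu; 0; 0; 0; 0]`_i) *m Qm.
Hypotheses (lambda0 : 0 < lambda) (mu0 : mu < 0).
Notation vnorm := (vnorm eta).
Notation mxnorm := (mxnorm eta).
Notation M n := ((n%:R * lambda)%:M - A).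

Let spec : 'rV[R]_6 := \row_i [:: lambda; mu; 0; 0; 0; 0]`_i.

Let spec_le i : spec 0 i <= lambda.
Proof.
have ml : mu <= lambda by exact: ltW (lt_trans mu0 lambda0).
by rewrite mxE; case: i => -[|[|[|[|[|[|//]]]]]] i6 //=; exact: ltW.
Qed.

(* The distance between n lambda and the spectrum, whose largest element is lambda. *)
Let resolvent_gap n i : (2 <= n)%N ->
  0 < (n%:R - 1) * lambda <= n%:R * lambda - spec 0 i.
Proof.
move=> n2; have l1norm : 0 < n%:R - 1 :> R by rewrite subr_gt0 ltr1n.
by rewrite mulr_gt0//= mulrBl mul1r lerD2l lerN2.
Qed.

(* The inverse of n lambda - A, by diagonalization. *)
Let resolvent n := invmx Qm *m diag_mx (\row_i (n%:R * lambda - spec 0 i)^-1) *m Qm.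

Let resolventK n : (2 <= n)%N -> M n *m resolvent n = 1%:M.
Proof.
move=> n2; have -> : M n = invmx Qm *m diag_mx (\row_i (n%:R * lambda - spec 0 i)) *m Qm.
  have -> : diag_mx (\row_i (n%:R * lambda - spec 0 i)) = (n%:R * lambda)%:M - diag_mx spec.
    by apply/matrixP => i j; rewrite !mxE; case: (i == j); rewrite ?mulr1n ?mulr0n ?subr0.
  by rewrite mulmxBr mulmxBl -AE mul_mx_scalar -scalemxAl mulVmx// scalemx1.
rewrite /resolvent -!mulmxA (mulmxA Qm) mulmxV// mul1mx (mulmxA (diag_mx _)) mulmx_diag.
have -> : diag_mx (\row_j ((\row_i (n%:R * lambda - spec 0 i)) 0 j *
    (\row_i (n%:R * lambda - spec 0 i)^-1) 0 j)) = 1%:M.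
  apply/matrixP => i j; rewrite !mxE; case: eqP => [->|_]; rewrite ?mulr1n ?mulr0n//.
  have /andP[g0 gi] := resolvent_gap j n2.
  move: gi; rewrite mxE => gi.
  by rewrite mulfV// gt_eqF// (lt_le_trans g0).
by rewrite mul1mx mulVmx.
Qed.

Lemma resolvent_unit n : (2 <= n)%N -> M n \in unitmx.
Proof. by move=> /resolventK /mulmx1_unit[]. Qed.

Lemma vnorm_resolvent_diag n x : (2 <= n)%N ->
  vnorm (invmx (M n) *m x) <= mxnorm (invmx Qm) * mxnorm Qm / ((n%:R - 1) * lambda) * vnorm x.
Proof.
move=> n2.
have -> : invmx (M n) = resolvent n.
  by rewrite -[LHS]mulmx1 -(resolventK n2) mulmxA mulVmx ?mul1mx// resolvent_unit.
rewrite /resolvent -!mulmxA; apply: le_trans (vnorm_mulmx _ _ _) _.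
rewrite -!mulrA ler_wpM2l ?mxnorm_ge0//.
rewrite mulrA [mxnorm Qm / _]mulrC -mulrA.
have /andP[g0 _] := resolvent_gap 0 n2.
apply: (@le_trans _ _ (((n%:R - 1) * lambda)^-1 * vnorm (Qm *m x))); last first.
  by rewrite ler_wpM2l ?invr_ge0 ?(ltW g0)// vnorm_mulmx.
rewrite mul_diag_mx /Defs.vnorm mulr_sumr; apply: ler_sum => i _; rewrite !mxE.
rewrite mulrA ler_wpM2r// normrM ler_wpM2r//.
have /andP[_] := resolvent_gap i n2; rewrite mxE => gi.
have ip := lt_le_trans g0 gi.
by rewrite ger0_norm ?invr_ge0 ?(ltW ip)// lef_pV2 ?posrE.
Qed.

(** The bound given by the triangle inequality, when n lambda exceeds the norm of A. *)
Lemma vnorm_resolvent_neumann n x : (2 <= n)%N -> mxnorm A < n%:R * lambda ->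
  vnorm (invmx (M n) *m x) <= (n%:R * lambda - mxnorm A)^-1 * vnorm x.
Proof.
move=> n2 An; set y := invmx (M n) *m x.
have xE : x = M n *m y by rewrite mulmxA mulmxV ?mul1mx// resolvent_unit.
have nl0 : 0 < n%:R * lambda by exact: le_lt_trans (mxnorm_ge0 _ _) An.
rewrite mulrC ler_pdivlMr ?subr_gt0// mulrBr.
have : vnorm ((n%:R * lambda) *: y) <= vnorm x + vnorm (A *m y).
  apply: le_trans (vnormD _ _ _); rewrite xE mulmxBl mul_scalar_mx subrK//.
rewrite vnormZ ger0_norm ?(ltW nl0)//; have := vnorm_mulmx eta A y.
by move: (mxnorm A) (vnorm y) (vnorm x) (vnorm _) => a0 b0 c0 d0; lra.
Qed.

Lemma frakM_ge0 n : (2 <= n)%N -> 0 <= frakM eta A Qm lambda n.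
Proof.
move=> n2; have /andP[g0 _] := resolvent_gap 0 n2.
have d0 : 0 <= mxnorm (invmx Qm) * mxnorm Qm / ((n%:R - 1) * lambda).
  by rewrite mulr_ge0// ?invr_ge0 ?(ltW g0)// mulr_ge0 ?mxnorm_ge0.
rewrite /frakM; case: ifPn => // nA; rewrite le_min d0 andbT invr_ge0 subr_ge0.
by rewrite -ltNge ltr_pdivrMr// in nA; exact: ltW.
Qed.

Lemma vnorm_resolvent n x : (2 <= n)%N ->
  vnorm (invmx (M n) *m x) <= frakM eta A Qm lambda n * vnorm x.
Proof.
move=> n2; rewrite /frakM; case: ifPn => nA; first exact: vnorm_resolvent_diag.
rewrite -ltNge ltr_pdivrMr// in nA.
by rewrite minEle; case: ifP => _; [exact: vnorm_resolvent_neumann|exact: vnorm_resolvent_diag].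
Qed.

Lemma frakM_nincr m n : (2 <= m <= n)%N ->
  frakM eta A Qm lambda n <= frakM eta A Qm lambda m.
Proof.
move=> /andP[m2 mn]; have n2 := leq_trans m2 mn.
have /andP[gm _] := resolvent_gap 0 m2; have /andP[gn _] := resolvent_gap 0 n2.
have mnR : m%:R <= n%:R :> R by rewrite ler_nat.
have dmn : mxnorm (invmx Qm) * mxnorm Qm / ((n%:R - 1) * lambda) <=
    mxnorm (invmx Qm) * mxnorm Qm / ((m%:R - 1) * lambda).
  rewrite ler_wpM2l ?mulr_ge0 ?mxnorm_ge0// lef_pV2 ?posrE//.
  by rewrite ler_wpM2r ?(ltW lambda0)// lerD2r.
rewrite /frakM; case: ifPn => nA.
  by rewrite (le_trans mnR nA).
case: ifPn => mA; first by rewrite (le_trans _ dmn)// ge_min lexx orbT.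
rewrite -ltNge ltr_pdivrMr// in mA; rewrite -ltNge ltr_pdivrMr// in nA.
rewrite le_min !ge_min dmn orbT andbT lef_pV2 ?posrE ?subr_gt0// lerD2r.
by rewrite ler_wpM2r// (ltW lambda0).
Qed.

End Resolvent.

(** * The vector field as a polynomial expression *)

Section LexprCoefficients.
Variable R : realType.
Notation vars := ('I_6 -> nat -> R^o).
Implicit Types (x y h : vars) (e : lexpr R).

Lemma eq_leval x y e n : (forall k m, (m <= n)%N -> x k m = y k m) ->
  leval x e n = leval y e n.
Proof.
elim: e n => [s|k|a IHa b IHb|a IHa b IHb|c a IHa] n xy /=.
- by [].
- exact: xy.
- by rewrite IHa ?IHb.
- apply: eq_bigr => k _; rewrite IHa ?IHb// => l m ml; apply: xy; apply: leq_trans ml _.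
    exact: leq_subr.
  by rewrite -ltnS.
- by rewrite IHa.
Qed.

(** The coefficient of order n depends on the coefficients of order n of the
  variables through the derivative at their constant terms. *)
Lemma leval_top x y e n : (0 < n)%N -> (forall k m, (m < n)%N -> x k m = y k m) ->
  leval x e n = leval y e n + leval y (lderiv (fun k _ => x k n - y k n) e) 0.
Proof.
move=> n0 xy.
have below a m : (m < n)%N -> leval x a m = leval y a m.
  by move=> mn; apply: eq_leval => k l lm; apply: xy; exact: leq_ltn_trans lm mn.
elim: e => [s|k|a IHa b IHb|a IHa b IHb|c a IHa] /=.
- by rewrite addr0.
- by rewrite addrC subrK.
- by rewrite IHa IHb; ring.
- rewrite /Defs.cauchy !big_ord1 subnn.
  case: n n0 => // n _ in xy below IHa IHb *.
  rewrite big_ord_recl big_ord_recr /= subn0 subnn IHa IHb.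
  rewrite [in RHS]big_ord_recl [in RHS]big_ord_recr /= subn0 subnn.
  rewrite !(below _ 0%N)// (eq_bigr (fun i : 'I_n => leval y a (bump 0 i) *
      leval y b (n.+1 - bump 0 i)%N)); first by ring.
  by move=> i _; rewrite /bump /= add1n subSS (below a i.+1 (ltn_ord i)) (below b (n - i)%N (leq_subr i n)).
- by rewrite IHa; ring.
Qed.

Lemma eq_leval_lderiv0 x y h h' e : (forall k, x k 0%N = y k 0%N) ->
  (forall k, h k 0%N = h' k 0%N) -> leval x (lderiv h e) 0 = leval y (lderiv h' e) 0.
Proof.
move=> xy hh; have exy a : leval x a 0 = leval y a 0.
  by apply: eq_leval => k [|//] _.
elim: e => [s|k|a IHa b IHb|a IHa b IHb|c a IHa] //=.
- by rewrite IHa IHb.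
- by rewrite /Defs.cauchy !big_ord1 IHa IHb !exy.
- by rewrite IHa.
Qed.

(** The coefficients are constants, that is, multiples of the unit sequence. *)
Fixpoint lconst e : Prop := match e with
  | Cst s => forall n, (0 < n)%N -> s n = 0
  | Var k => True
  | Add a b => lconst a /\ lconst b
  | Mul a b => lconst a /\ lconst b
  | Scl c a => lconst a
  end.

(** If the variables are polynomials of degree at most d in theta, the value is one of
  degree at most d times the degree of the expression. *)
Lemma leval_support x e d : lconst e -> (forall k n, (d < n)%N -> x k n = 0) ->
  forall n, (ldeg e * d < n)%N -> leval x e n = 0.
Proof.
move=> + xd; elim: e => [s|k|a IHa b IHb|a IHa b IHb|c a IHa] /=.
- by move=> s0 n; exact: s0.
- by move=> _ n; rewrite mul1n; exact: xd.
- move=> [wa wb] n; rewrite maxnMl gtn_max => /andP[an bn].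
  by rewrite IHa ?IHb ?addr0.
- move=> [wa wb] n nd; rewrite /Defs.cauchy big1// => k _.
  case: (ltnP (ldeg a * d) k) => ka; first by rewrite IHa ?mul0r.
  rewrite IHb ?mulr0// ltn_subRL; apply: leq_ltn_trans nd.
  by rewrite mulnDl leq_add2r.
- by move=> wa n nd; rewrite IHa ?mulr0.
Qed.

(** The sum of a series is a morphism of algebras from l^1 to R; on the right, real
  numbers are represented by sequences supported at 0. *)
Lemma lsum_leval x e : vfin x -> lwf e -> lconst e ->
  lsum (leval x e) = leval (fun k n => if n == 0%N then lsum (x k) else 0) e 0.
Proof.
move=> xf; elim: e => [s|k|a IHa b IHb|a IHa b IHb|c a IHa] //=.
- move=> _ s0; apply/cvg_lim => //; apply: cvg_near_cst; exists 1%N => // n /= n0.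
  rewrite /series/= big_ltn// big_nat_cond big1 ?addr0// => i /andP[/andP[i0 _] _].
  exact: s0.
- move=> [wa wb] [ca cb]; rewrite -IHa// -IHb//.
  have sa := summable1_series (leval_summable xf wa).
  have sb := summable1_series (leval_summable xf wb).
  apply/cvg_lim => //.
  have -> : series (fun n => leval x a n + leval x b n) =
      fun n => series (leval x a) n + series (leval x b) n.
    by apply/funext => n; rewrite /series /= big_split.
  exact: cvgD sa sb.
- move=> [wa wb] [ca cb]; rewrite (lsum_cauchy (leval_summable xf wa) (leval_summable xf wb)).
  by rewrite IHa// IHb// /Defs.cauchy big_ord1 subn0.
- move=> wa ca; rewrite -IHa//; apply/cvg_lim => //.
  have -> : series (fun n => c * leval x a n) = fun n => c * series (leval x a) n.
    by apply/funext => n; rewrite /series /= mulr_sumr.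
  by apply: cvgMr; exact: summable1_series (leval_summable xf wa).
Qed.

(** Translation of the variables by s. *)
Fixpoint lsubst (s : vars) e : lexpr R := match e with
  | Cst t => Cst t
  | Var k => Add (Cst (s k)) (Var _ k)
  | Add a b => Add (lsubst s a) (lsubst s b)
  | Mul a b => Mul (lsubst s a) (lsubst s b)
  | Scl c a => Scl c (lsubst s a)
  end.

Lemma leval_lsubst s x e : leval x (lsubst s e) = leval (fun k n => s k n + x k n) e.
Proof. by elim: e => //= [a -> b ->|a -> b ->|c a ->]. Qed.

Lemma ldeg_lsubst s e : ldeg (lsubst s e) = ldeg e.
Proof. by elim: e => //= [a -> b ->|a -> b ->]. Qed.

Lemma lwf_lsubst s e : vfin s -> lwf e -> lwf (lsubst s e).
Proof.
by move=> sf; elim: e => //= [a IHa b IHb|a IHa b IHb] [/IHa ? /IHb ?].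
Qed.

(** Finite sums of expressions. *)
Definition lsumexpr (I : finType) (F : I -> lexpr R) : lexpr R :=
  foldr (fun i e => Add (F i) e) (Cst (fun=> 0)) (enum I).

Lemma lsumexprP (I : finType) (P : lexpr R -> Prop) (F : I -> lexpr R) : P (Cst (fun=> 0)) ->
  (forall u v, P u -> P v -> P (Add u v)) -> (forall i, P (F i)) -> P (lsumexpr F).
Proof. by move=> P0 PD PF; rewrite /lsumexpr; elim: (enum I) => //= i s; exact: PD. Qed.

Lemma leval_lsumexpr (I : finType) x (F : I -> lexpr R) n :
  leval x (lsumexpr F) n = \sum_i leval x (F i) n.
Proof.
by rewrite -big_enum /lsumexpr; elim: (enum I) => [|i s /= ->]; rewrite ?big_nil ?big_cons.
Qed.

End LexprCoefficients.

Section FieldExpression.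
Variable R : realType.
Notation vars := ('I_6 -> nat -> R^o).
Implicit Types (x y h : vars) (e : lexpr R) (p : nat -> 'cV[R]_6) (X H : 'cV[R]_6).

(** The coordinates x, y and z^(i) of R^6. *)
Definition iX : 'I_6 := lshift 4 (0 : 'I_2).
Definition iY : 'I_6 := lshift 4 (1 : 'I_2).
Definition iZ (i : 'I_4) : 'I_6 := rshift 2 i.

(** The linear forms L_1 and L_2, and the sums that appear in f. *)
Definition L1x (i : 'I_4) : lexpr R := Add (Add (Scl (2 * a R i) (Var _ iX))
  (Scl (b R i) (Var _ iY))) (Scl (- w1 R i) (Cst (@cauchy1 R))).
Definition L2x (i : 'I_4) : lexpr R := Add (Add (Scl (b R i) (Var _ iX))
  (Scl (2 * c R i) (Var _ iY))) (Scl (- w2 R i) (Cst (@cauchy1 R))).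
Definition S1x : lexpr R := lsumexpr (fun i => Mul (L1x i) (Var _ (iZ i))).
Definition S2x : lexpr R := lsumexpr (fun i => Mul (L2x i) (Var _ (iZ i))).

(** The components of f, as polynomial expressions. *)
Definition fexpr (i : 'I_6) : lexpr R :=
  match fintype.split (i : 'I_(2 + 4)) with
  | inl k => if k == 0 then Scl (-1) S1x else Scl (-1) S2x
  | inr j => Scl (-1) (Mul (Add (Mul (L1x j) S1x) (Mul (L2x j) S2x)) (Var _ (iZ j)))
  end.

Lemma leval_fexpr x i : leval x (fexpr i) = field_over (@Defs.cauchy R) (@cauchy1 R) x i.
Proof.
have L1E j : leval x (L1x j) = L1 (@cauchy1 R) x j.
  by apply/funext => n; rewrite /= mulNr.
have L2E j : leval x (L2x j) = L2 (@cauchy1 R) x j.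
  by apply/funext => n; rewrite /= mulNr.
have S1E : leval x S1x = S1 (@Defs.cauchy R) (@cauchy1 R) x.
  apply/funext => n; rewrite leval_lsumexpr /S1 fct_sumE; apply: eq_bigr => j _.
  by rewrite -L1E.
have S2E : leval x S2x = S2 (@Defs.cauchy R) (@cauchy1 R) x.
  apply/funext => n; rewrite leval_lsumexpr /S2 fct_sumE; apply: eq_bigr => j _.
  by rewrite -L2E.
rewrite /fexpr /field_over; case: (fintype.split _) => [k|j].
  by case: ifP => _; apply/funext => n /=; rewrite mulN1r ?S1E ?S2E.
apply/funext => n /=; rewrite mulN1r; congr (- _); congr (cauchy _ _ n).
by apply/funext => m; rewrite S1E S2E -L1E -L2E.
Qed.

Lemma fcoefE p n i : fcoef p n i 0 = leval (fun k => component k p) (fexpr i) n.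
Proof. by rewrite leval_fexpr mxE. Qed.

(** An induction principle on the expressions of f. *)
Lemma fexprP (P : lexpr R -> Prop) : P (Cst (fun=> 0)) -> P (Cst (@cauchy1 R)) ->
  (forall k, P (Var _ k)) ->
  (forall u v, P u -> P v -> P (Add u v)) -> (forall u v, P u -> P v -> P (Mul u v)) ->
  (forall c u, P u -> P (Scl c u)) -> forall i, P (fexpr i).
Proof.
move=> P0 P1 PV PD PM PS i.
have L1P j : P (L1x j) by rewrite /L1x; auto.
have L2P j : P (L2x j) by rewrite /L2x; auto.
have S1P : P S1x by apply: lsumexprP => // j; exact: PM.
have S2P : P S2x by apply: lsumexprP => // j; exact: PM.
by rewrite /fexpr; case: (fintype.split _) => [k|j]; [case: ifP => _|]; auto 6.
Qed.

Lemma fexpr_wf i : lwf (fexpr i).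
Proof.
apply: fexprP => //=; first by have [] := summable10 R.
apply: (l1norm_le (C := 1) _).1 => -[|K]; first by rewrite big_ord0.
by rewrite big_ord_recl /cauchy1 /= normr1 big1 ?addr0// => i' _; rewrite normr0.
Qed.

Lemma fexpr_const i : lconst (fexpr i).
Proof. by apply: fexprP => //= n n0; rewrite /cauchy1 gtn_eqF. Qed.

Lemma fexpr_deg i : (ldeg (fexpr i) <= 4)%N.
Proof.
have dS (F : 'I_4 -> lexpr R) : (forall j, ldeg (F j) <= 2)%N -> (ldeg (lsumexpr F) <= 2)%N.
  by move=> F2; apply: (lsumexprP (P := fun e => ldeg e <= 2)%N) => //= u v ? ?; rewrite geq_max; apply/andP.
have S1d : (ldeg S1x <= 2)%N by exact: dS.
have S2d : (ldeg S2x <= 2)%N by exact: dS.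
rewrite /fexpr; case: (fintype.split _) => [k|j].
  by case: ifP => _ /=; [exact: leq_trans S1d _ | exact: leq_trans S2d _].
rewrite /= addn1 ltnS geq_max /= !maxn0 maxnn add1n.
by rewrite !ltnS S1d S2d.
Qed.

(** A point of R^6, seen as six sequences supported at 0. *)
Definition flat X : vars := fun k n => if n == 0%N then X k 0 else 0.

(** The value of f at a point is the constant term of its expression. *)
Lemma fE X i : f X i 0 = leval (flat X) (fexpr i) 0.
Proof.
have L1E j : leval (flat X) (L1x j) 0 = L1 (A := R^o) 1 (fun k => X k 0) j.
  by rewrite /= /cauchy1 mulNr.
have L2E j : leval (flat X) (L2x j) 0 = L2 (A := R^o) 1 (fun k => X k 0) j.
  by rewrite /= /cauchy1 mulNr.
have S1E : leval (flat X) S1x 0 = S1 (A := R^o) *%R 1 (fun k => X k 0).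
  rewrite leval_lsumexpr; apply: eq_bigr => j _.
  by rewrite -L1E /= /Defs.cauchy big_ord1.
have S2E : leval (flat X) S2x 0 = S2 (A := R^o) *%R 1 (fun k => X k 0).
  rewrite leval_lsumexpr; apply: eq_bigr => j _.
  by rewrite -L2E /= /Defs.cauchy big_ord1.
rewrite mxE /fexpr /field_over; case: (fintype.split _) => [k|j].
  by case: ifP => _ /=; rewrite mulN1r ?S1E ?S2E.
rewrite -L1E -L2E -S1E -S2E [RHS]/= /Defs.cauchy !big_ord1 /= mulN1r.
by [].

Qed.

End FieldExpression.

Section FieldDifferential.
Variable R : realType.
Notation vars := ('I_6 -> nat -> R^o).
Implicit Types (x y h : vars) (e : lexpr R) (p : nat -> 'cV[R]_6) (X H : 'cV[R]_6).

Lemma flat_vfin X : vfin (flat X) /\ forall k, l1norm (flat X k) <= `|X|.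
Proof.
have flatb k : forall K, \sum_(n < K) `|flat X k n| <= `|X|.
  case=> [|K]; first by rewrite big_ord0.
  rewrite big_ord_recl big1 ?addr0 /flat /= => [|i _]; last by rewrite normr0.
  rewrite [leRHS]/Num.norm/= mx_normrE.
  exact: (le_bigmax _ (fun ij => `|X ij.1 ij.2|) (k, 0)).
by split=> k; have [] := l1norm_le (flatb k).
Qed.

Lemma mx_norm_le m n (M : 'M[R]_(m, n)) (C : R) : 0 <= C ->
  (forall i j, `|M i j| <= C) -> `|M| <= C.
Proof.
by move=> C0 MC; rewrite /Num.norm/= mx_normrE; apply/bigmax_leP; split.
Qed.

Lemma entry_le_norm m n (M : 'M[R]_(m, n)) i j : `|M i j| <= `|M|.
Proof.
rewrite [leRHS]/Num.norm/= mx_normrE.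
exact: (le_bigmax _ (fun ij => `|M ij.1 ij.2|) (i, j)).
Qed.

(** The derivative of f at X in the direction H. *)
Definition fderiv X H : 'cV[R]_6 := \col_i leval (flat X) (lderiv (flat H) (fexpr R i)) 0.

Lemma fderiv_linear X : linear (fderiv X).
Proof.
move=> s H H'; apply/colP => i; rewrite !mxE.
have -> : flat (s *: H + H') = fun k n => s * flat H k n + flat H' k n.
  apply/funext => k; apply/funext => n; rewrite /flat; case: ifP => _; first by rewrite !mxE.
  by rewrite mulr0 addr0.
exact: leval_lderivZD.
Qed.

Lemma f_diff X : differentiable (@f R) X /\ 'd (@f R) X = fderiv X :> ('cV[R]_6 -> 'cV[R]_6).
Proof.
pose dM := GRing.isLinear.Build _ _ _ _ _ (fderiv_linear X).
pose dL : {linear 'cV[R]_6 -> 'cV[R]_6} := HB.pack (fderiv X) dM.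
have HC i : exists C, 0 <= C /\ forall H, `|H| <= 1 ->
    `|fderiv X H i 0| <= C * `|H| /\
    `|(f (H + X) - f X - fderiv X H) i 0| <= C * `|H| ^+ 2.
  have [C C0 HC] := leval_expand (flat_vfin X).1 (fexpr_wf R i).
  exists C; split => // H H1.
  have [_ dC [rem [rS rC E]]] := HC _ (flat_vfin H).1 _ (flat_vfin H).2 H1.
  split.
    rewrite mxE; apply: le_trans dC; apply: coef_le_l1norm; apply: leval_summable.
      exact: (flat_vfin X).1.
    by apply: lwf_lderiv; [exact: (flat_vfin H).1 | exact: fexpr_wf].
  apply: le_trans rC; apply: le_trans (coef_le_l1norm 0 rS).
  rewrite [X in `|X| <= _](_ : _ = rem 0%N)//.
  have subE (M1 M2 M3 : 'cV[R]_6) : (M1 - M2 - M3) i 0 = M1 i 0 - M2 i 0 - M3 i 0.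
    by rewrite !mxE.
  rewrite subE !fE [fderiv _ _ _ _]mxE.
  have -> : flat (H + X) = fun k n => flat X k n + flat H k n.
    apply/funext => k; apply/funext => n; rewrite /flat; case: ifP => _; rewrite ?addr0//.
    by rewrite mxE addrC.
  by rewrite E; ring.
have [C {}HC] := choice HC.
pose S := \sum_i C i; have CS i : C i <= S.
  by rewrite /S (bigD1 i)//= lerDl; apply: sumr_ge0 => j _; have [] := HC j.
have S0 : 0 <= S by apply: le_trans (CS 0); have [] := HC 0.
apply: (@quadratic_differentiable R _ _ (@f R) dL X S 1) => // H H1.
have HH : 0 <= `|H| by [].
split; apply: mx_norm_le; rewrite ?mulr_ge0 ?exprn_ge0// => i j; rewrite (ord1 j).
  by have [_ /(_ H H1)[+ _]] := HC i => /le_trans; apply; rewrite ler_wpM2r.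
by have [_ /(_ H H1)[_]] := HC i => /le_trans; apply; rewrite ler_wpM2r// exprn_ge0.
Qed.

Lemma Jac_mulmx m n (F : 'cV[R]_n -> 'cV[R]_m) (X H : 'cV[R]_n) : Jac F X *m H = 'd F X H.
Proof.
apply/colP => i; rewrite mxE.
have HE : H = \sum_j H j 0 *: delta_mx j 0.
  by rewrite {1}(matrix_sum_delta H); apply: eq_bigr => j _; rewrite big_ord1.
rewrite [in RHS]HE linear_sum summxE; apply: eq_bigr => j _.
by rewrite linearZ /= !mxE mulrC.
Qed.

(** The n-th coefficient of f(p) is linear in p_n, through Df(p_0). *)
Lemma fcoef_top p n : (0 < n)%N ->
  fcoef p n = fcoef (trunc n.-1 p) n + Jac (@f R) (p 0%N) *m p n.
Proof.
move=> n0; rewrite Jac_mulmx (f_diff _).2; apply/colP => i.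
rewrite [RHS]mxE !fcoefE [fderiv _ _ _ _]mxE.
rewrite (leval_top (y := fun k => component k (trunc n.-1 p)) _ n0); last first.
  by move=> k m mn; rewrite /component /trunc -ltnS prednK// mn.
congr (_ + _).
have -> : (fun k => (fun=> component k p n - component k (trunc n.-1 p) n) : nat -> R^o) =
    fun k => fun=> p n k 0.
  apply/funext => k; apply/funext => _; rewrite /component /trunc.
  by rewrite leqNgt prednK// leqnn/= mxE subr0.
apply: eq_leval_lderiv0 => k; rewrite /component /trunc /flat //.
Qed.

(** f has degree 4. *)
Lemma fcoef_support p d n : (forall m, (d < m)%N -> p m = 0) -> (4 * d < n)%N -> fcoef p n = 0.
Proof.
move=> pd nd; apply/colP => i; rewrite fcoefE [RHS]mxE.
apply: (leval_support (d := d) (fexpr_const R i)) => [k m dm|].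
  by rewrite /component pd// mxE.
by apply: leq_ltn_trans nd; rewrite leq_mul2r fexpr_deg orbT.
Qed.

Lemma eq_fcoef p p' n : (forall m, (m <= n)%N -> p m = p' m) -> fcoef p n = fcoef p' n.
Proof.
move=> pp; apply/colP => i; rewrite !fcoefE; apply: eq_leval => k m mn.
by rewrite /component pp.
Qed.

Lemma fcoef0 p : fcoef p 0 = f (p 0%N).
Proof. by apply/colP => i; rewrite fcoefE fE; apply: eq_leval => k [|//]. Qed.

End FieldDifferential.

(** * The operator T *)

Section Operator.
Variables (R : realType) (eta : 'I_6 -> {posnum R}) (N : nat) (phat : N.-tuple 'cV[R]_6).
Hypothesis N2 : (2 <= N)%N.
Notation X := (Xeta eta).
Notation vars := ('I_6 -> nat -> R^o).
Notation A := (Jac (@f R) phat`_0).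
Implicit Types q : X.

Let N0 : (0 < N)%N. Proof. exact: ltnW. Qed.

(** The finite sequence phat, extended by zeros. *)
Definition phat_vars : vars := fun k n => phat`_n k 0.

Lemma phat_vars_vfin : vfin phat_vars.
Proof.
move=> k; apply: (l1norm_le (C := \sum_(n < N) `|phat_vars k n|) _).1 => K.
apply: (@le_trans _ _ (\sum_(n < N + K) `|phat_vars k n|)).
  by rewrite addnC big_split_ord/= lerDl sumr_ge0.
rewrite big_split_ord/= gerDl big1// => i _.
by rewrite /phat_vars nth_default ?mxE ?normr0// size_tuple leq_addr.
Qed.

(** The components of g: g_n(p) = f_n(p) - Df(p_0) p_n, where p = (phat, q). The
  coefficients of index less than N are irrelevant, as [lmap] drops them. *)
Definition gexpr (i : 'I_6) : lexpr R :=
  Add (lsubst phat_vars (fexpr R i)) (Scl (-1) (lsumexpr (fun k => Scl (A i k) (Var _ k)))).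

Lemma gexpr_wf i : lwf (gexpr i).
Proof.
split; first by apply: lwf_lsubst; [exact: phat_vars_vfin | exact: fexpr_wf].
by apply: (lsumexprP (P := @lwf R)) => //=; have [] := summable10 R.
Qed.

Lemma gexpr_deg i : (ldeg (gexpr i) <= 4)%N.
Proof.
rewrite /= geq_max ldeg_lsubst fexpr_deg/=.
apply: (lsumexprP (P := fun e => ldeg e <= 4)%N) => //= u v ? ?.
by rewrite geq_max; apply/andP.
Qed.

Lemma component_glue q k n : component k (glue phat q) n = phat_vars k n + tail_vars N q k n.
Proof.
rewrite /component /glue /tail_vars /phat_vars; case: ltnP => nN; first by rewrite addr0.
by rewrite nth_default ?size_tuple// mxE add0r.
Qed.

(** g is given by polynomial expressions. *)
Lemma gE : g phat = lmap N gexpr_wf :> (X -> X).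
Proof.
apply/funext => q; apply/val_inj/funext => n; apply/colP => i.
have n0 : (0 < N + n)%N by rewrite addn_gt0 N0.
rewrite [RHS]mxE /= /gcoef.
have := fcoef_top (glue phat q) n0.
have g0 : glue phat q 0%N = phat`_0 by rewrite /glue N0.
rewrite g0 => /(congr1 (fun Z : 'cV[R]_6 => Z i 0)) E.
have addE (M1 M2 : 'cV[R]_6) : (M1 + M2) i 0 = M1 i 0 + M2 i 0 by rewrite mxE.
rewrite addE in E.
have -> : fcoef (trunc (N + n).-1 (glue phat q)) (N + n) i 0 =
   fcoef (glue phat q) (N + n) i 0 - (A *m glue phat q (N + n)%N) i 0.
  by rewrite E addrK.
rewrite fcoefE leval_lsubst mulN1r; congr (leval _ _ _ - _).
  by apply/funext => k; apply/funext => m; rewrite component_glue.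
rewrite leval_lsumexpr mxE; apply: eq_bigr => k _ /=.
by rewrite /glue /tail_vars ltnNge leq_addr /= addKn.
Qed.

Lemma psum_vnorm_le q K : \sum_(n < K) vnorm eta (q n) <= `|q|.
Proof.
rewrite Xeta_normrE /vnorm exchange_big/=; apply: ler_sum => i _.
by rewrite -mulr_suml ler_wpM2r// (psum_le_l1norm K (summable1_component i q)).
Qed.

Lemma vnorm0 : vnorm eta 0 = 0.
Proof. by rewrite /vnorm big1// => i _; rewrite mxE normr0 mul0r. Qed.

Lemma vnorm_sum (I : Type) (r : seq I) (x : I -> 'cV[R]_6) :
  vnorm eta (\sum_(i <- r) x i) <= \sum_(i <- r) vnorm eta (x i).
Proof.
elim/big_ind2 : _ => //; first by rewrite vnorm0.
by move=> x1 y1 x2 y2 le1 le2; apply: le_trans (vnormD _ _ _) (lerD le1 le2).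
Qed.

Variables (Qm : 'M[R]_6) (lambda mu : R).
Hypothesis Qu : Qm \in unitmx.
Hypothesis AE : A = invmx Qm *m diag_mx (\row_i [:: lambda; mu; 0; 0; 0; 0]`_i) *m Qm.
Hypotheses (lambda0 : 0 < lambda) (mu0 : mu < 0).
Notation M n := ((n%:R * lambda)%:M - A).

(** T_n(0) vanishes for n > 4 N - 4, so that Y is the norm of T(0). *)
Lemma psum_T0_le K :
  \sum_(n < K) vnorm eta (T phat A lambda (N + n) (0 : X)) <= Y eta phat A lambda.
Proof.
have T0 n : (4 * N - 4 < n)%N -> T phat A lambda n (0 : X) = 0.
  move=> nN; rewrite /T /gcoef (fcoef_support (d := N.-1)) ?mulmx0//.
    move=> m Nm; rewrite /Defs.trunc /glue; case: ifP => // _.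
    by case: ifP => // mN; move: Nm; rewrite ltnNge -ltnS prednK// mN.
  by rewrite -subn1 mulnBr muln1.
have NN : (N <= (4 * N - 4).+1)%N by rewrite -(prednK N0) mulnS addKn ltnS leq_pmull.
rewrite /Defs.Y -[X in index_iota X _]add0n big_addn big_mkord.
set L := (_ - N)%N.
apply: (@le_trans _ _ (\sum_(n < L + K) vnorm eta (T phat A lambda (N + n) (0 : X)))).
  by rewrite addnC big_split_ord/= lerDl sumr_ge0// => i _; exact: vnorm_ge0.
rewrite big_split_ord/= [X in _ + X]big1 ?addr0 => [|i _].
  by rewrite le_eqVlt; apply/orP; left; apply/eqP; apply: eq_bigr => i _; rewrite addnC.
rewrite T0 ?vnorm0//; rewrite addnA subnKC//; exact: leq_addr.
Qed.

(** The bound on the norm of T(q) that comes from the Taylor formula at 0. *)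
Lemma psum_T_le q K :
  \sum_(n < K) vnorm eta (T phat A lambda (N + n) q) <=
  Y eta phat A lambda +
  frakM eta A Qm lambda N * \sum_(k < 4) (k.+1`!)%:R^-1 * (Zmax eta phat k.+1 * `|q| ^+ k.+1).
Proof.
pose D k : X := multi_diff (g phat) (nseq k q) 0.
have M0 : 0 <= frakM eta A Qm lambda N by exact: (frakM_ge0 eta A Qm lambda0 mu0 N2).
have Tle n : vnorm eta (T phat A lambda (N + n) q) <=
    vnorm eta (T phat A lambda (N + n) (0 : X)) +
    \sum_(k < 4) frakM eta A Qm lambda N * (k.+1`!%:R^-1 * vnorm eta (D k.+1 n)).
  have -> : T phat A lambda (N + n) q = T phat A lambda (N + n) (0 : X) +
      \sum_(k < 4) (k.+1`!)%:R^-1 *: (invmx (M (N + n)) *m D k.+1 n).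
    have := lmap_taylor N gexpr_wf q gexpr_deg; rewrite -gE big_ord_recl /= fact0 invr1 scale1r => E.
    rewrite /T -[gcoef phat (N + n) q]/(g phat q n) E.
    rewrite -[gcoef phat (N + n) _]/(g phat (0 : X) n).
    have vadd (x y : X) : (x + y : X) n = x n + y n by [].
    have vsum (G : 'I_4 -> X) : (\sum_k G k : X) n = \sum_k G k n by elim/big_ind2 : _ => // x y z t <- <-.
    rewrite vadd vsum mulmxDr mulmx_sumr; congr (_ + _).
    by apply: eq_bigr => k _; rewrite -scalemxAr.
  apply: le_trans (vnormD _ _ _) _; rewrite lerD2l; apply: le_trans (vnorm_sum _ _) _.
  apply: ler_sum => k _; rewrite vnormZ ger0_norm ?invr_ge0 ?ler0n// mulrCA ler_wpM2l ?invr_ge0 ?ler0n//.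
  have n2 : (2 <= N + n)%N by exact: leq_trans N2 (leq_addr _ _).
  apply: le_trans (vnorm_resolvent eta Qu AE lambda0 mu0 _ n2) _.
  rewrite ler_wpM2r ?vnorm_ge0//; apply: (frakM_nincr eta A Qm lambda0 mu0).
  by rewrite N2 leq_addr.
apply: (@le_trans _ _ (\sum_(n < K) (vnorm eta (T phat A lambda (N + n) (0 : X)) +
    \sum_(k < 4) frakM eta A Qm lambda N * (k.+1`!%:R^-1 * vnorm eta (D k.+1 n))))).
  by apply: ler_sum => n _; exact: Tle.
rewrite big_split/= lerD ?psum_T0_le// exchange_big/= mulr_sumr; apply: ler_sum => k _.
rewrite -mulr_sumr ler_wpM2l// -mulr_sumr ler_wpM2l ?invr_ge0 ?ler0n//.
apply: le_trans (psum_vnorm_le _ _) _.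
exact: (multi_diff_norm_le gE).
Qed.

End Operator.

(** * The coefficients of the parametrization *)

Section Coefficients.
Variables (R : realType) (eta : 'I_6 -> {posnum R}) (N : nat) (phat : N.-tuple 'cV[R]_6).
Variables (Qm : 'M[R]_6) (lambda mu rbar : R).
Notation A := (Jac (@f R) phat`_0).
Notation M n := ((n%:R * lambda)%:M - A).
Notation X := (Xeta eta).
Hypothesis N2 : (2 <= N)%N.
Hypothesis Qu : Qm \in unitmx.
Hypothesis AE : A = invmx Qm *m diag_mx (\row_i [:: lambda; mu; 0; 0; 0; 0]`_i) *m Qm.
Hypotheses (lambda0 : 0 < lambda) (mu0 : mu < 0).
Hypothesis f0 : f phat`_0 = 0.
Hypothesis A1 : A *m phat`_1 = lambda *: phat`_1.
Hypothesis phatE : forall n, (2 <= n < N)%N ->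
  (n%:R * lambda) *: phat`_n = fcoef (fun m => phat`_m) n.
Hypotheses (rbar0 : 0 <= rbar) (Prbar : Y eta phat A lambda +
  frakM eta A Qm lambda N * \sum_(k < 4) (k.+1`!)%:R^-1 * (Zmax eta phat k.+1 * rbar ^+ k.+1)
  <= rbar).

(* One step of the recurrence; its value at n only depends on p_m for m < n. *)
Let step (p : nat -> 'cV[R]_6) : nat -> 'cV[R]_6 := fun n =>
  if (n < N)%N then phat`_n else invmx (M n) *m fcoef (trunc n.-1 p) n.

(** The fixed point of T, preceded by phat. As each step determines one more
  coefficient, the n-th coefficient is final after n + 1 steps. *)
Definition coefs : nat -> 'cV[R]_6 := fun n => iter n.+1 step (fun=> 0) n.

Let eq_step p p' n : (forall m, (m < n)%N -> p m = p' m) -> step p n = step p' n.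
Proof.
move=> pp; rewrite /step; case: ltnP => // Nn; congr (_ *m _); apply: eq_fcoef => m mn.
rewrite /Defs.trunc; case: leqP => // mn1; apply: pp.
by rewrite (leq_ltn_trans mn1)// prednK// (leq_trans _ Nn)// ltnW.
Qed.

Let iter_step k n : (n < k)%N -> iter k step (fun=> 0) n = coefs n.
Proof.
elim/ltn_ind: n k => n IH [//|k] nk; rewrite /coefs !iterS.
apply: eq_step => m mn; rewrite !IH//; exact: leq_trans mn _.
Qed.

Lemma coefs_step n : coefs n = step coefs n.
Proof. by rewrite {1}/coefs iterS; apply: eq_step => m mn; rewrite iter_step. Qed.

Lemma coefs_phat n : (n < N)%N -> coefs n = phat`_n.
Proof. by move=> nN; rewrite coefs_step /step nN. Qed.

Lemma coefs_T n : (N <= n)%N -> coefs n = T phat A lambda n (fun m => coefs (N + m)).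
Proof.
move=> Nn; rewrite coefs_step /step ltnNge Nn /T /gcoef; congr (_ *m _).
apply: eq_fcoef => m _; rewrite /Defs.trunc; case: ifP => // _.
rewrite /glue; case: ltnP => mN; first exact: coefs_phat.
by rewrite subnKC.
Qed.

(** The coefficients solve the invariance equation at every order. *)
Lemma coefs_invariance n : (n%:R * lambda) *: coefs n = fcoef coefs n.
Proof.
case: n => [|[|n]].
(* Order 0: the equilibrium; order 1: the eigenvector; then the hypothesis on phat
  below N, and the fixed point equation from N on. *)
- by rewrite mul0r scale0r fcoef0 coefs_phat ?f0// ltnW.
- rewrite mul1r fcoef_top// (fcoef_support (d := 0)) ?add0r//; last first.
    by move=> m m0; rewrite /Defs.trunc leqNgt m0.
  by rewrite (coefs_phat (ltnW N2)) coefs_phat// A1.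
- case: (ltnP n.+2 N) => nN.
    rewrite coefs_phat// phatE ?nN//; apply: eq_fcoef => m mn.
    by rewrite coefs_phat// (leq_ltn_trans mn).
  rewrite fcoef_top// (coefs_phat (ltnW N2)).
  have -> : fcoef (trunc n.+2.-1 coefs) n.+2 = M n.+2 *m coefs n.+2.
    rewrite [in RHS]coefs_step /step ltnNge nN /= mulmxA mulmxV ?mul1mx//.
    exact: (resolvent_unit Qu AE lambda0 mu0).
  by rewrite mulmxBl mul_scalar_mx subrK.
Qed.

Lemma eq_gcoef n q q' : (forall m, (m < n)%N -> q m = q' m) ->
  gcoef phat (N + n) q = gcoef phat (N + n) q'.
Proof.
move=> qq; apply: eq_fcoef => m _; rewrite /Defs.trunc; case: leqP => // mn.
rewrite /glue; case: ltnP => // Nm; apply: qq; rewrite ltn_subLR//.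
by rewrite -ltnS prednK ?addn_gt0 ?(ltnW N2)// in mn.
Qed.

(** The tail of the solution is in the closed ball of radius rbar. *)
Lemma coefs_bound K : \sum_(n < K) vnorm eta (coefs (N + n)) <= rbar.
Proof.
elim: K => [|K IH]; first by rewrite big_ord0.
(* u is the tail truncated to its first K coefficients. It determines the first K + 1
  coefficients of T(u), which are those of the solution. *)
pose u n : 'cV[R]_6 := if (n < K)%N then coefs (N + n) else 0.
have psum_u L : \sum_(n < L) vnorm eta (u n) <= \sum_(n < K) vnorm eta (coefs (N + n)).
  apply: (@le_trans _ _ (\sum_(n < K + L) vnorm eta (u n))).
    by rewrite addnC big_split_ord/= lerDl sumr_ge0// => i _; exact: vnorm_ge0.
  rewrite big_split_ord/= [X in _ + X]big1 ?addr0 => [|i _]; last first.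
    by rewrite /u ltnNge leq_addr vnorm0.
  by apply: ler_sum => i _; rewrite /u ltn_ord.
have upsum i L : \sum_(n < L) `|component i u n| <=
    ((eta i)%:num)^-1 * \sum_(n < K) vnorm eta (coefs (N + n)).
  rewrite mulrC ler_pdivlMr//; apply: le_trans (psum_u L).
  rewrite mulr_suml; apply: ler_sum => n _.
  rewrite /vnorm (bigD1 i)//= lerDl; apply: sumr_ge0 => j _; exact: mulr_ge0.
have uX : u \in Xeta_pred eta by apply/eta_norm_ltyP => i; exact: (l1norm_le (upsum i)).1.
pose q : X := MkXeta uX.
have qr : `|q| <= rbar.
  apply: le_trans IH; rewrite Xeta_normrE.
  have -> : \sum_(n < K) vnorm eta (coefs (N + n)) =
      \sum_(i < 6) (\sum_(n < K) `|component i u n|) * (eta i)%:num.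
    under [RHS]eq_bigr do rewrite mulr_suml.
    rewrite exchange_big/=; apply: eq_bigr => n _; apply: eq_bigr => i _.
    by rewrite /component /u ltn_ord.
  apply: ler_sum => i _; rewrite ler_wpM2r//; apply: (l1norm_le _).2 => L.
  apply: (@le_trans _ _ (\sum_(n < K + L) `|component i u n|)).
    by rewrite addnC big_split_ord/= lerDl sumr_ge0.
  rewrite big_split_ord/= [X in _ + X]big1 ?addr0// => n _.
  by rewrite /component /u ltnNge leq_addr mxE normr0.
apply: le_trans Prbar.
have -> : \sum_(n < K.+1) vnorm eta (coefs (N + n)) =
    \sum_(n < K.+1) vnorm eta (T phat A lambda (N + n) q).
  apply: eq_bigr => n _; rewrite coefs_T ?leq_addr// /T; congr (vnorm _ (_ *m _)).
  apply: eq_gcoef => m mn; rewrite /q /= /u (leq_trans mn)//.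
  by rewrite -ltnS.
apply: le_trans (psum_T_le N2 Qu AE lambda0 mu0 q K.+1) _.
rewrite lerD2l; apply: ler_wpM2l; first exact: (frakM_ge0 eta A Qm lambda0 mu0 N2).
apply: ler_sum => k _; rewrite ler_wpM2l ?invr_ge0 ?ler0n// ler_wpM2l//.
  exact: bigmax_ge_id.
by apply: lerXn2r; rewrite ?nnegrE.
Qed.

End Coefficients.

Section TailBound.
Variables (R : realType) (eta : 'I_6 -> {posnum R}) (N : nat) (pn : nat -> 'cV[R]_6) (r : R).
Hypothesis bnd : forall K, \sum_(n < K) vnorm eta (pn (N + n)%N) <= r.

Lemma vnorm_tail_summable i : summable1 (component i pn).
Proof.
apply: (@norm1_unshift R N).
apply: (l1norm_le (C := ((eta i)%:num)^-1 * r) _).1 => K.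
rewrite mulrC ler_pdivlMr//; apply: le_trans (bnd K).
rewrite mulr_suml; apply: ler_sum => n _; rewrite /vnorm (bigD1 i)//= lerDl.
by apply: sumr_ge0 => j _; rewrite mulr_ge0.
Qed.

Lemma vnorm_tail_le :
  (\sum_(i < 6) \sum_(N <= n <oo) (`|pn n i 0| * (eta i)%:num)%:E <= r%:E)%E.
Proof.
rewrite -nneseries_sum; last by move=> i n _; rewrite lee_fin mulr_ge0.
apply: lime_le.
  by apply: is_cvg_nneseries => n *; apply: sume_ge0 => i _; rewrite lee_fin mulr_ge0.
apply: nearW => K; under eq_bigr do rewrite sumEFin.
rewrite sumEFin lee_fin -[X in index_iota X _]add0n big_addn big_mkord.
apply: le_trans (bnd (K - N)%N); rewrite le_eqVlt; apply/orP; left; apply/eqP.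
by apply: eq_bigr => n _; rewrite addnC.
Qed.

End TailBound.

(** * One-sided derivatives and uniqueness of integral curves *)

Section WithinDerivative.
Variable R : realType.
Implicit Types (W : normedModType R) (A B : set R).

(** The derivative as a first-order approximation; the point s itself is allowed for t. *)
Lemma within_derivP W A (u : R -> W) s d : has_derivative_within A u s d <->
  forall e : R, 0 < e -> exists2 dt : R, 0 < dt & forall t, A t -> `|t - s| < dt ->
    `|u t - u s - (t - s) *: d| <= e * `|t - s|.
Proof.
rewrite /has_derivative_within; split.
  move=> /cvgrPdist_le H e e0; have [dt /= dt0 Hdt] := H e e0.
  exists dt => // t At ts; have [->|nts] := eqVneq t s.
    by rewrite !subrr scale0r subr0 !normr0 mulr0.
  have := Hdt t; rewrite /ball/= distrC => /(_ ts nts At).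
  have nts0 : t - s != 0 by rewrite subr_eq0.
  have -> : d - (t - s)^-1 *: (u t - u s) = - (t - s)^-1 *: (u t - u s - (t - s) *: d).
    by rewrite [RHS]scalerBr scalerA mulNr mulVf// !scaleNr scale1r opprK addrC.
  rewrite normrZ normrN normfV mulrC ler_pdivrMr// normr_gt0//.
move=> H; apply/cvgrPdist_le => e e0; have [dt dt0 Hdt] := H e e0.
exists dt => // t /=; rewrite /ball/= distrC => ts nts At.
have nts0 : t - s != 0 by rewrite subr_eq0.
have -> : d - (t - s)^-1 *: (u t - u s) = - (t - s)^-1 *: (u t - u s - (t - s) *: d).
  by rewrite [RHS]scalerBr scalerA mulNr mulVf// !scaleNr scale1r opprK addrC.
by rewrite normrZ normrN normfV mulrC ler_pdivrMr ?normr_gt0//; exact: Hdt.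
Qed.

Lemma within_deriv_lipschitz W A (u : R -> W) s d : has_derivative_within A u s d ->
  exists2 dt : R, 0 < dt & forall t, A t -> `|t - s| < dt ->
    `|u t - u s| <= (`|d| + 1) * `|t - s|.
Proof.
move=> /within_derivP/(_ 1 ltr01)[dt dt0 H]; exists dt => // t At ts.
have -> : u t - u s = (u t - u s - (t - s) *: d) + (t - s) *: d by rewrite subrK.
apply: le_trans (ler_normD _ _) _; rewrite normrZ mulrDl mul1r addrC mulrC.
by rewrite lerD2l; have := H t At ts; rewrite mul1r.
Qed.

Lemma within_deriv_continuous W A (u : R -> W) : (forall s, A s -> exists d, has_derivative_within A u s d) ->
  {within A, continuous u}.
Proof.
move=> H; apply/subspace_continuousP => s As; have [d /within_deriv_lipschitz[dt dt0 Hd]] := H s As.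
apply/cvgrPdist_le => e e0.
have c0 : 0 < `|d| + 1 by rewrite ltr_wpDl.
exists (Num.min dt (e / (`|d| + 1))); first by rewrite /= lt_min dt0 divr_gt0.
move=> t /=; rewrite /ball /= distrC lt_min => /andP[tdt te] At; rewrite distrC.
apply: le_trans (Hd t At tdt) _; rewrite mulrC -ler_pdivlMr//; exact: ltW.
Qed.

(** Chain rule, with a differentiable outer map. *)
Lemma within_deriv_comp_diff (V W : normedModType R) A (G : V -> W) (u : R -> V) s d :
  differentiable G (u s) -> has_derivative_within A u s d ->
  has_derivative_within A (G \o u) s ('d G (u s) d).
Proof.
move=> Gd ud; have [dt1 dt10 Hl] := within_deriv_lipschitz ud.
have [k k0 Gk] := linear_lipschitz (diff_continuous Gd).
have c0 : 0 < `|d| + 1 by rewrite ltr_wpDl.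
apply/within_derivP => e e0.
have /diff_locallyP[_ /eqaddoP Go] := Gd.
have e1 : 0 < e / 2 / (`|d| + 1) by rewrite !divr_gt0.
have e2 : 0 < e / 2 / k by rewrite !divr_gt0.
have /nbhs_ballP[dt2 /= dt20 H2] := Go _ e1.
move/within_derivP : ud => /(_ _ e2)[dt3 dt30 H3].
exists (Num.min dt1 (Num.min dt3 (dt2 / (`|d| + 1)))).
  by rewrite !lt_min dt10 dt30 divr_gt0.
move=> t At; rewrite !lt_min => /and3P[t1 t3 t2].
have ut := Hl t At t1.
have := H2 (u t - u s); rewrite -ball_normE /= sub0r normrN => Hb.
have {}Hb := Hb (le_lt_trans ut _).
rewrite mulrC -ltr_pdivlMr// in Hb; have {Hb} := Hb t2.
rewrite -[(_ - _ : V -> W) _]/(G (u t - u s + u s) - (G (u s) + 'd G (u s) (u t - u s))).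
rewrite subrK => Hb.
have -> : (G \o u) t - (G \o u) s - (t - s) *: 'd G (u s) d =
   (G (u t) - (G (u s) + 'd G (u s) (u t - u s))) + 'd G (u s) (u t - u s - (t - s) *: d).
  have -> : 'd G (u s) (u t - u s - (t - s) *: d) =
      'd G (u s) (u t - u s) - (t - s) *: 'd G (u s) d by rewrite [LHS]linearB linearZ.
  move: ('d G (u s) (u t - u s)) => L.
  by rewrite opprD [in RHS]addrA [in RHS]addrA subrK.
apply: le_trans (ler_normD _ _) _; rewrite [e]splitr [leRHS]mulrDl; apply: lerD.
  apply: le_trans Hb _; apply: le_trans (ler_wpM2l (ltW e1) ut) _.
  by rewrite mulrA divfK// gt_eqF.
apply: le_trans (Gk _) _; rewrite mulrC -ler_pdivlMr// mulrAC; exact: H3.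
Qed.

(** Chain rule, with a change of the real parameter. *)
Lemma within_deriv_comp_real W A B (u : R -> W) (phi : R -> R^o) s d k :
  (forall t, B t -> A (phi t)) -> has_derivative_within A u (phi s) d ->
  has_derivative_within B phi s k -> has_derivative_within B (u \o phi) s (k *: d).
Proof.
move=> BA ud phid; have [dt1 dt10 Hl] := within_deriv_lipschitz phid.
have c0 : 0 < `|k| + 1 by rewrite ltr_wpDl.
have d0 : 0 < `|d| + 1 by rewrite ltr_wpDl.
apply/within_derivP => e e0.
have e1 : 0 < e / 2 / (`|k| + 1) by rewrite !divr_gt0.
have e2 : 0 < e / 2 / (`|d| + 1) by rewrite !divr_gt0.
move/within_derivP : ud => /(_ _ e1)[dt2 dt20 H2].
move/within_derivP : phid => /(_ _ e2)[dt3 dt30 H3].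
exists (Num.min dt1 (Num.min dt3 (dt2 / (`|k| + 1)))).
  by rewrite !lt_min dt10 dt30 divr_gt0.
move=> t Bt; rewrite !lt_min => /and3P[t1 t3 t2].
have pt := Hl t Bt t1.
have /(H2 _ (BA t Bt)) Hb : `|phi t - phi s| < dt2.
  by apply: le_lt_trans pt _; rewrite mulrC -ltr_pdivlMr.
have -> : (u \o phi) t - (u \o phi) s - (t - s) *: (k *: d) =
  (u (phi t) - u (phi s) - (phi t - phi s) *: d) + (phi t - phi s - (t - s) * k) *: d.
  move: (phi t - phi s) => y.
  have -> : (y - (t - s) * k) *: d = y *: d - (t - s) *: (k *: d) by rewrite scalerA -scalerBl.
  by rewrite addrA subrK.
apply: le_trans (ler_normD _ _) _; rewrite [e]splitr [leRHS]mulrDl; apply: lerD.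
  apply: le_trans Hb _; apply: le_trans (ler_wpM2l (ltW e1) pt) _.
  by rewrite mulrA divfK// gt_eqF.
rewrite normrZ; apply: le_trans (ler_wpM2r (normr_ge0 _) (H3 t Bt t3)) _.
rewrite mulrAC ler_wpM2r// mulrAC.
rewrite ler_pdivrMr// ler_wpM2l ?lerDl// ltW// divr_gt0//.
Qed.

(** At an interior point the derivative is two-sided. *)
Lemma within_deriv_is_derive (u : R -> R^o) (p q s d : R) : p < s < q ->
  has_derivative_within `[p, q] u s d -> is_derive s 1 u d.
Proof.
move=> /andP[ps sq] /within_derivP H.
have cv : h^-1 *: (u (h *: 1 + s) - u s) @[h --> 0^'] --> (d : R^o).
  apply/cvgrPdist_le => e e0; have [dt dt0 Hd] := H e e0.
  exists (Num.min dt (Num.min (s - p) (q - s))) => /=.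
    by rewrite !lt_min dt0 !subr_gt0 ps.
  move=> h /=; rewrite /ball /= sub0r normrN !lt_min => /and3P[hdt hp hq] h0.
  have hs : h *: 1 + s - s = h by rewrite addrK -[LHS]/(h * 1) mulr1.
  have /(Hd (h *: 1 + s)) : `[p, q]%classic (h *: 1 + s).
    rewrite /= in_itv /= -[h *: 1]/(h * 1) mulr1.
    by move: hp hq; rewrite !ltr_norml => /andP[? ?] /andP[? ?]; apply/andP; lra.
  rewrite hs => /(_ hdt) Hh.
  have -> : (d : R^o) - h^-1 *: (u (h *: 1 + s) - u s) =
      - h^-1 *: (u (h *: 1 + s) - u s - h *: (d : R^o)).
    by rewrite [RHS]scalerBr scalerA mulNr mulVf// !scaleNr scale1r opprK addrC.
  by rewrite normrZ normrN normfV mulrC ler_pdivrMr ?normr_gt0.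
by apply: DeriveDef; [apply/cvg_ex; exists d | exact/cvg_lim].
Qed.

(** Convergence of column vectors is entrywise. *)
Lemma cvg_col (S : Type) (F : set_system S) (FF : Filter F) n (w : S -> 'cV[R]_n) (l : 'cV[R]_n) :
  (forall i, w t i 0 @[t --> F] --> l i 0) -> w t @[t --> F] --> l.
Proof.
move=> wl; apply/cvgrPdist_le => e e0.
have : \forall t \near F, forall i, `|l i 0 - w t i 0| <= e.
  by apply: filter_forall => i; move/cvgrPdist_le: (wl i); exact.
apply: filterS => t wt; apply: mx_norm_le; first exact: ltW.
by move=> i j; rewrite (ord1 j) !mxE.
Qed.

Lemma within_deriv_col n A (u : R -> 'cV[R]_n) s (d : 'cV[R]_n) :
  (forall i, has_derivative_within A (fun t => u t i 0 : R^o) s (d i 0)) ->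
  has_derivative_within A u s d.
Proof.
move=> H; apply: cvg_col => i.
by under eq_fun do rewrite 3!mxE; exact: H.
Qed.

Lemma within_deriv_entry n A (u : R -> 'cV[R]_n) s (d : 'cV[R]_n) i :
  has_derivative_within A u s d -> has_derivative_within A (fun t => u t i 0 : R^o) s (d i 0).
Proof.
move=> /within_derivP H; apply/within_derivP => e e0; have [dt dt0 Hd] := H e e0.
exists dt => // t At ts; apply: le_trans (Hd t At ts).
by have := entry_le_norm (u t - u s - (t - s) *: d) i 0; rewrite !mxE.
Qed.

End WithinDerivative.

Section Uniqueness.
Variable R : realType.

(** Lipschitz continuity on bounded sets. *)
Definition lipschitz_bounded n (F : 'cV[R]_n -> 'cV[R]_n) := forall B : R,
  exists2 K : R, 0 <= K & forall x y, `|x| <= B -> `|y| <= B -> `|F x - F y| <= K * `|x - y|.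

Lemma continuous_bounded n (u : R -> 'cV[R]_n) (p q : R) : p <= q ->
  {within `[p, q], continuous u} -> exists B : R, forall s, s \in `[p, q] -> `|u s| <= B.
Proof.
move=> pq uc; have nc : {within `[p, q], continuous (fun s => `|u s|)}.
  move=> s; apply: (@continuous_comp _ _ _ (u : subspace _ -> _)); first exact: uc.
  exact: norm_continuous.
have [m _ Hm] := EVT_max pq nc.
by exists `|u m|.
Qed.

(** Gronwall: the squared distance of two solutions, multiplied by exp(C s), is
  nondecreasing; it is zero at time 0, hence at all negative times. *)
Lemma integral_curve_unique n (F : 'cV[R]_n -> 'cV[R]_n) (t : R) (u w : R -> 'cV[R]_n) :
  lipschitz_bounded F -> t <= 0 ->
  integral_curve F t u -> integral_curve F t w -> u 0 = w 0 -> u t = w t.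
Proof.
move=> FL t0; rewrite /integral_curve (min_r t0) (max_l t0) => uF wF uw0.
have [<-//|tn0] := eqVneq 0 t.
have tl0 : t < 0 by rewrite lt_def eq_sym in tn0 *; rewrite tn0.
have uc : {within `[t, 0], continuous u}.
  by apply: within_deriv_continuous => s ts; exists (F (u s)); exact: uF.
have wc : {within `[t, 0], continuous w}.
  by apply: within_deriv_continuous => s ts; exists (F (w s)); exact: wF.
have [B1 HB1] := continuous_bounded t0 uc; have [B2 HB2] := continuous_bounded t0 wc.
have [K K0 HK] := FL (Num.max B1 B2).
pose C : R := 2 * (n%:R * K).
pose sq s : R := \sum_(i < n) (u s i 0 - w s i 0) ^+ 2.
pose G s : R := expR (C * s) * sq s.
have sq0 s : 0 <= sq s by apply: sumr_ge0 => i _; exact: sqr_ge0.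
have Gder s : s \in `]t, 0[ -> is_derive s 1 G (expR (C * s) * (C * sq s +
    \sum_(i < n) 2 * (u s i 0 - w s i 0) * (F (u s) i 0 - F (w s) i 0))).
  move=> sI; have sJ : s \in `[t, 0] by exact: subset_itv_oo_cc.
  have ts0 : t < s < 0 by rewrite in_itv in sI.
  have du i : is_derive s 1 (fun s => u s i 0 : R^o) (F (u s) i 0).
    by apply: (within_deriv_is_derive ts0); exact: within_deriv_entry (uF s sJ).
  have dw i : is_derive s 1 (fun s => w s i 0 : R^o) (F (w s) i 0).
    by apply: (within_deriv_is_derive ts0); exact: within_deriv_entry (wF s sJ).
  have dsq : is_derive s 1 (sq : R -> R^o)
      (\sum_(i < n) 2 * (u s i 0 - w s i 0) * (F (u s) i 0 - F (w s) i 0)).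
    have -> : sq = \sum_(i < n) (fun s => (u s i 0 - w s i 0) ^+ 2 : R^o).
      by apply/funext => x; rewrite fct_sumE.
    apply: is_derive_sum => i.
    have -> : (fun s => (u s i 0 - w s i 0) ^+ 2 : R^o) =
        ((fun s => u s i 0 : R^o) - (fun s => w s i 0 : R^o)) ^+ 2.
      by apply/funext => x; rewrite exprfctE.
    apply: (is_derive_eq (is_deriveX 2 (is_deriveB (du i) (dw i)))).
    by rewrite expr1.
  have dexp : is_derive s 1 (fun s => expR (C * s) : R^o) (expR (C * s) * C).
    have dC : is_derive s 1 (fun s : R => C * s : R^o) C.
      apply: (is_derive_eq (is_deriveZ C (@is_derive_id R R^o s 1))).
      by rewrite -[LHS]/(C * 1) mulr1.
    exact: is_derive1_comp (is_derive_expR _) dC.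
  apply: (is_derive_eq (is_deriveM dexp dsq)).
  set S := \sum_(i < n) _; rewrite -[LHS]/(expR (C * s) * S + sq s * (expR (C * s) * C)).
  by ring.
have Gc : {within `[t, 0], continuous (G : R -> R^o)}.
  have entc i (v : R -> 'cV[R]_n) : {within `[t, 0], continuous v} ->
      {within `[t, 0], continuous (fun s => v s i 0 : R^o)}.
    move=> vc s; apply: (@continuous_comp _ _ _ (v : subspace _ -> _)
      (fun M : 'cV[R]_n => M i 0 : R^o)); first exact: vc.
    exact: coord_continuous.
  have ec : {within `[t, 0], continuous (fun s => expR (C * s) : R^o)}.
    apply: continuous_subspaceT => s; apply: continuous_comp; last exact: continuous_expR.
    exact: mulrl_continuous.
  have sc : {within `[t, 0], continuous (sq : R -> R^o)}.
    have -> : sq = \sum_(i < n) (fun s => (u s i 0 - w s i 0) * (u s i 0 - w s i 0) : R^o).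
      by apply/funext => x; rewrite fct_sumE.
    move=> s; elim/big_ind : _ => [|f1 f2 c1 c2|i _]; first exact: cst_continuous.
      exact: continuousD.
    have cB := continuousB (entc i u uc s) (entc i w wc s).
    exact: (continuousM cB cB).
  by move=> s; exact: (continuousM (ec s) (sc s)).
have Gder0 s : s \in `]t, 0[ -> 0 <= derive1 G s.
  move=> sI; have sJ : s \in `[t, 0] by exact: subset_itv_oo_cc.
  rewrite derive1E; have := @derive_val _ _ _ _ _ _ _ (Gder s sI) => ->.
  rewrite mulr_ge0 ?expR_ge0//.
  have Fl : `|F (u s) - F (w s)| <= K * `|u s - w s|.
    by apply: HK; rewrite le_max ?HB1 ?HB2 ?orbT.
  have dle i : `|u s i 0 - w s i 0| <= `|u s - w s|.
    by have := entry_le_norm (u s - w s) i 0; rewrite !mxE.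
  have Fle i : `|F (u s) i 0 - F (w s) i 0| <= `|F (u s) - F (w s)|.
    by have := entry_le_norm (F (u s) - F (w s)) i 0; rewrite !mxE.
  have nsq : `|u s - w s| ^+ 2 <= sq s.
    have [n0|] := eqVneq `|u s - w s| 0; first by rewrite n0 expr0n.
    move=> /mx_norm_neq0[[i j] /=]; rewrite -[mx_norm _]/(`|u s - w s|) => ->; rewrite (ord1 j) !mxE real_normK ?num_real//.
    by rewrite /sq (bigD1 i)//= lerDl; apply: sumr_ge0 => k _; exact: sqr_ge0.
  have term i : - (2 * (K * sq s)) <= 2 * (u s i 0 - w s i 0) * (F (u s) i 0 - F (w s) i 0).
    have : `|(u s i 0 - w s i 0) * (F (u s) i 0 - F (w s) i 0)| <= K * sq s.
      rewrite normrM; apply: (@le_trans _ _ (`|u s - w s| * (K * `|u s - w s|))).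
        by apply: ler_pM => //; exact: le_trans (Fle i) Fl.
      by rewrite mulrCA -expr2 ler_wpM2l.
    by rewrite ler_norml -mulrA => /andP[+ _]; lra.
  have : \sum_(i < n) - (2 * (K * sq s)) <=
      \sum_(i < n) 2 * (u s i 0 - w s i 0) * (F (u s) i 0 - F (w s) i 0).
    by apply: ler_sum => i _; exact: term.
  rewrite sumr_const card_ord -mulr_natl /C; lra.
have : G t <= G 0.
  apply: (@ger0_derive1_le_cc R G t 0 _ Gder0 Gc); rewrite ?in_itv/= ?lexx ?t0//.
  by move=> s sI; have [] := Gder s sI.
have -> : G 0 = 0.
  by rewrite /G /sq big1 ?mulr0// => i _; rewrite uw0 subrr expr0n.
rewrite /G pmulr_rle0 ?expR_gt0// => sqt; have {}sqt : sq t = 0 by apply/le_anti; rewrite sqt sq0.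
apply/colP => i; apply/eqP; rewrite -subr_eq0 -sqrf_eq0.
move/eqP: sqt; rewrite /sq psumr_eq0; last by move=> j _; exact: sqr_ge0.
by move=> /allP/(_ i (mem_index_enum _)).
Qed.

End Uniqueness.

(** * Power series on the closed disc *)

Section PowerSeries.
Variable R : realType.
Implicit Types (u v : nat -> R).

Lemma lsumB u v : summable1 u -> summable1 v ->
  lsum (fun n => u n - v n) = lsum u - lsum v.
Proof.
move=> uS vS; apply/cvg_lim => //.
have -> : series (fun n => u n - v n) = fun n => series u n - series v n.
  by apply/funext => n; rewrite /series /= -sumrB.
exact: cvgB (summable1_series uS) (summable1_series vS).
Qed.

Lemma lsumZ (c : R) u : summable1 u -> lsum (fun n => c * u n) = c * lsum u.
Proof.
move=> uS; apply/cvg_lim => //.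
have -> : series (fun n => c * u n) = fun n => c * series u n.
  by apply/funext => n; rewrite /series /= mulr_sumr.
by apply: cvgMr; exact: summable1_series.
Qed.

(** A series with finitely many terms. *)
Lemma lsum_finite u K : (forall n, (K <= n)%N -> u n = 0) -> lsum u = \sum_(n < K) u n.
Proof.
move=> u0; apply/cvg_lim => //; apply: cvg_near_cst; exists K => // n /= Kn.
rewrite /series/= (big_cat_nat (n := K))//= [X in _ + X]big_nat_cond [X in _ + X]big1 ?addr0.
  by rewrite big_mkord.
by move=> i /andP[/andP[Ki _] _]; exact: u0.
Qed.

Lemma zero_in_unit : (0 : R) \in `[-1, 1].
Proof. by rewrite in_itv /= lerN10 ler01. Qed.

Lemma unit_exp_le (t : R) n : t \in `[-1, 1] -> `|t ^+ n| <= 1.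
Proof.
rewrite in_itv /= => t1; rewrite normrX exprn_ile1//.
by rewrite ler_norml.
Qed.

Lemma summable1_scale u (t : R) : t \in `[-1, 1] -> summable1 u -> summable1 (fun n => u n * t ^+ n).
Proof.
move=> t1 uS; apply: (@summable1_le R _ u _ uS).1 => n.
by rewrite normrM ler_piMr// unit_exp_le.
Qed.

Lemma expR_scale_unit (l t s : R) : 0 < l -> t <= 0 -> s \in `[-1, 1] ->
  expR (l * t) * s \in `[-1, 1].
Proof.
move=> l0 t0 s1; rewrite in_itv /= -ler_norml normrM ger0_norm ?expR_ge0//.
rewrite mulr_ile1 ?expR_ge0//; first by rewrite -expR0 ler_expR mulr_ge0_le0// ltW.
by rewrite ler_norml; rewrite in_itv in s1.
Qed.

(** Termwise differentiation on the closed interval, one-sided at its end points. *)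
Lemma power_series_within_deriv u (s : R) : summable1 u -> summable1 (fun n => n%:R * u n) ->
  s \in `[-1, 1] ->
  has_derivative_within `[-1, 1] (fun t => lsum (fun n => u n * t ^+ n) : R^o) s
    (lsum (fun n => n%:R * u n * s ^+ n.-1)).
Proof.
move=> uS dS s1.
(* The difference quotient is the series of the w t n, dominated by n |u_n|. *)
pose w (t : R) n := u n * \sum_(i < n) t ^+ (n.-1 - i) * s ^+ i.
have wb (t : R) n : t \in `[-1, 1] -> `|w t n| <= `|n%:R * u n|.
  move=> t1; rewrite /w !normrM mulrC ler_wpM2r//.
  apply: le_trans (ler_norm_sum _ _ _) _.
  apply: (@le_trans _ _ (\sum_(i < n) 1)); last first.
    by rewrite sumr_const card_ord ger0_norm.
  by apply: ler_sum => i _; rewrite normrM mulr_ile1// unit_exp_le.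
have ws n : w s n = n%:R * u n * s ^+ n.-1.
  rewrite /w (eq_bigr (fun=> s ^+ n.-1)) => [|i _].
    by rewrite sumr_const card_ord -mulr_natr; ring.
  by rewrite -exprD subnK// -ltnS prednK// (leq_ltn_trans _ (ltn_ord i)).
have dS' : summable1 (fun n => `|n%:R * u n|).
  by apply: (@summable1_le R _ _ _ dS).1 => n; rewrite normr_id.
have : lsum (w t) @[t --> within `[-1, 1] s^'] --> (lsum (fun n => n%:R * u n * s ^+ n.-1) : R^o).
  apply: (@lsum_cvg R R _ _ w (fun n => `|n%:R * u n|) _ dS').
  - by exists 1 => //= t _ _ ts n; exact: wb.
  - by move=> n; rewrite -ws; exact: wb.
  - move=> n; rewrite -ws; apply: cvgMr; apply: cvg_big; first exact: add_continuous.
    move=> i _; apply: cvgMl; apply: cvg_within_filter.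
    by apply: cvg_within_filter; exact: exprn_continuous.
apply: cvg_trans; apply: near_eq_cvg; exists 1 => //= t _ ts t1.
have nts : t - s != 0 by rewrite subr_eq0.
rewrite -(lsumB (summable1_scale t1 uS) (summable1_scale s1 uS)).
have dS1 : summable1 (fun n => u n * t ^+ n - u n * s ^+ n).
  have [] // := summable1D (summable1_scale t1 uS) (summable1Z (-1) (summable1_scale s1 uS)).1.
  by move=> + _; congr (summable1 _); apply/funext => n; rewrite mulN1r.
rewrite -[_ *: _]/(_ * _ : R) -(lsumZ _ dS1); congr lsum; apply/funext => n.
by rewrite /w -mulrBr subrXX mulrCA mulKf.
Qed.

End PowerSeries.

Lemma is_derive_within_deriv (R : realType) (A : set R) (u : R -> R^o) (s d : R) :
  is_derive s 1 u d -> has_derivative_within A u s d.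
Proof.
move=> [ud <-]; have ud' : differentiable u s by exact/derivable1_diffP.
rewrite deriveE//; apply: (within_deriv_comp_diff (u := id) (G := u) (d := 1 : R^o) ud').
apply/within_derivP => e e0; exists 1 => // t _ _.
by rewrite -[_ *: _]/((t - s) * 1) mulr1 subrr normr0 mulr_ge0// ltW.
Qed.

Section Curve.
Variables (R : realType) (lambda : R) (pn : nat -> 'cV[R]_6).
Hypothesis lambda0 : 0 < lambda.
Hypothesis pnS : forall i, summable1 (component i pn).
Hypothesis pnE : forall n, (n%:R * lambda) *: pn n = fcoef pn n.

(** The parametrization p, and its derivative. *)
Definition curve (t : R) : 'cV[R]_6 := \col_i lsum (fun n => pn n i 0 * t ^+ n).
Definition curve_deriv (t : R) : 'cV[R]_6 :=
  \col_i lsum (fun n => n%:R * pn n i 0 * t ^+ n.-1).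

Lemma curve_series t : t \in `[-1, 1] -> series (fun n => t ^+ n *: pn n) @ \oo --> curve t.
Proof.
move=> t1; apply: cvg_col => i; rewrite mxE.
have := summable1_series (summable1_scale t1 (pnS i)); apply: cvg_trans.
apply: near_eq_cvg; apply: nearW => n; rewrite /series /= summxE.
by apply: eq_bigr => k _; rewrite mxE mulrC.
Qed.

(** n lambda p_n = f_n(p), and f(p) is in l^1 since l^1 is an algebra. *)
Lemma curve_deriv_summable i : summable1 (fun n => n%:R * pn n i 0).
Proof.
have fS : summable1 (fun n => fcoef pn n i 0).
  have [] := leval_summable pnS (fexpr_wf R i).
  by rewrite /summable1; congr (norm1 _ < _)%E; apply/funext => n; rewrite fcoefE.
have [+ _] := summable1Z lambda^-1 fS; rewrite /summable1; congr (norm1 _ < _)%E.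
by apply/funext => n; rewrite -pnE mxE; field; rewrite gt_eqF.
Qed.

Lemma curve_within_deriv t : t \in `[-1, 1] -> has_derivative_within `[-1, 1] curve t (curve_deriv t).
Proof.
move=> t1; apply: within_deriv_col => i.
have -> : (fun s => curve s i 0 : R^o) = fun s => lsum (fun n => pn n i 0 * s ^+ n).
  by apply/funext => s; rewrite mxE.
rewrite [curve_deriv t i 0]mxE.
exact: (power_series_within_deriv (pnS i) (curve_deriv_summable i) t1).
Qed.

Lemma curve_invariance t : t \in `[-1, 1] -> (lambda * t) *: curve_deriv t = f (curve t).
Proof.
move=> t1; apply/colP => i; rewrite fE 2!mxE.
(* Evaluation at t is the sum of the series of the x_n = p_n t^n; the coefficients of
  f(x) are those of f(p) scaled in the same way. *)
pose x k n : R^o := pn n k 0 * t ^+ n.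
have xf : vfin x by move=> k; exact: summable1_scale t1 (pnS k).
have dS : summable1 (fun n => n%:R * pn n i 0 * t ^+ n.-1).
  apply: (@summable1_le R _ _ _ (curve_deriv_summable i)).1 => n.
  by rewrite normrM ler_piMr// unit_exp_le.
transitivity (lsum (leval x (fexpr R i))); last first.
  rewrite (lsum_leval xf (fexpr_wf R i) (fexpr_const R i)); apply: eq_leval => k n _.
  by rewrite /flat; case: eqP => // _; rewrite mxE.
rewrite -(lsumZ _ dS); congr lsum; apply/funext => n.
have scale e m : lconst e -> leval x e m = leval (fun k => component k pn) e m * t ^+ m.
  elim: e m => [s|k|a IHa b IHb|a IHa b IHb|c a IHa] m //=.
  - by case: m => [|m] s0; rewrite ?expr0 ?mulr1// s0// mul0r.
  - by move=> [ca cb]; rewrite IHa// IHb// mulrDl.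
  - move=> [ca cb]; rewrite /Defs.cauchy mulr_suml; apply: eq_bigr => k _.
    rewrite IHa// IHb// mulrACA -exprD subnKC// -ltnS; exact: ltn_ord.
  - by move=> ca; rewrite IHa// mulrA.
rewrite (scale _ _ (fexpr_const R i)) -fcoefE -pnE mxE.
case: n => [|n]; first by rewrite !mul0r mulr0.
by rewrite /= exprS; ring.
Qed.

Lemma curve0 : curve 0 = pn 0%N.
Proof.
apply/colP => i; rewrite mxE (lsum_finite (K := 1)) ?big_ord1 ?expr0 ?mulr1// => n n0.
by rewrite expr0n gtn_eqF// mulr0.
Qed.

Lemma curve_deriv0 : curve_deriv 0 = pn 1%N.
Proof.
apply/colP => i; rewrite mxE (lsum_finite (K := 2)) => [|[|[|n]]//= _].
  by rewrite !big_ord_recl big_ord0 /= !mul0r add0r addr0 expr0 mulr1 mul1r.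
by rewrite exprS mul0r mulr0.
Qed.

(** In the parameter, the flow on the curve is multiplication by exp(lambda t). *)
Lemma curve_integral (s t : R) : s \in `[-1, 1] -> t <= 0 ->
  integral_curve (@f R) t (fun x => curve (expR (lambda * x) * s)).
Proof.
move=> s1 t0; rewrite /integral_curve (min_r t0) (max_l t0) => x xt.
have inI y : y \in `[t, 0] -> expR (lambda * y) * s \in `[-1, 1].
  by rewrite in_itv /= => /andP[_ y0]; exact: expR_scale_unit.
have dphi : is_derive x 1 (fun y => expR (lambda * y) * s : R^o) (lambda * (expR (lambda * x) * s)).
  have dl : is_derive x 1 (fun y : R => lambda * y : R^o) lambda.
    apply: (is_derive_eq (is_deriveZ lambda (@is_derive_id R R^o x 1))).
    by rewrite -[LHS]/(lambda * 1) mulr1.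
  have := is_deriveZ s (is_derive1_comp (is_derive_expR _) dl).
  have -> : s \*: (expR \o (fun y => lambda * y)) = fun y => expR (lambda * y) * s.
    by apply/funext => y; rewrite -[LHS]/(s * _) mulrC.
  by move=> h; apply: (is_derive_eq h); rewrite -[LHS]/(s * _); ring.
have hphi : has_derivative_within `[t, 0] (fun y => expR (lambda * y) * s : R^o) x
    (lambda * (expR (lambda * x) * s)).
  exact: is_derive_within_deriv.
have := within_deriv_comp_real inI (curve_within_deriv (inI x xt)) hphi.
by rewrite -curve_invariance ?inI.
Qed.

End Curve.

(** * Entrywise differentials and Lipschitz bounds *)

Section FieldLipschitz.
Variable R : realType.

(** The constant term of an expression is Lipschitz continuous on bounded sets. *)
Lemma leval0_lipschitz (e : lexpr R) (B : R) : 0 <= B -> exists2 K : R, 0 <= K &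
  forall (x y : 'I_6 -> nat -> R^o) d, 0 <= d ->
  (forall k, [/\ `|x k 0%N| <= B, `|y k 0%N| <= B & `|x k 0%N - y k 0%N| <= d]) ->
  [/\ `|leval x e 0| <= K, `|leval y e 0| <= K & `|leval x e 0 - leval y e 0| <= K * d].
Proof.
move=> B0; elim: e => [s|k|u [Ku Ku0 IHu] v [Kv Kv0 IHv]|u [Ku Ku0 IHu] v [Kv Kv0 IHv]|r u [Ku Ku0 IHu]] /=.
- by exists `|s 0%N| => // x y d d0 _; rewrite subrr normr0 lexx mulr_ge0.
- exists (B + 1); first by rewrite addr_ge0.
  move=> x y d d0 /(_ k)[xB yB xy]; split.
  + by rewrite (le_trans xB)// lerDl.
  + by rewrite (le_trans yB)// lerDl.
  + by rewrite (le_trans xy)// mulrDl mul1r lerDr mulr_ge0.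
- exists (Ku + Kv); first exact: addr_ge0.
  move=> x y d d0 xy; have [ux uy ud] := IHu x y d d0 xy; have [vx vy vd] := IHv x y d d0 xy.
  split.
  + by rewrite (le_trans (ler_normD _ _))// lerD.
  + by rewrite (le_trans (ler_normD _ _))// lerD.
  + by rewrite opprD addrACA mulrDl (le_trans (ler_normD _ _))// lerD.
- exists (Ku * Kv + Ku * Kv); first by rewrite addr_ge0// mulr_ge0.
  move=> x y d d0 xy; have [ux uy ud] := IHu x y d d0 xy; have [vx vy vd] := IHv x y d d0 xy.
  have K0 : 0 <= Ku * Kv by exact: mulr_ge0.
  rewrite /Defs.cauchy !big_ord1 subn0; split.
  + by rewrite normrM (le_trans (ler_pM _ _ ux vx))// lerDl.
  + by rewrite normrM (le_trans (ler_pM _ _ uy vy))// lerDl.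
  + have -> : leval x u 0 * leval x v 0 - leval y u 0 * leval y v 0 =
      (leval x u 0 - leval y u 0) * leval x v 0 + leval y u 0 * (leval x v 0 - leval y v 0).
      by ring.
    rewrite (le_trans (ler_normD _ _))// [leRHS]mulrDl lerD// normrM.
      by rewrite mulrAC ler_pM.
    by rewrite -mulrA ler_pM.
- exists (`|r| * Ku); first exact: mulr_ge0.
  move=> x y d d0 xy; have [ux uy ud] := IHu x y d d0 xy.
  by rewrite -mulrBr !normrM -mulrA !ler_wpM2l.
Qed.

Lemma f_lipschitz : lipschitz_bounded (@f R).
Proof.
move=> B; have B0 : 0 <= `|B| by [].
have HK i : exists K : R, 0 <= K /\ forall X Y : 'cV[R]_6, `|X| <= B -> `|Y| <= B ->
    `|f X i 0 - f Y i 0| <= K * `|X - Y|.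
  have [K K0 HK] := leval0_lipschitz (fexpr R i) B0; exists K; split => // X Y XB YB.
  rewrite !fE; have [] // := HK (flat X) (flat Y) `|X - Y| => //.
  move=> k; rewrite /flat /=; split.
  - exact: le_trans (entry_le_norm X k 0) (le_trans XB (ler_norm B)).
  - exact: le_trans (entry_le_norm Y k 0) (le_trans YB (ler_norm B)).
  - by have := entry_le_norm (X - Y) k 0; rewrite !mxE.
have [K {}HK] := choice HK.
exists (\sum_i K i); first by apply: sumr_ge0 => i _; have [] := HK i.
move=> X Y XB YB; apply: mx_norm_le.
  by rewrite mulr_ge0//; apply: sumr_ge0 => i _; have [] := HK i.
move=> i j; rewrite (ord1 j).
have -> : (f X - f Y) i 0 = f X i 0 - f Y i 0.
  by move: (f X) (f Y) => M1 M2; rewrite !mxE.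
have [_ /(_ X Y XB YB)] := HK i => /le_trans; apply; rewrite ler_wpM2r//.
by rewrite (bigD1 i)//= lerDl; apply: sumr_ge0 => k _; have [] := HK k.
Qed.

End FieldLipschitz.

Section Differentials.
Variable R : realType.

Lemma coord_diff n (k : 'I_n) (q : 'cV[R]_n) :
  differentiable (fun q : 'cV[R]_n => q k 0 : R^o) q /\
  'd (fun q : 'cV[R]_n => q k 0 : R^o) q = (fun h => h k 0) :> ('cV[R]_n -> R^o).
Proof.
have lin : linear (fun h : 'cV[R]_n => h k 0 : R^o) by move=> s h h'; rewrite !mxE.
pose dM := GRing.isLinear.Build _ _ _ _ _ lin.
pose dL : {linear 'cV[R]_n -> R^o} := HB.pack (fun h : 'cV[R]_n => h k 0 : R^o) dM.
apply: (@quadratic_differentiable R _ _ _ dL q 1 1) => // h _.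
rewrite mul1r; split; first exact: entry_le_norm.
by rewrite /= mxE addrK subrr normr0 mul1r exprn_ge0.
Qed.

Lemma usubmx_diff m n (q : 'cV[R]_(m + n)) :
  differentiable (usubmx : 'cV[R]_(m + n) -> 'cV[R]_m) q /\
  'd (usubmx : 'cV[R]_(m + n) -> 'cV[R]_m) q = usubmx :> ('cV[R]_(m + n) -> 'cV[R]_m).
Proof.
have lin : linear (usubmx : 'cV[R]_(m + n) -> 'cV[R]_m).
  by move=> s h h'; apply/matrixP => i j; rewrite !mxE.
pose dM := GRing.isLinear.Build _ _ _ _ _ lin.
pose dL : {linear 'cV[R]_(m + n) -> 'cV[R]_m} := HB.pack (usubmx : 'cV[R]_(m + n) -> 'cV[R]_m) dM.
apply: (@quadratic_differentiable R _ _ _ dL q 1 1) => // h _.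
rewrite mul1r; split.
  by apply: mx_norm_le => // i j; rewrite mxE entry_le_norm.
have -> : usubmx (h + q) - usubmx q - dL h = 0.
  by apply/matrixP => i j; rewrite !mxE addrK subrr.
by rewrite normr0 mul1r exprn_ge0.
Qed.

(** Differentials of vector-valued maps are computed entrywise. *)
Lemma diff_col (W : normedModType R) n (F : W -> 'cV[R]_n) (q : W) :
  (forall i, differentiable (fun q => F q i 0 : R^o) q) ->
  differentiable F q /\ forall h i, 'd F q h i 0 = 'd (fun q => F q i 0 : R^o) q h.
Proof.
move=> Fd; pose e (i : 'I_n) : 'cV[R]_n := delta_mx i 0.
have FE : F = fun q => \sum_(i < n) F q i 0 *: e i.
  apply/funext => x; rewrite {1}(matrix_sum_delta (F x)).
  by apply: eq_bigr => i _; rewrite big_ord1.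
have [Sd SE] := diff_sum (fun i => differentiableZl (e i) (Fd i)).
rewrite {1 2}FE; split => // h i; rewrite SE summxE (bigD1 i)//= big1 ?addr0.
  by rewrite (diffZl _ (Fd i)) !mxE !eqxx mulr1.
by move=> j ji; rewrite (diffZl _ (Fd j)) !mxE eq_sym (negPf ji) mulr0.
Qed.

End Differentials.

Section MuellerBrown.
Variable R : realType.
Implicit Types (j : 'I_4) (q : 'cV[R]_2) (X : 'cV[R]_6).

(** The exponents of the potential, as functions of two coordinates of a point. *)
Definition psi_arg n (k l : 'I_n) j (q : 'cV[R]_n) : R^o :=
  a R j * (q k 0 - xhat R j) ^+ 2 + b R j * (q k 0 - xhat R j) * (q l 0 - yhat R j)
  + c R j * (q l 0 - yhat R j) ^+ 2.

(** The partial derivatives of the exponents, which are the linear forms L_1 and L_2. *)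
Definition slope1 j (x y : R) : R := 2 * a R j * x + b R j * y - w1 R j.
Definition slope2 j (x y : R) : R := b R j * x + 2 * c R j * y - w2 R j.

Lemma psi_arg_diff n (k l : 'I_n) j (q : 'cV[R]_n) : differentiable (psi_arg k l j) q /\
  forall h, 'd (psi_arg k l j) q h =
    slope1 j (q k 0) (q l 0) * h k 0 + slope2 j (q k 0) (q l 0) * h l 0.
Proof.
pose dF (h : 'cV[R]_n) : R^o :=
  slope1 j (q k 0) (q l 0) * h k 0 + slope2 j (q k 0) (q l 0) * h l 0.
have lin : linear dF.
  by move=> s h h'; rewrite /dF !mxE -[s *: _]/(s * _); ring.
pose dM := GRing.isLinear.Build _ _ _ _ _ lin.
pose dL : {linear 'cV[R]_n -> R^o} := HB.pack dF dM.
have [] := @quadratic_differentiable R _ _ (psi_arg k l j) dL q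
  (`|slope1 j (q k 0) (q l 0)| + `|slope2 j (q k 0) (q l 0)| +
   (`|a R j| + `|b R j| + `|c R j|)) 1 ltr01.
  move=> h _; have hk := entry_le_norm h k 0; have hl := entry_le_norm h l 0.
  have h0 : 0 <= `|h| by [].
  split.
    rewrite /dL/= /dF (le_trans (ler_normD _ _))// !normrM mulrDl.
    apply: (@le_trans _ _ ((`|slope1 j (q k 0) (q l 0)| + `|slope2 j (q k 0) (q l 0)|) * `|h|)).
      by rewrite mulrDl lerD// ler_wpM2l.
    by rewrite lerDl mulr_ge0// !addr_ge0.
  have -> : psi_arg k l j (h + q) - psi_arg k l j q - dL h =
      a R j * (h k 0 * h k 0) + b R j * (h k 0 * h l 0) + c R j * (h l 0 * h l 0).
    by rewrite /dL/= /dF /psi_arg !mxE /slope1 /slope2 /w1 /w2; ring.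
  rewrite mulrDl (le_trans (ler_normD _ _))// (le_trans (lerD (ler_normD _ _) (lexx _)))//.
  apply: (@le_trans _ _ ((`|a R j| + `|b R j| + `|c R j|) * `|h| ^+ 2)).
    by rewrite !mulrDl !normrM !lerD// expr2 ler_wpM2l// ler_pM.
  by rewrite lerDr mulr_ge0 ?exprn_ge0// addr_ge0.
by move=> dE ddE; split => // h; rewrite ddE.
Qed.

Lemma expR_comp_diff (W : normedModType R) (F : W -> R^o) (w : W) : differentiable F w ->
  differentiable (fun x => expR (F x) : R^o) w /\
  forall h, 'd (fun x => expR (F x) : R^o) w h = expR (F w) * 'd F w h.
Proof.
move=> Fd; have ed : differentiable (expR : R -> R^o) (F w) by exact/derivable1_diffP/derivable_expR.
split; first exact: (differentiable_comp Fd ed).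
move=> h; transitivity (('d (expR : R -> R^o) (F w) \o 'd F w) h).
  by rewrite -(diff_comp Fd ed).
have e1 : 'd (expR : R -> R^o) (F w) (1 : R) = expR (F w).
  by rewrite -deriveE// derive_val.
have := linearZZ ('d (expR : R -> R^o) (F w)) ('d F w h) (1 : R^o).
rewrite e1 -[X in 'd _ _ X]/('d F w h * 1) mulr1 => E.
transitivity ('d F w h *: expR (F w)); first exact: E.
by rewrite -[LHS]/(_ * _) mulrC.
Qed.

End MuellerBrown.

(** * The graph of psi and the gradient flow *)

Section Lift.
Variable R : realType.
Implicit Types (j : 'I_4) (q h : 'cV[R]_2) (X H : 'cV[R]_6).
Notation s1 j X := (slope1 j (X iX 0) (X iY 0)).
Notation s2 j X := (slope2 j (X iX 0) (X iY 0)).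

(** The embedding of the plane in the invariant graph z = psi(x, y). *)
Definition emb q : 'cV[R]_6 := col_mx q (\col_(j < 4) psi j (q 0 0) (q 1 0)).

Lemma emb_X q : emb q iX 0 = q 0 0. Proof. exact: col_mxEu. Qed.
Lemma emb_Y q : emb q iY 0 = q 1 0. Proof. exact: col_mxEu. Qed.
Lemma emb_Z q j : emb q (iZ j) 0 = psi j (q 0 0) (q 1 0).
Proof. by rewrite [LHS]col_mxEd mxE. Qed.

Lemma usubmx_emb q : usubmx (emb q : 'cV[R]_(2 + 4)) = q. Proof. exact: col_mxKu. Qed.

Lemma usub_X X : (usubmx (X : 'cV[R]_(2 + 4)) : 'cV[R]_2) 0 0 = X iX 0.
Proof. by rewrite mxE. Qed.
Lemma usub_Y X : (usubmx (X : 'cV[R]_(2 + 4)) : 'cV[R]_2) 1 0 = X iY 0.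
Proof. by rewrite mxE. Qed.

Lemma eq_col6 X H : X iX 0 = H iX 0 -> X iY 0 = H iY 0 ->
  (forall j, X (iZ j) 0 = H (iZ j) 0) -> X = H.
Proof.
move=> eX eY eZ; apply/colP => i; rewrite -(splitK (i : 'I_(2 + 4))).
case: (fintype.split _) => [k|j]; last exact: eZ.
have [->|->] : k = 0 \/ k = 1 by case: k => -[|[|//]] k2; [left|right]; exact/val_inj.
  exact: eX.
exact: eY.
Qed.

Lemma eq_col2 q h : q 0 0 = h 0 0 -> q 1 0 = h 1 0 -> q = h.
Proof.
move=> e0 e1; apply/colP => k.
by have [->|->] : k = 0 \/ k = 1 by case: k => -[|[|//]] k2; [left|right]; exact/val_inj.
Qed.

Lemma L1_slope j X : L1 (A := R^o) 1 (fun k => X k 0) j = s1 j X.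
Proof. by rewrite /L1 -[w1 R j *: _]/(w1 R j * 1) mulr1. Qed.

Lemma L2_slope j X : L2 (A := R^o) 1 (fun k => X k 0) j = s2 j X.
Proof. by rewrite /L2 -[w2 R j *: _]/(w2 R j * 1) mulr1. Qed.

Lemma S1_slope X : S1 (A := R^o) *%R 1 (fun k => X k 0) = \sum_(j < 4) s1 j X * X (iZ j) 0.
Proof. by apply: eq_bigr => j _; rewrite L1_slope. Qed.

Lemma S2_slope X : S2 (A := R^o) *%R 1 (fun k => X k 0) = \sum_(j < 4) s2 j X * X (iZ j) 0.
Proof. by apply: eq_bigr => j _; rewrite L2_slope. Qed.

Lemma f_X X : f X iX 0 = - \sum_(j < 4) s1 j X * X (iZ j) 0.
Proof. by rewrite mxE /field_over (unsplitK (inl 0)) /= S1_slope. Qed.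

Lemma f_Y X : f X iY 0 = - \sum_(j < 4) s2 j X * X (iZ j) 0.
Proof. by rewrite mxE /field_over (unsplitK (inl 1)) /= S2_slope. Qed.

Lemma f_Z X j : f X (iZ j) 0 = (s1 j X * f X iX 0 + s2 j X * f X iY 0) * X (iZ j) 0.
Proof.
rewrite f_X f_Y mxE /field_over (unsplitK (inr j)) /= S1_slope S2_slope L1_slope L2_slope.
by rewrite !mulrN -opprD mulNr.
Qed.

Lemma psiE j q : psi j (q 0 0) (q 1 0) = alpha R j * expR (psi_arg 0 1 j q).
Proof. by []. Qed.

Lemma psi_diff j q : differentiable (fun q => psi j (q 0 0) (q 1 0) : R^o) q /\
  forall h, 'd (fun q => psi j (q 0 0) (q 1 0) : R^o) q h =
  (slope1 j (q 0 0) (q 1 0) * h 0 0 + slope2 j (q 0 0) (q 1 0) * h 1 0) * psi j (q 0 0) (q 1 0).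
Proof.
have [gd gE] := psi_arg_diff 0 1 j q; have [ed eE] := expR_comp_diff gd.
have -> : (fun q => psi j (q 0 0) (q 1 0) : R^o) = alpha R j *: (fun q => expR (psi_arg 0 1 j q) : R^o).
  by apply/funext => x.
split; first exact: differentiableZ.
by move=> h; rewrite diffZ//= eE gE psiE -[_ *: _]/(_ * _); ring.
Qed.

(** The differential of the embedding at q, in the direction h. *)
Definition demb q h : 'cV[R]_6 := col_mx h (\col_(j < 4)
  ((slope1 j (q 0 0) (q 1 0) * h 0 0 + slope2 j (q 0 0) (q 1 0) * h 1 0) * psi j (q 0 0) (q 1 0))).

Lemma demb_X q h : demb q h iX 0 = h 0 0. Proof. exact: col_mxEu. Qed.
Lemma demb_Y q h : demb q h iY 0 = h 1 0. Proof. exact: col_mxEu. Qed.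
Lemma demb_Z q h j : demb q h (iZ j) 0 =
  (slope1 j (q 0 0) (q 1 0) * h 0 0 + slope2 j (q 0 0) (q 1 0) * h 1 0) * psi j (q 0 0) (q 1 0).
Proof. by rewrite [LHS]col_mxEd mxE. Qed.

Lemma emb_diff q : differentiable emb q /\ forall h, 'd emb q h = demb q h.
Proof.
have eX : (fun q => emb q iX 0 : R^o) = fun q => q 0 0 by apply/funext => x; rewrite emb_X.
have eY : (fun q => emb q iY 0 : R^o) = fun q => q 1 0 by apply/funext => x; rewrite emb_Y.
have eZ j : (fun q => emb q (iZ j) 0 : R^o) = fun q => psi j (q 0 0) (q 1 0).
  by apply/funext => x; rewrite emb_Z.
have [ed eE] : differentiable emb q /\
    forall h i, 'd emb q h i 0 = 'd (fun q => emb q i 0 : R^o) q h.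
  apply: diff_col => i; rewrite -(splitK (i : 'I_(2 + 4))).
  case: (fintype.split _) => [k|j]; last by have := (psi_diff j q).1; rewrite -eZ.
  have [->|->] : k = 0 \/ k = 1 by case: k => -[|[|//]] k2; [left|right]; exact/val_inj.
    by have := (coord_diff 0 q).1; rewrite -eX.
  by have := (coord_diff 1 q).1; rewrite -eY.
split => // h; apply: eq_col6 => [||j]; rewrite eE.
- by rewrite eX (coord_diff _ _).2 demb_X.
- by rewrite eY (coord_diff _ _).2 demb_Y.
- by rewrite eZ (psi_diff _ _).2 demb_Z.
Qed.

(** - grad V is made of the first two components of f on the graph. *)
Lemma grad_V q : - grad (@V R) q = usubmx (f (emb q) : 'cV[R]_(2 + 4)).
Proof.
have Vd h : 'd (@V R) q h = \sum_(j < 4) 'd (fun q => psi j (q 0 0) (q 1 0) : R^o) q h.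
  exact: (diff_sum (fun j => (psi_diff j q).1)).2.
apply: eq_col2; rewrite [LHS]mxE [grad _ _ _ _]mxE Vd.
  rewrite usub_X f_X; congr (- _); apply: eq_bigr => j _.
  by rewrite (psi_diff _ _).2 emb_X emb_Y emb_Z !mxE /=; ring.
rewrite usub_Y f_Y; congr (- _); apply: eq_bigr => j _.
by rewrite (psi_diff _ _).2 emb_X emb_Y emb_Z !mxE /=; ring.
Qed.

(** f is tangent to the graph, where it is the image of - grad V. *)
Lemma f_emb q : demb q (- grad (@V R) q) = f (emb q).
Proof.
rewrite grad_V; apply: eq_col6 => [||j].
- by rewrite demb_X usub_X.
- by rewrite demb_Y usub_Y.
- by rewrite demb_Z usub_X usub_Y f_Z emb_X emb_Y emb_Z.
Qed.

Lemma emb_integral_curve (t : R) (u : R -> 'cV[R]_2) :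
  integral_curve (fun q => - grad (@V R) q) t u -> integral_curve (@f R) t (emb \o u).
Proof.
move=> uF I s sI; have := within_deriv_comp_diff (emb_diff (u s)).1 (uF s sI).
by rewrite (emb_diff _).2 f_emb.
Qed.

(** z_j exp(- arg_j(x, y)) is a first integral of f. *)
Definition first_integral j X : R^o := X (iZ j) 0 * expR (- psi_arg iX iY j X).

Lemma first_integral_diff j X : differentiable (first_integral j) X /\ 'd (first_integral j) X (f X) = 0.
Proof.
have [zd zE] := coord_diff (iZ j) X.
have [gd gE] := psi_arg_diff iX iY j X.
have gNd := differentiableN gd.
have [ed eE] := expR_comp_diff gNd.
pose zf : 'cV[R]_6 -> R^o := fun X => X (iZ j) 0.
pose ef : 'cV[R]_6 -> R^o := fun X => expR ((- psi_arg iX iY j) X).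
have zE' (h : 'cV[R]_6) : 'd zf X h = h (iZ j) 0 by rewrite zE.
have eE' (h : 'cV[R]_6) : 'd ef X h = ef X * - (s1 j X * h iX 0 + s2 j X * h iY 0).
  by rewrite eE (diffN gd) -gE.
have -> : first_integral j = zf * ef by apply/funext => Y.
split; first exact: (differentiableM zd ed).
have -> : 'd (zf * ef) X (f X) = zf X * 'd ef X (f X) + ef X * 'd zf X (f X).
  by rewrite (diffM zd ed).
by rewrite eE' zE' f_Z /zf; ring.
Qed.

(** An eigenvector of Df at an equilibrium on the graph is tangent to the graph. *)
Lemma eigenvector_tangent q (lambda : R) H : lambda != 0 -> f (emb q) = 0 ->
  Jac (@f R) (emb q) *m H = lambda *: H -> demb q (usubmx (H : 'cV[R]_(2 + 4))) = H.
Proof.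
move=> l0 fq; rewrite Jac_mulmx (f_diff _).2 => AH.
(* At an equilibrium both sums in f vanish, and only their derivatives remain. *)
have AHi i : fderiv (emb q) H i 0 = lambda * H i 0 by rewrite AH mxE.
have fxX : fexpr R iX = Scl (-1) (S1x R) by rewrite /fexpr /iX (unsplitK (inl 0)).
have fxY : fexpr R iY = Scl (-1) (S2x R) by rewrite /fexpr /iY (unsplitK (inl 1)).
have fxZ j : fexpr R (iZ j) = Scl (-1) (Mul (Add (Mul (L1x R j) (S1x R)) (Mul (L2x R j) (S2x R))) (Var _ (iZ j))).
  by rewrite /fexpr /iZ (unsplitK (inr j)).
have S10 : leval (flat (emb q)) (S1x R) 0 = 0.
  have := fE (emb q) iX; rewrite fq mxE fxX /= mulN1r => /eqP; rewrite eq_sym oppr_eq0.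
  by move/eqP.
have S20 : leval (flat (emb q)) (S2x R) 0 = 0.
  have := fE (emb q) iY; rewrite fq mxE fxY /= mulN1r => /eqP; rewrite eq_sym oppr_eq0.
  by move/eqP.
have dS1 : leval (flat (emb q)) (lderiv (flat H) (S1x R)) 0 = - (lambda * H iX 0).
  by rewrite -AHi mxE fxX /= mulN1r opprK.
have dS2 : leval (flat (emb q)) (lderiv (flat H) (S2x R)) 0 = - (lambda * H iY 0).
  by rewrite -AHi mxE fxY /= mulN1r opprK.
apply: eq_col6 => [||j]; first by rewrite demb_X usub_X.
  by rewrite demb_Y usub_Y.
apply: (mulfI l0); rewrite -AHi [fderiv _ _ _ _]mxE fxZ demb_Z usub_X usub_Y.
rewrite [RHS]/= /Defs.cauchy !big_ord1 !subnn S10 S20 dS1 dS2.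
have F0 (X : 'cV[R]_6) k : flat X k 0%N = X k 0 by [].
rewrite -[cauchy1 R ord0]/(1 : R) !F0 emb_X emb_Y emb_Z /slope1 /slope2.
by ring.
Qed.

End Lift.

(** * The unstable manifolds *)

Section Manifolds.
Variable R : realType.

(** A function C with s C'(s) = 0 on [-1, 1] is constant; nothing is assumed on the
  derivative at 0, where continuity is enough. *)
Lemma within_deriv_constant (C d : R -> R^o) (t : R) : t \in `[-1, 1] ->
  (forall s, s \in `[-1, 1] -> has_derivative_within `[-1, 1] C s (d s)) ->
  (forall s, s \in `[-1, 1] -> s * d s = 0) -> C t = C 0.
Proof.
move=> t1 Cd d0.
have Cc : {within `[-1, 1], continuous C}.
  by apply: within_deriv_continuous => s s1; exists (d s); exact: Cd.
have Cder (s : R) : -1 < s < 1 -> s != 0 -> is_derive s 1 C 0.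
  move=> s1 s0; have sI : s \in `[-1, 1].
    by rewrite in_itv /=; case/andP: s1 => /ltW -> /ltW ->.
  have ds : d s = 0 by apply/eqP; have /eqP := d0 s sI; rewrite mulf_eq0 (negPf s0).
  by rewrite -ds; exact: within_deriv_is_derive s1 (Cd s sI).
have on p q : p <= q -> p \in `[-1, 1] -> q \in `[-1, 1] -> (0 <= p) || (q <= 0) -> C q = C p.
  move=> pq; rewrite !in_itv /= => /andP[p1 _] /andP[_ q1] pq0.
  have [//||x _ /eqP] := @MVT_segment R C (fun=> 0) p q pq.
  - move=> x; rewrite in_itv /= => /andP[px xq]; apply: Cder.
      by rewrite (le_lt_trans p1 px) (lt_le_trans xq q1).
    case/orP: pq0 => h; first by rewrite gt_eqF// (le_lt_trans h px).
    by rewrite lt_eqF// (lt_le_trans xq h).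
  - apply: continuous_subspaceW Cc => x /=; rewrite !in_itv /= => /andP[px xq].
    by rewrite (le_trans p1 px) (le_trans xq q1).
  - by rewrite mul0r subr_eq0 => /eqP.
have zI := zero_in_unit R.
have [t0|t0] := leP 0 t; first by apply: on => //; rewrite lexx.
by apply/esym/on => //; [exact: ltW | rewrite lexx orbT].
Qed.

Lemma within_deriv_usubmx (A : set R) (w : R -> 'cV[R]_6) (s : R) d : has_derivative_within A w s d ->
  has_derivative_within A (fun t => usubmx (w t : 'cV[R]_(2 + 4))) s (usubmx (d : 'cV[R]_(2 + 4))).
Proof.
move=> wd; have := within_deriv_comp_diff (@usubmx_diff R 2 4 (w s)).1 wd.
by rewrite (usubmx_diff _).2.
Qed.

Variables (lambda : R) (pn : nat -> 'cV[R]_6) (q0 : 'cV[R]_2).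
Hypothesis lambda0 : 0 < lambda.
Hypothesis pnS : forall i, summable1 (component i pn).
Hypothesis pnE : forall n, (n%:R * lambda) *: pn n = fcoef pn n.
Hypothesis pn0 : pn 0%N = emb q0.
Hypothesis pn1 : pn 1%N != 0.
Hypothesis Apn1 : Jac (@f R) (emb q0) *m pn 1%N = lambda *: pn 1%N.

(** The curve lies in the graph, since the first integrals have the value alpha_j at 0. *)
Lemma curve_graph t : t \in `[-1, 1] ->
  curve pn t = emb (usubmx (curve pn t : 'cV[R]_(2 + 4))).
Proof.
move=> t1; apply: eq_col6 => [||j].
- by rewrite emb_X usub_X.
- by rewrite emb_Y usub_Y.
rewrite emb_Z usub_X usub_Y.
have Ct s : s \in `[-1, 1] -> has_derivative_within `[-1, 1] (first_integral j \o curve pn) s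
    ('d (first_integral j) (curve pn s) (curve_deriv pn s)).
  move=> s1; apply: within_deriv_comp_diff; first exact: (first_integral_diff _ _).1.
  exact: (curve_within_deriv lambda0 pnS pnE s1).
have := within_deriv_constant t1 Ct; rewrite /= (curve0 pn) pn0 => cst.
have {cst} : first_integral j (curve pn t) = first_integral j (emb q0).
  apply: cst => s s1.
  have /eqP : (lambda * s) *: 'd (first_integral j) (curve pn s) (curve_deriv pn s) = 0.
    rewrite -linearZ /= (curve_invariance lambda0 pnS pnE s1).
    exact: (first_integral_diff _ _).2.
  rewrite -[_ *: _]/(_ * _) -mulrA mulf_eq0 gt_eqF//= => /eqP; exact.
have -> : first_integral j (emb q0) = alpha R j.
  rewrite /first_integral emb_Z /psi -mulrA /psi_arg emb_X emb_Y expRN mulfV ?mulr1//.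
  by rewrite gt_eqF ?expR_gt0.
rewrite /first_integral expRN => /(canRL (mulfK _)) ->; first by rewrite invrK.
by rewrite invr_neq0// gt_eqF ?expR_gt0.
Qed.

Lemma manifold_f : local_unstable_manifold (@f R) (emb q0) lambda (curve pn).
Proof.
split.
- apply: within_deriv_continuous => s s1; exists (curve_deriv pn s).
  exact: (curve_within_deriv lambda0 pnS pnE).
- by rewrite curve0.
- exists (pn 1%N); split => //.
  by rewrite -(curve_deriv0 pn); exact: (curve_within_deriv lambda0 pnS pnE (zero_in_unit R)).
- move=> s t s1 t0; have ic := curve_integral lambda0 pnS pnE s1 t0.
  split.
    exists (fun x => curve pn (expR (lambda * x) * s)) => //.
    by rewrite mulr0 expR0 mul1r.
  move=> u uF u0; apply: (integral_curve_unique (@f_lipschitz R) t0 uF ic).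
  by rewrite u0 mulr0 expR0 mul1r.
Qed.

Notation planar := (fun t => usubmx (curve pn t : 'cV[R]_(2 + 4))).
Notation F := (fun q => - grad (@V R) q).

Lemma manifold_V : local_unstable_manifold F q0 lambda planar.
Proof.
have pd t : t \in `[-1, 1] -> has_derivative_within `[-1, 1] planar t
    (usubmx (curve_deriv pn t : 'cV[R]_(2 + 4))).
  by move=> t1; apply: within_deriv_usubmx; exact: (curve_within_deriv lambda0 pnS pnE t1).
pose us : 'cV[R]_6 -> 'cV[R]_2 := usubmx : 'cV[R]_(2 + 4) -> 'cV[R]_2.
have usd (X : 'cV[R]_6) : differentiable us X /\ 'd us X = us :> ('cV[R]_6 -> 'cV[R]_2).
  exact: (@usubmx_diff R 2 4 X).
have FE : F = us \o (@f R \o @emb R) by apply/funext => q; rewrite grad_V.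
have femb0 : f (emb q0) = 0.
  by rewrite -pn0 -fcoef0 -pnE mul0r scale0r.
have tang : demb q0 (usubmx (pn 1%N : 'cV[R]_(2 + 4))) = pn 1%N.
  by apply: eigenvector_tangent femb0 Apn1; rewrite gt_eqF.
split.
- by apply: within_deriv_continuous => t t1; exists (usubmx (curve_deriv pn t : 'cV[R]_(2 + 4))); exact: pd.
- by rewrite (curve0 pn) pn0 usubmx_emb.
- exists (usubmx (pn 1%N : 'cV[R]_(2 + 4))); split.
  + apply: contra_neq pn1 => w0; rewrite -tang w0; apply: eq_col6 => [||j].
    * by rewrite demb_X !mxE.
    * by rewrite demb_Y !mxE.
    * by rewrite demb_Z !mxE !mulr0 addr0 mul0r.
  + rewrite Jac_mulmx FE.
    have ed := (emb_diff q0).1; have fd := (f_diff (emb q0)).1.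
    have fed := differentiable_comp ed fd.
    rewrite (diff_comp fed (usd _).1) (diff_comp ed fd).
    rewrite [LHS](_ : _ = us ('d (@f R) (emb q0) ('d (@emb R) q0 (us (pn 1%N))))); last first.
      exact: (congr1 (fun k => k _) (usd (f (emb q0))).2).
    rewrite (emb_diff q0).2 tang -Jac_mulmx Apn1.
    by apply/colP => i; rewrite !mxE.
  + by rewrite -(curve_deriv0 pn); exact: pd (zero_in_unit R).
- move=> s t s1 t0; have ic := curve_integral lambda0 pnS pnE s1 t0.
  have icV : integral_curve F t (fun x => planar (expR (lambda * x) * s)).
    move=> x xI; have := within_deriv_usubmx (ic x xI); rewrite grad_V -curve_graph//.
    have x0 : x <= 0 by move: xI; rewrite (max_l t0) in_itv /= => /andP[].
    exact: expR_scale_unit lambda0 x0 s1.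
  split.
    by exists (fun x => planar (expR (lambda * x) * s)) => //; rewrite mulr0 expR0 mul1r.
  move=> u uF u0.
  have e : (@emb R \o u) t = (@emb R \o (fun x => planar (expR (lambda * x) * s))) t.
    apply: (integral_curve_unique (@f_lipschitz R) t0 (emb_integral_curve uF)
      (emb_integral_curve icV)).
    by rewrite /= u0 mulr0 expR0 mul1r.
  by rewrite -[LHS]usubmx_emb [emb (u t)]e usubmx_emb.
Qed.

End Manifolds.

Theorem theorem4p15 (R : realType) (x0 y0 lambda mu : R) (Qm : 'M[R]_6)
    (v : 'cV[R]_6) (gamma : R) (N : nat) (eta : 'I_6 -> {posnum R})
    (phat : N.-tuple 'cV[R]_6) (rbar : R) :
  let q0 : 'cV[R]_2 := \col_i [:: x0; y0]`_i in
  let X0 : 'cV[R]_6 := col_mx q0 (\col_(i < 4) psi i x0 y0) in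
  let A := Jac (@f R) X0 in
  let Y := Y eta phat A lambda in
  let Z := Z eta phat A Qm lambda in
  let P (r : R) := Z 4%N / 24 * r ^+ 4 + Z 3%N / 6 * r ^+ 3 + Z 2%N / 2 * r ^+ 2
                   - (1 - Z 1%N) * r + Y in
  let Q (r : R) := Z 4%N / 6 * r ^+ 3 + Z 3%N / 2 * r ^+ 2 + Z 2%N * r - (1 - Z 1%N) in
  saddle_point q0 lambda mu ->
  Qm \in unitmx ->
  A = invmx Qm *m diag_mx (\row_i [:: lambda; mu; 0; 0; 0; 0]`_i) *m Qm ->
  v != 0 -> A *m v = lambda *: v ->
  0 < gamma -> (2 <= N)%N ->
  phat`_0 = X0 -> phat`_1 = gamma *: v ->
  (forall n, (2 <= n < N)%N ->
    (n%:R * lambda) *: phat`_n = fcoef (fun m => phat`_m) n) ->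
  0 < rbar -> P rbar < 0 -> Q rbar < 0 ->
  exists (pn : nat -> 'cV[R]_6) (p : R -> 'cV[R]_6),
    [/\ (forall n, (n < N)%N -> pn n = phat`_n),
        (\sum_(i < 6) \sum_(N <= n <oo) (`|pn n i 0| * (eta i)%:num)%:E
           <= rbar%:E)%E,
        (forall theta, theta \in `[-1, 1] ->
           series (fun n => theta ^+ n *: pn n) @ \oo --> p theta) &
        [/\ (forall theta, theta \in `[-1, 1] ->
              exists2 dp, has_derivative_within `[-1, 1] p theta dp &
                (lambda * theta) *: dp = f (p theta)),
            local_unstable_manifold (@f R) X0 lambda p &
            local_unstable_manifold (fun q => - grad (@V R) q) q0 lambda
              (fun theta => usubmx (p theta : 'cV[R]_(2 + 4)))]].
Proof.
move=> q0 X0 A Y Z P Q [gV lambda0 mu0 _ _] Qu AE v0 Av gamma0 N2 p0 p1 pE rbar0 Pr _.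
have X0E : X0 = emb q0.
  by apply: eq_col6 => [||j]; rewrite /X0 /emb !mxE//; case: (fintype.split _) => k; rewrite !mxE.
clearbody X0; clearbody q0.
have fX0 : f phat`_0 = 0.
  by rewrite p0 X0E -f_emb gV oppr0; apply: eq_col6 => [||j];
    rewrite ?demb_X ?demb_Y ?demb_Z !mxE ?mulr0 ?addr0 ?mul0r.
have A0 : A = Jac (@f R) phat`_0 by rewrite p0.
have A1 : Jac (@f R) phat`_0 *m phat`_1 = lambda *: phat`_1.
  by rewrite -A0 p1 -scalemxAr Av scalerA mulrC -scalerA.
have AE' : Jac (@f R) phat`_0 =
    invmx Qm *m diag_mx (\row_i [:: lambda; mu; 0; 0; 0; 0]`_i) *m Qm by rewrite -A0.
(* This is P(rbar) <= 0, with the factor frakM_N taken out of the Z_k. *)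
have bound : Defs.Y eta phat (Jac (@f R) phat`_0) lambda +
    frakM eta (Jac (@f R) phat`_0) Qm lambda N *
    \sum_(k < 4) (k.+1`!)%:R^-1 * (Zmax eta phat k.+1 * rbar ^+ k.+1) <= rbar.
  rewrite -A0; move: Pr; rewrite /P /Z /Defs.Z -/(Zmax eta phat _) !big_ord_recl big_ord0 /=.
  move=> h; apply/ltW; rewrite -subr_lt0; apply: le_lt_trans h.
  rewrite le_eqVlt; apply/orP; left; apply/eqP.
  rewrite /bump /= !factS fact0 /Y -/(Zmax eta phat 1) -/(Zmax eta phat 2)
    -/(Zmax eta phat 3) -/(Zmax eta phat 4).
  by field.
have bnd := coefs_bound N2 Qu AE' lambda0 mu0 (ltW rbar0) bound.
have pnE := coefs_invariance N2 Qu AE' lambda0 mu0 fX0 A1 pE.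
have pnp n : (n < N)%N -> coefs phat lambda n = phat`_n by exact: coefs_phat.
move: (coefs phat lambda) => pn in bnd pnE pnp *.
have pnS := vnorm_tail_summable bnd.
have pn0 : pn 0%N = emb q0 by rewrite (pnp 0%N (ltnW N2)) p0 X0E.
have pn1 : pn 1%N = gamma *: v by rewrite (pnp 1%N N2) p1.
have pn10 : pn 1%N != 0 by rewrite pn1 scaler_eq0 negb_or v0 gt_eqF.
have Apn1 : Jac (@f R) (emb q0) *m pn 1%N = lambda *: pn 1%N.
  by rewrite -X0E (pnp 1%N N2) -p0.
exists pn, (curve pn); split.
- exact: pnp.
- exact: (vnorm_tail_le bnd).
- exact: (curve_series pnS).
- split.
  + move=> t t1; exists (curve_deriv pn t); first exact: (curve_within_deriv lambda0 pnS pnE).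
    exact: (curve_invariance lambda0 pnS pnE).
  + by rewrite X0E; exact: (manifold_f lambda0 pnS pnE pn0 pn10 Apn1).
  + exact: (manifold_V lambda0 pnS pnE pn0 pn10 Apn1).
Qed.
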